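(* Let $N\in\mathbb{N}\cup\{0\}$, $a\in A_N$ and $d\in\{\pm1\}^N$. Then for any $c_0>0$ there exists $r>0$ such that for any $b\in A_N$ the following holds true. If $|b_n-a_n|\le r$ for $n=1,\dots,N$, then for any $\epsilon\in(0,\frac14]$, $$\Bigl|\inf_{M(a,d)}E_\epsilon-\inf_{M(b,d)}E_\epsilon\Bigr|\le\frac{c_0}{(\log\delta)^2},$$ where $\delta=\epsilon\log\frac1\epsilon$.
   Context: Fix $\alpha\in(0,\pi)$. For $m=(m_1,m_2)\in H^1((-1,1);\mathbb{S}^1)$ with $m_1(-1)=m_1(1)=\cos\alpha$, extend $m_1$ to $\mathbb{R}$ by the constant $\cos\alpha$ outside $(-1,1)$ and set, for $\epsilon>0$, $$E_\epsilon(m)=\frac\epsilon2\int_{-1}^1|m'|^2\,dx_1+\frac12\|m_1-\cos\alpha\|_{\dot H^{1/2}(\mathbb{R})}^2,\qquad \|f\|_{\dot H^{1/2}(\mathbb{R})}^2=\frac1{2\pi}\int_{-\infty}^\infty\int_{-\infty}^\infty\frac{(f(s)-f(t))^2}{(s-t)^2}\,ds\,dt.$$ For $N\in\mathbb{N}\cup\{0\}$ let $A_N=\{a\in(-1,1)^N: -1<a_1<\dots<a_N<1\}$ (for $N=0$ this consists of the empty tuple). For $a\in A_N$ and $d\in\{\pm1\}^N$ let $$M(a,d)=\{m\in H^1((-1,1);\mathbb{S}^1): m_1(a_n)=d_n\text{ for }n=1,\dots,N\text{ and }m_1(-1)=m_1(1)=\cos\alpha\}.$$ *)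

(* Defs.v *)
From HB Require Import structures.
From mathcomp Require Export all_boot all_order all_algebra.
From mathcomp Require Export all_classical all_reals all_analysis.
Export Order.TTheory GRing.Theory Num.Theory.
Export numFieldNormedType.Exports.

#[export] Set Implicit Arguments.
#[export] Unset Strict Implicit.
#[export] Unset Printing Implicit Defensive.

Local Open Scope classical_set_scope.
Local Open Scope ring_scope.

(* Functions on the interval (-1,1) or [-1,1] are represented by total functions
   on R whose values outside the interval are irrelevant. *)

Definition L2 (R : realType) (u : R -> R) : Prop :=
  (u \_ `]-1, 1[ : R -> R) \in Lfun (@lebesgue_measure R) 2%:E.

(* The space C^1_c((-1,1)); elements are extended by 0 to the whole line. *)
Definition test_function (R : realType) (phi : R -> R) : Prop :=
  [/\ forall x, derivable phi x 1,
      continuous (derive1 phi),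
      compact (closure [set x | phi x != 0]) &
      closure [set x | phi x != 0] `<=` `]-1, 1[].

(* The weak derivatives of u on (-1,1) that belong to L^2((-1,1)). *)
Definition weak_derivatives (R : realType) (u : R -> R) : set (R -> R) :=
  [set g | L2 g /\ forall phi, test_function phi ->
    \int[@lebesgue_measure R]_(x in `]-1, 1[) (u x * derive1 phi x) =
    - \int[@lebesgue_measure R]_(x in `]-1, 1[) (g x * phi x)].

(* u belongs to H^1((-1,1)).  An element of H^1((-1,1)) is a class of functions
   modulo equality almost everywhere and is identified, as is usual whenever
   pointwise values are used, with its unique representative that is continuous
   on [-1,1]. *)
Definition H1 (R : realType) (u : R -> R) : Prop :=
  [/\ L2 u, weak_derivatives u !=set0 & {within `[-1, 1], continuous u}].

(* A version of the weak derivative, which is unique up to a null set. *)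
Definition weak_derivative (R : realType) (u : R -> R) : R -> R :=
  xget (cst 0) (weak_derivatives u).

(* H^1((-1,1); S^1) *)
Definition H1S1 (R : realType) : set (R -> R * R) :=
  [set m | [/\ H1 (fst \o m), H1 (snd \o m) &
    forall x, x \in `[-1, 1] -> (m x).1 ^+ 2 + (m x).2 ^+ 2 = 1]].

(* Squared seminorm; the integrand is 0 on the diagonal, which is a null set. *)
Definition Hhalf_seminorm2 (R : realType) (f : R -> R) : \bar R :=
  ((2 * pi)^-1%:E *
   \int[@lebesgue_measure R]_s \int[@lebesgue_measure R]_t
     ((f s - f t) ^+ 2 / (s - t) ^+ 2)%:E)%E.

Definition extend_cos (R : realType) (alpha : R) (u : R -> R) : R -> R :=
  fun x => if x \in `]-1, 1[ then u x else cos alpha.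

(* The integral over (-1,1) of |m'|^2. *)
Definition dirichlet (R : realType) (m : R -> R * R) : \bar R :=
  \int[@lebesgue_measure R]_(x in `]-1, 1[)
    (weak_derivative (fst \o m) x ^+ 2 + weak_derivative (snd \o m) x ^+ 2)%:E.

Definition energy (R : realType) (alpha eps : R) (m : R -> R * R) : \bar R :=
  ((eps / 2)%:E * dirichlet m +
   2^-1%:E * Hhalf_seminorm2
     (fun x => extend_cos alpha (fst \o m) x - cos alpha)%R)%E.

Definition positions (R : realType) (N : nat) : set ('I_N -> R) :=
  [set a | (forall n, -1 < a n < 1) /\
           (forall i j : 'I_N, (i < j)%N -> a i < a j)].

Definition signs (R : realType) (N : nat) : set ('I_N -> R) :=
  [set d | forall n, d n = 1 \/ d n = -1].

Definition admissible (R : realType) (alpha : R) (N : nat) (a d : 'I_N -> R) :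
    set (R -> R * R) :=
  [set m | [/\ H1S1 m, forall n, (m (a n)).1 = d n,
               (m (-1)).1 = cos alpha & (m 1).1 = cos alpha]].

Definition inf_energy (R : realType) (alpha eps : R) (N : nat)
    (a d : 'I_N -> R) : \bar R :=
  ereal_inf [set energy alpha eps m | m in admissible alpha a d].

(* Main.v *)
From HB Require Import structures.
Require Import Defs.
From mathcomp Require Import measurable_realfun lra.

(**
 Write f = m_1 - cos alpha, extended by 0 to the line, gamma_n = d_n - cos alpha
 for the height of the n-th wall, and Gamma for the sum of the gamma_n^2.  The
 infimum of the energy is K Gamma / (pi L) + O(1 / L^2), where L is the logarithm
 of the ratio of a fixed core radius rho to the wall width sig = kappa delta,
 and where the leading term does not see the positions of the walls.  Such an
 expansion alone would only compare two infima up to a multiple of 1 / L^2.  The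
 gain of an arbitrary factor c_0 comes from the form of the remainder: moving the
 walls costs nothing but a small multiple of the part of the energy that is
 already of order 1 / L^2.

 Lower bound.  In polar coordinates t = +- l s (lemma polar) the seminorm becomes
 an integral over ratios l > 1 of the increments F s - F (l s) against ds / s.
 Integrating 2 c (F s - F (l s)) <= (F s - F (l s))^2 + c^2 against ds / s, the
 left-hand side telescopes (telescope_lower), and c proportional to gamma_n ln l / L
 gives the sharp constant for each wall (wall_lower_pos).  The errors are absorbed
 by the Dirichlet energy and by the seminorm of the pairs of points that do not
 lie in a common core: on the circle m_1 leaves its extreme value d_n at a rate
 controlled by the Dirichlet energy (wall_core), and the boundary terms of the
 telescoping are controlled by interactions with the zero set of f
 (off_controls_core).  The result, energy_lower, keeps a fraction of both
 absorbing terms on the left.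

 Upper bound.  A profile that is affine in ln s between sig and rho, smoothed at
 both ends so that both components of m are C^1, matches the lower bound up to
 O(1 / L^2) (psi_energy, competitor_energy).

 Comparison.  Together the two bounds show that for a competitor m which is nearly
 minimal, the Dirichlet energy times eps and the seminorm over pairs outside the
 cores are O(1 / L^2) (excess_energy).  Let Phi be a diffeomorphism that is a
 translation on each core, carries the walls of one configuration to those of the
 other, and is C^1-close to the identity at the order r / rho.  Composition with
 Phi leaves the pairs inside a core unchanged, so it increases the energy by at
 most O(r / rho) times these two small quantities (moving_energy).  Hence the
 infima differ by O(r / L^2), and L >= |ln delta|.
*)

Local Open Scope classical_set_scope.
Local Open Scope ring_scope.

(** * Change of variables on the line *)

Section change_of_variables.
Import HBNNSimple.
Context {R : realType}.
Local Notation mu := (@lebesgue_measure R).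

(** theta is only asked to be nonnegative, so that the signed square y |y|
    is covered. *)
Definition diffeo (Phi theta : R -> R) : Prop :=
  [/\ {homo Phi : x y / x < y},
      forall y, exists x, Phi x = y,
      forall x : R, is_derive x 1 Phi (theta x),
      continuous theta &
      forall x, 0 <= theta x].

Variables (Phi theta : R -> R).

Lemma diffeo_mono : {homo Phi : x y / x < y} -> {mono Phi : x y / x <= y}.
Proof. exact: le_mono. Qed.

(** The pull-back of the density theta, to be identified with the Lebesgue
    measure. *)
Definition subst_measure (H : diffeo Phi theta) :
    set (measurableTypeR R) -> \bar R := fun A =>
  (\int[mu]_(x in Phi @^-1` A) (theta x)%:E)%E.

Lemma diffeo_continuous : diffeo Phi theta -> continuous Phi.
Proof.
move=> [_ _ d _ _] x; apply: differentiable_continuous; apply/derivable1_diffP.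
by case: (d x).
Qed.

Lemma diffeo_measurable : diffeo Phi theta -> measurable_fun setT Phi.
Proof. by move=> /diffeo_continuous/continuous_measurable_fun. Qed.

Lemma diffeo_derivative_measurable : diffeo Phi theta -> measurable_fun setT theta.
Proof. by move=> [_ _ _ /continuous_measurable_fun]. Qed.

Variable H : diffeo Phi theta.

Let subst0 : subst_measure H set0 = 0%E.
Proof. by rewrite /subst_measure preimage_set0 integral_set0. Qed.

Let theta_ge0 x : 0 <= theta x. Proof. by case: H. Qed.

Let subst_ge0 U : (0 <= subst_measure H U)%E.
Proof. by apply: integral_ge0 => x _; rewrite lee_fin. Qed.

Let mPhi (A : set (measurableTypeR R)) :
  measurable A -> measurable (Phi @^-1` A : set (measurableTypeR R)).
Proof.
by move=> mA; rewrite -[X in measurable X]setTI; exact: diffeo_measurable.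
Qed.

Let subst_sigma_additive : semi_sigma_additive (subst_measure H).
Proof.
move=> /= F mF tF mUF; rewrite /subst_measure; apply: cvg_toP.
  apply: ereal_nondecreasing_is_cvgn => m n mn.
  apply: lee_sum_nneg_natr => // k _ _.
  by apply: integral_ge0 => /= x Fkx; rewrite lee_fin.
rewrite preimage_bigcup ge0_integral_bigcup//=.
- by move=> i; exact: mPhi.
- apply: measurable_funTS; apply: measurableT_comp => //.
  exact: diffeo_derivative_measurable.
- by move=> x _; rewrite lee_fin.
- apply/trivIsetP => i j _ _ ij; rewrite -preimage_setI.
  by move/trivIsetP : tF => ->//; rewrite preimage_set0.
Qed.

HB.instance Definition _ := isMeasure.Build _ _ _ (subst_measure H)
  subst0 subst_ge0 subst_sigma_additive.

(** On a bounded interval this is the fundamental theorem of calculus, and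
    the Lebesgue measure is determined by its values on intervals. *)
Lemma subst_measureE A : measurable A -> subst_measure H A = mu A.
Proof.
move=> mA; apply/esym/(@lebesgue_measure_unique _ (subst_measure H)) => // X.
have [hom sur der cth _] := H; move=> [[a b]] _ <-; rewrite /=.
rewrite lebesgue_measure_itv/= lte_fin /subst_measure.
have [ab|ba] := ltP a b; last first.
  by rewrite set_itv_ge ?preimage_set0 ?integral_set0// bnd_simp -leNgt.
have [c ca] := sur a; have [d db] := sur b.
have cd : c < d by rewrite -(leW_mono (diffeo_mono hom)) ca db.
have -> : Phi @^-1` [set` `]a, b]] = [set` `]c, d]].
  apply/seteqP; split => x /=; rewrite !in_itv/= -ca -db.
    by rewrite (leW_mono (diffeo_mono hom)) (diffeo_mono hom).
  by rewrite (leW_mono (diffeo_mono hom)) (diffeo_mono hom).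
rewrite integral_itv_obnd_cbnd; last first.
  apply: measurable_funTS; apply: measurableT_comp => //.
  exact: diffeo_derivative_measurable.
rewrite -ca -db (@continuous_FTC2 _ theta Phi c d) => [|//|||].
- by [].
- exact: continuous_subspaceT.
- split => [x _||]; first by case: (der x).
    by apply: cvg_at_right_filter; exact: diffeo_continuous.
  by apply: cvg_at_left_filter; exact: diffeo_continuous.
- by move=> x _; rewrite derive1E; apply: derive_val.
Qed.

Let nnsfun_subst (f : {nnsfun measurableTypeR R >-> R}) :
  (\int[mu]_x (f x)%:E = \int[mu]_x ((f (Phi x))%:E * (theta x)%:E))%E.
Proof.
under [LHS]eq_integral do rewrite fimfunE -fsumEFin//.
rewrite [LHS]ge0_integral_fsum//; last 2 first.
  - by move=> r; exact/measurable_EFinP/measurable_funM.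
  - by move=> n x _; rewrite nnfun_muleindic_ge0.
have mth : measurable_fun (setT : set (measurableTypeR R)) theta.
  exact: diffeo_derivative_measurable H.
have mP : measurable_fun (setT : set (measurableTypeR R)) Phi.
  exact: diffeo_measurable H.
have mi k : measurable_fun setT (\1_(f @^-1` [set k]) : R -> R).
  exact: (@measurable_indic _ (measurableTypeR R)).
have miP k : measurable_fun setT (fun x : measurableTypeR R => \1_(f @^-1` [set k]) (Phi x) : R).
  exact: (measurableT_comp (mi k)).
under [RHS]eq_integral.
  move=> x xD; rewrite fimfunE -fsumEFin// muleC ge0_mule_fsumr; last first.
    by move=> r; rewrite EFinM nnfun_muleindic_ge0.
  over.
rewrite [RHS]ge0_integral_fsum//; last 2 first.
  - move=> r; apply: emeasurable_funM; first exact/measurable_EFinP.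
    by apply/measurable_EFinP; apply: measurable_funM; [exact: measurable_cst|exact: miP].
  - move=> n x _; rewrite mule_ge0 ?lee_fin//.
    by have := nnfun_muleindic_ge0 f n (Phi x); rewrite -EFinM lee_fin.
apply: eq_fsbigr => r _.
under [RHS]eq_integral do rewrite EFinM muleCA.
have [r0|r0] := ltP r 0.
  have E0 x : (\1_(f @^-1` [set r]) x = 0 :> R).
    by rewrite preimage_nnfun0// indicE in_set0.
  by rewrite !integral0_eq// => x _; rewrite E0 ?mulr0 ?mule0.
under [LHS]eq_integral do rewrite EFinM.
have mf : measurable (f @^-1` [set r]) by [].
rewrite !ge0_integralZl ?lee_fin//.
- congr (_ * _)%E; rewrite integral_indic//= setIT -subst_measureE//.
  rewrite /subst_measure [LHS]integral_mkcond; apply: eq_integral => x _.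
  rewrite patchE indicE; case: ifPn; rewrite ?inE//=.
    by move=> h; rewrite mem_set//= mule1.
  by rewrite notin_setE/= => h; rewrite memNset//= mule0.
- by apply: emeasurable_funM; apply/measurable_EFinP; [exact: mth|exact: miP].
- by move=> x _; rewrite mule_ge0 ?lee_fin.
- exact/measurable_EFinP.
Qed.

(** The equality of measures passes to simple functions and then, by
    monotone convergence, to nonnegative measurable functions. *)
Lemma ge0_integral_subst (f : measurableTypeR R -> \bar R) :
  measurable_fun setT f -> (forall x, 0 <= f x)%E ->
  (\int[mu]_x f x = \int[mu]_x (f (Phi x) * (theta x)%:E))%E.
Proof.
move=> mf f0.
have mth : measurable_fun (setT : set (measurableTypeR R)) theta.
  exact: diffeo_derivative_measurable H.
have mP : measurable_fun (setT : set (measurableTypeR R)) Phi.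
  exact: diffeo_measurable H.
pose f_ := nnsfun_approx measurableT mf.
transitivity (lim (\int[mu]_x (f_ n x)%:E @[n --> \oo])%E).
  rewrite -monotone_convergence//=.
  - apply: eq_integral => ? /[!inE] xD; apply/esym/cvg_lim => //=.
    exact: cvg_nnsfun_approx.
  - by move=> n; exact/measurable_EFinP/measurable_funTS.
  - by move=> n ? _; rewrite lee_fin.
  - by move=> ? _ ? ? mn; rewrite lee_fin; exact/lefP/nd_nnsfun_approx.
under eq_fun do rewrite nnsfun_subst.
rewrite -monotone_convergence//=.
- apply: eq_integral => x _; apply/cvg_lim => //; rewrite muleC.
  under eq_fun do rewrite muleC.
  by apply: cvgeZl => //; exact: cvg_nnsfun_approx.
- move=> n; apply: emeasurable_funM; apply/measurable_EFinP; last exact: mth.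
  exact: (measurableT_comp (f := f_ n)).
- by move=> n x _; rewrite mule_ge0 ?lee_fin.
- move=> x _ a b ab; rewrite lee_wpmul2r ?lee_fin//.
  by have /lefP := nd_nnsfun_approx measurableT mf ab; apply.
Qed.

End change_of_variables.

Section substitutions.
Context {R : realType}.
Local Notation mu := (@lebesgue_measure R).
Local Notation RR := (measurableTypeR R).

Lemma diffeo_affine (c d : R) : 0 < c -> diffeo (fun x => c * x + d) (cst c).
Proof.
move=> c0; split.
- by move=> x y xy; rewrite ltrD2r ltr_pM2l.
- by move=> y; exists ((y - d) / c); rewrite mulrC divfK ?gt_eqF// subrK.
- move=> x; apply: is_derive_eq; rewrite ?addr0 ?mulr0 ?addr0 /GRing.scale/= ?mulr1 ?mulr0 ?addr0.
  by [].
- by move=> x; exact: cvg_cst.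
- by move=> x; exact: ltW.
Qed.

Lemma integral_scale (c : R) (f : RR -> \bar R) : 0 < c ->
  measurable_fun setT f -> (forall x, 0 <= f x)%E ->
  (\int[mu]_x f x = \int[mu]_x (f (c * x)%R * c%:E))%E.
Proof.
move=> c0 mf f0; rewrite (ge0_integral_subst (diffeo_affine 0 c0) mf f0).
by apply: eq_integral => x _; rewrite addr0.
Qed.

Lemma integral_shift (c : R) (f : RR -> \bar R) :
  measurable_fun setT f -> (forall x, 0 <= f x)%E ->
  (\int[mu]_x f x = \int[mu]_x f (x + c)%R)%E.
Proof.
move=> mf f0; rewrite (ge0_integral_subst (diffeo_affine c ltr01) mf f0).
by apply: eq_integral => x _; rewrite mul1r mule1.
Qed.

Lemma integral_opp (f : RR -> \bar R) :
  measurable_fun setT f -> (forall x, 0 <= f x)%E ->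
  (\int[mu]_x f x = \int[mu]_x f (- x)%R)%E.
Proof.
move=> mf f0.
transitivity (\int[pushforward mu (-%R : RR -> RR)]_(x in setT) f x)%E.
  apply: eq_measure_integral => A mA _; apply/esym.
  exact: lebesgue_measureN.
rewrite ge0_integral_pushforward//.
Qed.

Lemma measurable_invr : measurable_fun [set: RR] (fun x : RR => x^-1 : R).
Proof.
have -> : [set: RR] = [set 0 : R] `|` [set~ 0].
  by apply/seteqP; split => x // _; have [->|/eqP] := eqVneq x 0; [left|right].
apply/measurable_funU => //; first exact: measurableC.
split.
  exact: measurable_fun_set1.
apply: open_continuous_measurable_fun.
  by apply: closed_openC; exact: closed_eq.
by move=> x; rewrite inE/= => /eqP x0; exact: inv_continuous x0.
Qed.

Lemma measurable_funV d (T : measurableType d) (D : set T) (f : T -> R) :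
  measurable_fun D f -> measurable_fun D (fun x => (f x)^-1).
Proof. by move=> mf; exact: (measurableT_comp measurable_invr). Qed.

Lemma integral_pos_neg (f : RR -> \bar R) :
  measurable_fun setT f -> (forall x, 0 <= f x)%E ->
  (\int[mu]_x f x = \int[mu]_(x in `]0%R, +oo[) (f x + f (- x)%R))%E.
Proof.
move=> mf f0.
have mfN : measurable_fun setT (fun x : RR => f (- x)%R).
  by apply: measurableT_comp => //; exact: oppr_measurable.
rewrite ge0_integralD//; [|exact: measurable_funTS..].
have -> : [set: R] = `]-oo, 0%R[ `|` ([set 0%R] `|` `]0%R, +oo[).
  apply/seteqP; split => x // _ /=; rewrite !in_itv/= andbT.
  by have [x0|x0|->] := ltgtP x 0; [left|right;right|right;left].
rewrite ge0_integral_setU//=; first last.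
- rewrite disj_set2E; apply/eqP/seteqP; split => x //= [].
  by rewrite !in_itv/= => x0 [x0'|]; [move: x0; rewrite x0'|rewrite andbT]; lra.
- exact: measurable_funTS.
- exact: measurableU.
rewrite ge0_integral_setU//=; first last.
- rewrite disj_set2E; apply/eqP/seteqP; split => x //= [] -> .
  by rewrite !in_itv/= ltxx.
- exact: measurable_funTS.
rewrite integral_set1 add0e addeC; congr (_ + _)%E.
rewrite [LHS]integral_mkcond integral_opp.
- rewrite [RHS]integral_mkcond; apply: eq_integral => x _.
  rewrite !patchE; congr (if _ then _ else _).
  by apply/idP/idP; rewrite !inE/= !in_itv/= andbT; lra.
- by apply/(measurable_restrictT f) => //; exact: measurable_funTS.
- by move=> x; exact: erestrict_ge0.
Qed.

End substitutions.

(** * Polar decomposition of double integrals *)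

(** Measurability by structural recursion through arithmetic operations,
    comparisons, conditionals and pairs. *)
Ltac meas1 := first
  [ assumption
  | match goal with
    | H : measurable_fun _ ?f |- measurable_fun _ (fun x => ?f (@?g x)) =>
        apply: (measurableT_comp H)
    end
  | lazymatch goal with
    | |- measurable_fun _ (fun x => @?f x * @?g x) => apply: measurable_funM
    | |- measurable_fun _ (fun x => @?f x + @?g x) =>
        first [apply: measurable_funD | apply: emeasurable_funD]
    | |- measurable_fun _ (fun x => - @?g x) => apply: measurable_funN
    | |- measurable_fun _ (fun x => @?g x ^+ _) => apply: measurable_funX
    | |- measurable_fun _ (fun x => (@?g x)^-1) => apply: measurable_funV
    | |- measurable_fun _ (fun x => (@?f x * @?g x)%E) => apply: emeasurable_funM
    | |- measurable_fun _ (fun x => (@?f x)%:E) => apply/measurable_EFinP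
    | |- measurable_fun _ (fun x => @?f x && @?g x) => apply: measurable_and
    | |- measurable_fun _ (fun x => @?f x < @?g x) => apply: measurable_fun_ltr
    | |- measurable_fun _ (fun x => ~~ _) => apply: measurable_neg
    | |- measurable_fun _ (fun x => @?f x <= @?g x) => apply: measurable_fun_ler
    | |- measurable_fun _ (fun x => if _ then _ else _) => apply: measurable_fun_ifT
    | |- measurable_fun _ (fun x => (@?f x, @?g x)) => apply: measurable_fun_pair
    | |- measurable_fun _ (fun x => fst x) => exact: measurable_fst
    | |- measurable_fun _ (fun x => snd x) => exact: measurable_snd
    | |- measurable_fun _ (fun x => x) => exact: measurable_id
    | |- measurable_fun _ fst => exact: measurable_fst
    | |- measurable_fun _ snd => exact: measurable_snd
    | |- measurable_fun _ (fun x => _ (_ x)) => fail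
    | |- measurable_fun _ _ => exact: measurable_cst
    end ].
Ltac meas := repeat meas1.

Section polar.
Context {R : realType}.
Local Notation mu := (@lebesgue_measure R).
Local Notation RR := (measurableTypeR R).

Lemma integral_if (P : RR -> bool) (f : RR -> \bar R) :
  (\int[mu]_x (if P x then f x else 0) = \int[mu]_(x in [set x | P x]) f x)%E.
Proof.
rewrite [RHS]integral_mkcond; apply: eq_integral => x _.
by rewrite patchE; case: ifPn => Px; [rewrite mem_set|rewrite memNset//; apply/negP].
Qed.

Lemma integral_gtE (a : R) (f : RR -> \bar R) :
  (\int[mu]_(x in `]a, +oo[) f x = \int[mu]_x (if (a < x)%R then f x else 0))%E.
Proof.
rewrite [RHS]integral_if; congr integral.
by apply/seteqP; split => x /=; rewrite in_itv/= andbT.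
Qed.

Lemma integral_ooE (a b : R) (f : RR -> \bar R) :
  (\int[mu]_(x in `]a, b[) f x =
   \int[mu]_x (if (a < x < b)%R then f x else 0))%E.
Proof.
by rewrite [RHS]integral_if; congr integral; apply/seteqP; split => x /=; rewrite in_itv.
Qed.

Lemma integral_diag (f : RR -> \bar R) (s : R) : measurable_fun setT f ->
  (forall x, 0 <= f x)%E -> 0 < s ->
  (\int[mu]_(x in `]0%R, +oo[) f x =
   \int[mu]_(x in `]0%R, s[) f x + \int[mu]_(x in `]s, +oo[) f x)%E.
Proof.
move=> mf f0 s0.
have -> : [set` `]0, +oo[] = `]0, s[ `|` ([set s] `|` `]s, +oo[) :> set RR.
  apply/seteqP; split => x /=; rewrite !in_itv/= !andbT.
    by move=> ->; have [x0|x0|->] := ltgtP x s; [left|right;right|right;left].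
  by case=> [/andP[]//|[->//|]]; exact: lt_trans.
rewrite ge0_integral_setU//=; first last.
- rewrite disj_set2E; apply/eqP/seteqP; split => x //= [].
  by rewrite !in_itv/= => /andP[_ x0] [x0'|]; [move: x0; rewrite x0'|rewrite andbT]; lra.
- exact: measurable_funTS.
- exact: measurableU.
rewrite ge0_integral_setU//=; first last.
- rewrite disj_set2E; apply/eqP/seteqP; split => x //= [] -> .
  by rewrite !in_itv/= ltxx.
- exact: measurable_funTS.
by rewrite integral_set1 add0e.
Qed.

(** Split along the diagonal; dilating the inner variable by the outer one
    below the diagonal, and symmetrically above it, turns both halves into
    integrals over l > 1. *)
Lemma polar_quadrant (H : RR * RR -> \bar R) : measurable_fun setT H ->
  (forall z, 0 <= H z)%E ->
  (\int[mu]_(s in `]0%R, +oo[) \int[mu]_(t in `]0%R, +oo[) H (s, t) =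
   \int[mu]_(l in `]1%R, +oo[) \int[mu]_(s in `]0%R, +oo[)
     ((H (s, (l : R) * s)%R + H ((l : R) * s, s)%R) * s%:E))%E.
Proof.
move=> mH H0.
pose A := (fun z : RR * RR => if (0 < z.1)%R && (z.1 < z.2)%R then H z else 0%E).
pose B := (fun z : RR * RR => if (0 < z.2)%R && (z.2 < z.1)%R then H z else 0%E).
have mA : measurable_fun setT A by rewrite /A; meas.
have mB : measurable_fun setT B by rewrite /B; meas.
have A0 z : (0 <= A z)%E by rewrite /A; case: ifP.
have B0 z : (0 <= B z)%E by rewrite /B; case: ifP.
have mAs s : measurable_fun setT (fun t => A (s, t)).
  exact: (measurable_fun_pair2 s mA).
have mBs s : measurable_fun setT (fun t => B (s, t)).
  exact: (measurable_fun_pair2 s mB).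
have mBs' s : measurable_fun setT (fun t => B (t, s)).
  exact: (measurable_fun_pair1 s mB).
transitivity (\int[mu]_s (\int[mu]_t A (s, t) + \int[mu]_t B (s, t)))%E.
  rewrite [LHS]integral_gtE; apply: eq_integral => s _; case: ifP => s0.
    rewrite (integral_diag (measurable_fun_pair2 s mH) _ s0)// addeC.
    rewrite integral_gtE integral_ooE.
    by congr (_ + _)%E; apply: eq_integral => t _; rewrite /A /B/= ?s0.
  rewrite /A /B/=; rewrite !integral0_eq ?adde0// => t _.
    by case: ifP => // /andP[? ?]; exfalso; move/negP : s0; apply; lra.
  by rewrite s0.
rewrite ge0_integralD//; last 4 first.
- by move=> x _; exact: integral_ge0.
- exact: measurable_fun_fubini_tonelli_F.
- by move=> x _; exact: integral_ge0.
- exact: measurable_fun_fubini_tonelli_F.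
rewrite [X in (_ + X)%E](fubini_tonelli B)//.
rewrite -ge0_integralD//; last 4 first.
- by move=> x _; exact: integral_ge0.
- exact: measurable_fun_fubini_tonelli_F.
- by move=> x _; exact: integral_ge0.
- exact: measurable_fun_fubini_tonelli_G.
(* The integrand after the dilation, with the ratio as first variable. *)
pose K := (fun z : RR * RR => if (1 < z.1)%R && (0 < z.2)%R then
  ((H (z.2, ((z.1 : R) * (z.2 : R))%R) + H (((z.1 : R) * (z.2 : R))%R, z.2)) * (z.2 : R)%:E)%E else 0%E).
have mK : measurable_fun setT K.
  rewrite /K; meas.
have K0 z : (0 <= K z)%E.
  by rewrite /K; case: ifP => // /andP[_ ?]; rewrite mule_ge0 ?adde_ge0// lee_fin ltW.
transitivity (\int[mu]_s \int[mu]_l K (l, s))%E; last first.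
  transitivity (\int[mu]_l \int[mu]_s K (l, s))%E.
    exact/esym/fubini_tonelli.
  rewrite [RHS]integral_gtE; apply: eq_integral => l _.
  case: ifP => l1; last by rewrite integral0_eq// => s _; rewrite /K/= l1.
  by rewrite [RHS]integral_gtE; apply: eq_integral => s _; rewrite /K/= l1.
apply: eq_integral => s _.
rewrite -ge0_integralD//.
have [s0|s0] := ltP 0 s; last first.
  rewrite !integral0_eq// => t _.
    by rewrite /K/= [X in _ && X]ltNge s0 andbF.
  have /negbTE Z1 : ~~ (0 < s < t) by apply/negP => /andP[? ?]; lra.
  by rewrite /A /B/= Z1 add0e.
rewrite [LHS](integral_scale s0); first last.
- by move=> x; exact: adde_ge0.
- by apply: emeasurable_funD; [exact: mAs|exact: mBs'].
apply: eq_integral => l _; rewrite /A /B /K/= s0/= andbT.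
have -> : (s < s * l) = (1 < l) by rewrite -{1}(mulr1 s) ltr_pM2l.
by case: ifP; rewrite ?adde0 ?mul0e// mulrC.
Qed.

(** The kernel (s - t)^-2 is homogeneous, hence factors into a function of l
    and a power of s in these coordinates: the seminorm is then estimated
    separately for each ratio l. *)
Lemma polar (h : RR * RR -> \bar R) : measurable_fun setT h ->
  (forall z, 0 <= h z)%E ->
  (\int[mu]_s \int[mu]_t h (s, t) =
   \int[mu]_(l in `]1%R, +oo[) \int[mu]_(s in `]0%R, +oo[)
     ((h (s, (l : R) * s)%R + h (s, - ((l : R) * s))%R +
      (h (- s, (l : R) * s)%R + h (- s, - ((l : R) * s))%R) +
      (h ((l : R) * s, s)%R + h ((l : R) * s, - s)%R +
      (h (- ((l : R) * s), s)%R + h (- ((l : R) * s), - s)%R))) * s%:E))%E.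
Proof.
move=> mh h0.
pose H := (fun z : RR * RR => h z + h (z.1, (- (z.2 : R))%R) +
  (h ((- (z.1 : R))%R, z.2) + h ((- (z.1 : R))%R, (- (z.2 : R))%R)))%E.
have mH : measurable_fun setT H.
  rewrite /H; meas.
have H0 z : (0 <= H z)%E by rewrite /H !adde_ge0.
transitivity (\int[mu]_(s in `]0%R, +oo[) \int[mu]_(t in `]0%R, +oo[) H (s, t))%E;
  last by rewrite polar_quadrant.
have mhs s : measurable_fun setT (fun t => h (s, t)).
  exact: (measurable_fun_pair2 s mh).
have mhsN s : measurable_fun setT (fun t : RR => h (s, (- (t:R))%R)).
  by apply: (measurableT_comp (mhs s)); meas.
have mI : measurable_fun setT (fun s => \int[mu]_t h (s, t))%E.
  exact: measurable_fun_fubini_tonelli_F.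
rewrite (integral_pos_neg mI); last by move=> s; exact: integral_ge0.
apply: eq_integral => s _.
rewrite !integral_pos_neg// -ge0_integralD//.
- by move=> t _; exact: adde_ge0.
- by apply: emeasurable_funD; exact: measurable_funTS.
- by move=> t _; exact: adde_ge0.
- by apply: emeasurable_funD; exact: measurable_funTS.
Qed.

End polar.

(** * Quadratic splines and test functions *)

Section splines.
Context {R : realType}.

(** A quadratic bound on the remainder gives the derivative of a spline at
    its knots without one-sided limits. *)
Lemma is_derive_quadratic (f : R -> R) (x d C : R) :
  (forall h, `|f (x + h) - f x - d * h| <= C * h ^+ 2) -> is_derive x 1 f d.
Proof.
move=> fq.
have C0 : 0 <= C.
  by have := le_trans (normr_ge0 _) (fq 1); rewrite expr1n mulr1.
suff H : h^-1 *: ((f \o shift x) (h *: (1:R)) - f x) @[h --> 0^'] --> d.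
  by apply: DeriveDef; [apply/cvg_ex; exists d|exact: cvg_lim H].
apply/cvgrPdist_le => e e0.
near=> h.
have h0 : h != 0 by near: h; exact: nbhs_dnbhs_neq.
have hn : 0 < `|h| by rewrite normr_gt0.
rewrite /= /GRing.scale/= mulr1 [h + x]addrC.
have -> : d - h^-1 * (f (x + h) - f x) = - (h^-1 * (f (x + h) - f x - d * h)).
  have E : h^-1 * (d * h) = d by rewrite mulrC mulfK.
  by rewrite [in RHS](mulrBr h^-1 _ (d * h)) E opprB.
rewrite normrN normrM normfV ler_pdivrMl//.
apply: le_trans (fq h) _.
rewrite -[h ^+ 2]ger0_norm ?sqr_ge0// normrX expr2 mulrA mulrC ler_wpM2l//.
have : `|h| <= e / (C + 1).
  by near: h; apply: dnbhs0_le; rewrite divr_gt0// ltr_wpDl.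
rewrite ler_pdivlMr ?ltr_wpDl// => hle; apply: le_trans hle.
by rewrite mulrC ler_wpM2l// lerDl.
Unshelve. all: by end_near. Qed.

Definition pospart (x : R) : R := Num.max x 0.

Lemma pospart_continuous : continuous pospart.
Proof. by move=> x; apply: continuous_max => //; exact: cvg_cst. Qed.

Lemma pospart_shift_continuous (b : R) : continuous (fun x => pospart (x - b)).
Proof.
move=> x; apply: (@cvg_comp _ _ _ (fun y => y - b) pospart _ (nbhs (x - b))).
  by apply: cvgB; [exact: cvg_id|exact: cvg_cst].
exact: pospart_continuous.
Qed.

Lemma is_derive_pospart2 (x : R) :
  is_derive x 1 (fun x => pospart x ^+ 2) (2 * pospart x).
Proof.
apply: (@is_derive_quadratic _ _ _ 1) => h; rewrite mul1r /pospart.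
have [x0|x0] := ltP x 0; have [xh0|xh0] := ltP (x + h) 0;
  rewrite ?(max_r (ltW x0)) ?(max_l x0) ?(max_r (ltW xh0)) ?(max_l xh0);
  rewrite ler_norml; apply/andP; split; nra.
Qed.

(** The C^1 quadratic spline that increases from 0 to 1 on [0, 1]. *)
Definition ramp (x : R) : R :=
  2 * pospart x ^+ 2 - 4 * pospart (x - 2^-1) ^+ 2 + 2 * pospart (x - 1) ^+ 2.

Definition dramp (x : R) : R :=
  4 * pospart x - 8 * pospart (x - 2^-1) + 4 * pospart (x - 1).

Lemma pospart_ge x : 0 <= x -> pospart x = x.
Proof. by move=> x0; rewrite /pospart max_l. Qed.

Lemma pospart_le x : x <= 0 -> pospart x = 0.
Proof. by move=> x0; rewrite /pospart max_r. Qed.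

Lemma ramp0 x : x <= 0 -> ramp x = 0.
Proof. by move=> x0; rewrite /ramp !pospart_le; lra. Qed.

Lemma ramp1 x : 1 <= x -> ramp x = 1.
Proof. by move=> x0; rewrite /ramp !pospart_ge; lra. Qed.

Lemma ramp_itv x : 0 <= ramp x <= 1.
Proof.
have [x0|x0] := leP x 0; first by rewrite ramp0 ?lexx ?ler01.
have [x1|x1] := leP 1 x; first by rewrite ramp1 ?lexx ?ler01.
rewrite /ramp (pospart_ge (ltW x0)) (@pospart_le (x - 1)); last lra.
have [x2|x2] := leP x 2^-1.
  by rewrite pospart_le; [apply/andP; split; nra|lra].
by rewrite pospart_ge; [apply/andP; split; nra|lra].
Qed.

Lemma dramp_itv x : 0 <= dramp x <= 2.
Proof.
rewrite /dramp.
have [x0|x0] := leP x 0; first by rewrite !pospart_le; lra.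
have [x1|x1] := leP 1 x; first by rewrite !pospart_ge; lra.
rewrite (pospart_ge (ltW x0)) (@pospart_le (x - 1)); last lra.
have [x2|x2] := leP x 2^-1; first by rewrite pospart_le; lra.
by rewrite pospart_ge; lra.
Qed.

Lemma dramp0 x : x <= 0 \/ 1 <= x -> dramp x = 0.
Proof.
by rewrite /dramp => -[x0|x0]; [rewrite !pospart_le|rewrite !pospart_ge]; lra.
Qed.

Lemma is_derive_ramp (a h x : R) :
  is_derive x 1 (fun t => ramp ((t - a) / h)) (dramp ((x - a) / h) / h).
Proof.
have H b : is_derive x 1 (fun t => pospart ((t - a) / h - b) ^+ 2)
   (2 * pospart ((x - a) / h - b) / h).
  have := @is_derive1_comp R (fun t => pospart t ^+ 2)
    (fun t => (t - a) / h - b) x (2 * pospart ((x - a) / h - b)) h^-1.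
  apply; first exact: is_derive_pospart2.
  apply: is_derive_eq; rewrite /GRing.scale/=.
  lra.
have H0 : is_derive x 1 (fun t => pospart ((t - a) / h) ^+ 2)
   (2 * pospart ((x - a) / h) / h).
  have := H 0; rewrite subr0; congr is_derive; apply/funext => t.
  by rewrite subr0.
rewrite /ramp; apply: is_derive_eq; rewrite /GRing.scale/= /dramp.
lra.
Qed.

Lemma dramp_continuous : continuous dramp.
Proof.
move=> x; rewrite /dramp.
apply: cvgD; [apply: cvgB|]; apply: cvgM; try exact: cvg_cst.
- exact: pospart_continuous.
- exact: pospart_shift_continuous.
- exact: pospart_shift_continuous.
Qed.

Lemma dramp_comp_continuous (a h : R) : continuous (fun t => dramp ((t - a) / h) / h).
Proof.
move=> x; apply: cvgM; last exact: cvg_cst.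
apply: (@continuous_comp _ _ _ (fun t => (t - a) / h)); last exact: dramp_continuous.
apply: cvgM; last exact: cvg_cst.
by apply: cvgB; [exact: cvg_id|exact: cvg_cst].
Qed.

End splines.

Section test_functions.
Context {R : realType}.

Lemma test_functionI (phi dphi : R -> R) (a b : R) : -1 < a -> b < 1 ->
  (forall x : R, is_derive x 1 phi (dphi x)) -> continuous dphi ->
  (forall x, x < a \/ b < x -> phi x = 0) ->
  test_function phi.
Proof.
move=> a1 b1 dp cd p0.
have sub : closure [set x | phi x != 0] `<=` [set` `[a, b]].
  rewrite [X in _ `<=` X](iffLR (closure_id _)); last exact: interval_closed.
  apply: closureS => x /= px; rewrite in_itv/= !leNgt.
  by apply/andP; split; apply/negP => h; move: px; rewrite p0 ?eqxx//; [left|right].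
split.
- by move=> x; case: (dp x).
- rewrite (_ : phi^`()%classic = dphi)//; apply/funext => x.
  by rewrite derive1E; apply: derive_val.
- apply: (subclosed_compact _ (@segment_compact _ a b)) => //.
  exact: closed_closure.
- move=> x /sub/=; rewrite !in_itv/= => /andP[? ?]; apply/andP; split; lra.
Qed.

(** Tends to the indicator function of ]x, y] as h tends to 0. *)
Definition plateau (x y h t : R) : R := ramp ((t - x) / h) - ramp ((t - y) / h).
Definition dplateau (x y h t : R) : R :=
  dramp ((t - x) / h) / h - dramp ((t - y) / h) / h.

Lemma is_derive_plateau (x y h t : R) : is_derive t 1 (plateau x y h) (dplateau x y h t).
Proof. by apply: is_deriveB; exact: is_derive_ramp. Qed.

Lemma dplateau_continuous x y h : continuous (dplateau x y h).
Proof. by move=> t; apply: cvgB; exact: dramp_comp_continuous. Qed.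

Lemma derive1_plateau x y h : derive1 (plateau x y h) = dplateau x y h.
Proof.
apply/funext => t; rewrite derive1E; apply: derive_val.
exact: is_derive_plateau.
Qed.

Lemma test_plateau x y h : -1 < x -> x < y -> 0 < h -> y + h < 1 ->
  test_function (plateau x y h).
Proof.
move=> x1 xy h0 y1.
apply: (test_functionI x1 y1 (is_derive_plateau x y h) (@dplateau_continuous x y h)).
move=> t [tx|yt]; rewrite /plateau.
  by rewrite !ramp0 ?subr0// ler_pdivrMr// mul0r; lra.
by rewrite !ramp1 ?subrr// ler_pdivlMr// mul1r; lra.
Qed.

End test_functions.

(** * Sobolev functions of one variable *)

Section weak_derivatives.
Context {R : realType}.
Local Notation mu := (@lebesgue_measure R).
Local Notation RR := (measurableTypeR R).
Local Notation D := (`]-1, 1[%classic : set RR).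

Lemma L2P (u : R -> R) : L2 u <->
  measurable_fun D (u : RR -> R) /\ (\int[mu]_(x in D) (u x ^+ 2)%:E < +oo)%E.
Proof.
have E : (\int[mu]_(x in D) (u x ^+ 2)%:E =
    'N[mu]_2%:E[EFin \o (u \_ D : R -> R)] `^ 2)%E.
  rewrite poweR_Lnorm//.
  rewrite [LHS]integral_mkcond; apply: eq_integral => x _.
  rewrite !patchE/= patchE; case: ifP => _.
    by rewrite powR_mulrn// real_normK// num_real.
  by rewrite /point/= normr0 powR0 ?pnatr_eq0.
have mE : measurable_fun D (u : RR -> R) <->
    measurable_fun setT ((u \_ D : R -> R) : RR -> R).
  by apply: measurable_restrictT.
rewrite /L2 inE/=; split => [/andP[]|[mu_ ufin]].
  rewrite !inE/= => mf fin; split; first by apply/mE.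
  by rewrite E poweR_lty.
apply/andP; rewrite !inE/=; split; first by apply/mE.
by rewrite /finite_norm; apply: (@lty_poweRy _ _ 2); rewrite ?pnatr_eq0// -E.
Qed.

Lemma lebesgue_measure_D_lty : (mu D < +oo)%E.
Proof. by rewrite lebesgue_measure_itv/=; case: ifP; rewrite ?ltry// -EFinB ltry. Qed.

Lemma integrable_cst (A : set RR) (c : R) : measurable A -> (mu A < +oo)%E ->
  mu.-integrable A (EFin \o cst c).
Proof.
move=> mA Afin; apply: measurable_bounded_integrable => //.
by exists `|c|; split; [rewrite num_real|move=> M cM x _ /=; exact: ltW].
Qed.

Lemma L2_integrable (u : R -> R) : L2 u -> mu.-integrable D (EFin \o u).
Proof.
move=> /L2P[mu_ ufin].
have i1 : mu.-integrable D (EFin \o (fun x => 1 + u x ^+ 2)).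
  apply/integrableP; split.
    apply/measurable_EFinP; apply: measurable_funD => //.
    exact: measurable_funX.
  under eq_integral do rewrite /= ger0_norm ?addr_ge0 ?sqr_ge0// EFinD.
  rewrite ge0_integralD//=; last 2 first.
    by move=> x _; rewrite lee_fin sqr_ge0.
    by apply/measurable_EFinP; exact: measurable_funX.
  rewrite lte_add_pinfty// integral_cst//= mul1e lebesgue_measure_itv/=.
  by case: ifP => _; rewrite ?ltry// -EFinB ltry.
apply: le_integrable i1 => //; first exact/measurable_EFinP.
move=> x _ /=; rewrite lee_fin (ger0_norm (addr_ge0 ler01 (sqr_ge0 (u x)))).
rewrite -[u x ^+ 2]real_normK ?num_real//; nra.
Qed.

Lemma integrable_mulr_bounded (A : set RR) (g k : R -> R) (M : R) :
  measurable A -> mu.-integrable A (EFin \o g) ->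
  measurable_fun A (k : RR -> R) -> (forall x, A x -> `|k x| <= M) ->
  mu.-integrable A (EFin \o (fun x => g x * k x)).
Proof.
move=> mA ig mk kM.
have := integrableMl mA ig mk; apply.
exists M; split; first by rewrite num_real.
by move=> x Mx y Ay /=; apply: le_trans (ltW Mx); exact: kM.
Qed.

(** The derivative of the ramp is a nonnegative kernel of mass one supported
    in [x, x + h], so it averages u near x. *)
Lemma dramp_average (u : R -> R) (x h e : R) : mu.-integrable D (EFin \o u) ->
  -1 < x -> 0 < h -> x + h < 1 ->
  (forall t, x <= t <= x + h -> `|u t - u x| <= e) ->
  `|\int[mu]_(t in D) (u t * (dramp ((t - x) / h) / h)) - u x| <= e.
Proof.
move=> iu x1 h0 xh ue.
set k := fun t => dramp ((t - x) / h) / h.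
have ck : continuous k by exact: dramp_comp_continuous.
have mk : measurable_fun setT (k : RR -> R) by exact: continuous_measurable_fun.
have k0 t : 0 <= k t by apply: divr_ge0; [case/andP: (dramp_itv ((t - x) / h))|exact: ltW].
have kM t : `|k t| <= 2 / h.
  by rewrite ger0_norm// ler_pM2r ?invr_gt0//; case/andP: (dramp_itv ((t - x) / h)).
have mkD : measurable_fun D (k : RR -> R) by exact: measurable_funTS.
have iuk := integrable_mulr_bounded (measurable_itv _) iu mkD (fun t _ => kM t).
have i1 c : mu.-integrable D (EFin \o cst c : RR -> \bar R).
  by apply: integrable_cst => //; exact: lebesgue_measure_D_lty.
have ick c : mu.-integrable D (EFin \o (fun t => c * k t)).
  exact: (integrable_mulr_bounded (measurable_itv _) (i1 c) mkD (fun t _ => kM t)).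
have ik : mu.-integrable D (EFin \o k).
  by have := ick 1; congr (_.-integrable _ _); apply/funext => t /=; rewrite mul1r.
have intk : \int[mu]_(t in D) k t = 1.
  rewrite /Rintegral -(@integral_itv_bndoo _ (-1) 1 (EFin \o k) true false)/=; last first.
    exact/measurable_EFinP.
  rewrite (@continuous_FTC2 _ k (fun t => ramp ((t - x) / h))) => [||||].
  - rewrite ramp1 ?ler_pdivlMr ?mul1r//; last lra.
    rewrite ramp0; last by rewrite ler_pdivrMr// mul0r; lra.
    by rewrite sube0.
  - by lra.
  - exact: continuous_subspaceT.
  - have d t : derivable (fun t => ramp ((t - x) / h)) t 1.
      by case: (is_derive_ramp x h t).
    have c t : {for t, continuous (fun t => ramp ((t - x) / h))}.
      by apply: differentiable_continuous; exact/derivable1_diffP.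
    split=> [t _||]; first exact: d.
      by apply: cvg_at_right_filter; exact: c.
    by apply: cvg_at_left_filter; exact: c.
  - by move=> t _; rewrite derive1E; apply: derive_val; exact: is_derive_ramp.
have -> : \int[mu]_(t in D) (u t * k t) - u x =
    \int[mu]_(t in D) (u t * k t - u x * k t).
  rewrite RintegralB// RintegralZl// intk mulr1//.
apply: le_trans (le_normr_Rintegral _ _) _ => //.
  exact: (integrableB _ iuk (ick (u x))).
have -> : e = \int[mu]_(t in D) (e * k t) by rewrite RintegralZl// intk mulr1.
apply: le_Rintegral => //.
  exact: integrable_norm (integrableB _ iuk (ick (u x))).
move=> t _; rewrite -mulrBl normrM (ger0_norm (k0 t)).
have [tx|tx] := boolP (x <= t <= x + h).
  by rewrite ler_wpM2r// ue.
suff -> : k t = 0 by rewrite !mulr0.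
rewrite /k dramp0 ?mul0r//.
move: tx; rewrite negb_and -!ltNge => /orP[tx|tx]; [left|right].
  by rewrite ler_pdivrMr// mul0r; lra.
by rewrite ler_pdivlMr// mul1r; lra.
Qed.

Lemma continuous_itv_at (u : R -> R) (x : R) :
  {within `[-1, 1], continuous u} -> -1 < x < 1 -> {for x, continuous u}.
Proof.
have ltm11 : (-1 : R) < 1 by lra.
move=> /(continuous_within_itvP _ ltm11)[cu _ _] xD; apply: cu.
by rewrite in_itv.
Qed.

Lemma integrable_sub (g : R -> R) (x y : R) : mu.-integrable D (EFin \o g) ->
  -1 <= x -> y < 1 -> mu.-integrable `]x, y] (EFin \o g).
Proof.
move=> ig x1 y1; apply: integrableS ig => // t /=; rewrite !in_itv/=.
by move=> /andP[? ?]; apply/andP; split; lra.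
Qed.

Lemma ramp_cvg (h : R^nat) (t z : R) : (forall n, 0 < h n) ->
  h n @[n --> \oo] --> 0 ->
  ramp ((t - z) / h n) @[n --> \oo] --> ((z < t)%R%:R : R).
Proof.
move=> h0 hcvg; apply: cvg_near_cst; have [zt|tz] := ltP z t; last first.
  by apply: nearW => n; rewrite ramp0// ler_pdivrMr// mul0r subr_le0.
move/cvgrPdist_lt : hcvg => /(_ (t - z)); rewrite subr_gt0 => /(_ zt).
apply: filterS => n; rewrite sub0r normrN gtr0_norm// => htz.
by rewrite ramp1// ler_pdivlMr// mul1r ltW.
Qed.

Lemma plateau_norm (x y h t : R) : `|plateau x y h t| <= 1.
Proof.
rewrite /plateau; have /andP[? ?] := ramp_itv ((t - x) / h).
have /andP[? ?] := ramp_itv ((t - y) / h).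
by rewrite ler_norml; apply/andP; split; lra.
Qed.

Lemma measurable_plateau (x y h : R) : measurable_fun setT (plateau x y h : RR -> R).
Proof.
apply: continuous_measurable_fun => t; apply: differentiable_continuous.
apply/derivable1_diffP; by case: (is_derive_plateau x y h t).
Qed.

(** Test the weak derivative against plateaux whose slopes shrink to the end
    points: one side converges by averaging, the other one by dominated
    convergence. *)
Lemma weak_derivative_ftc (u g : R -> R) (x y : R) :
  L2 u -> {within `[-1, 1], continuous u} -> weak_derivatives u g ->
  -1 < x -> x < y -> y < 1 ->
  u y - u x = \int[mu]_(t in `]x, y]) g t.
Proof.
move=> Lu cu [Lg wg] x1 xy y1.
have iu := L2_integrable Lu; have ig := L2_integrable Lg.
pose h (n : nat) : R := (1 - y) / 2 / n.+1%:R.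
have h0 n : 0 < h n by rewrite /h !divr_gt0//; lra.
have h_le n : h n <= (1 - y) / 2.
  by rewrite /h ler_pdivrMr// ler_peMr// ?ler1n//; lra.
have hy n : y + h n < 1 by have := h_le n; lra.
have hcvg : h n @[n --> \oo] --> 0.
  rewrite -(mulr0 ((1 - y) / 2)); apply: cvgM; first exact: cvg_cst.
  exact: cvg_harmonic.
have cvgL (z : R) : x <= z <= y ->
    \int[mu]_(t in D) (u t * (dramp ((t - z) / h n) / h n)) @[n --> \oo] --> u z.
  move=> /andP[xz zy]; apply/cvgrPdist_le => e e0.
  have zc : {for z, continuous u}.
    by apply: (continuous_itv_at cu); apply/andP; split; lra.
  move/cvgrPdist_le : zc => /(_ e e0)[d /= d0 zd].
  near=> n; rewrite distrC; apply: dramp_average => //; [lra|have := hy n; lra|].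
  move=> t /andP[zt tz]; rewrite distrC; apply: zd => /=.
  rewrite distrC ger0_norm ?subr_ge0//.
  suff : h n < d by lra.
  near: n; move/cvgrPdist_lt : hcvg => /(_ d d0).
  by apply: filterS => n; rewrite sub0r normrN gtr0_norm.
have cvgU : \int[mu]_(t in D) (u t * derive1 (plateau x y (h n)) t) @[n --> \oo] -->
    u x - u y.
  have E n : \int[mu]_(t in D) (u t * derive1 (plateau x y (h n)) t) =
     \int[mu]_(t in D) (u t * (dramp ((t - x) / h n) / h n)) -
     \int[mu]_(t in D) (u t * (dramp ((t - y) / h n) / h n)).
    have i z : mu.-integrable D (EFin \o (fun t => u t * (dramp ((t - z) / h n) / h n))).
      apply: (@integrable_mulr_bounded _ _ _ (2 / h n)) => //.
        apply: measurable_funTS; apply: continuous_measurable_fun.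
        exact: dramp_comp_continuous.
      move=> t _; have /andP[d1 d2] := dramp_itv ((t - z) / h n).
      by rewrite ger0_norm ?ler_pM2r ?invr_gt0// divr_ge0// ltW.
    rewrite -RintegralB//; apply: eq_Rintegral => t _.
    by rewrite derive1_plateau /dplateau mulrBr.
  under eq_fun do rewrite E.
  by apply: cvgB; apply: cvgL; apply/andP; split; lra.
have cvgG : \int[mu]_(t in D) (g t * plateau x y (h n) t) @[n --> \oo] -->
    \int[mu]_(t in `]x, y]) g t.
  pose ind t : R := (x < t)%R%:R - (y < t)%R%:R.
  have indE t : ind t = (x < t <= y)%R%:R.
    rewrite /ind; have [xt|tx] := ltP x t; have [yt|ty] := ltP y t => /=; lra.
  have mplat n : measurable_fun D (plateau x y (h n) : RR -> R).
    by apply: measurable_funTS; exact: measurable_plateau.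
  have limE : \int[mu]_(t in `]x, y]) g t = \int[mu]_(t in D) (g t * ind t).
    rewrite Rintegral_mkcond [RHS]Rintegral_mkcond; apply: eq_Rintegral => t _.
    rewrite !patchE indE; case: ifPn => [|/negP]; rewrite inE/= in_itv/= => h1.
      rewrite mem_set ?h1 ?mulr1//= in_itv/=.
      by move/andP : h1 => [? ?]; apply/andP; split; lra.
    by move/negP/negbTE : h1 => ->; rewrite mulr0; case: ifP.
  have mg : measurable_fun D (g : RR -> R) by case/L2P : Lg.
  have mind : measurable_fun D (ind : RR -> R).
    apply: measurable_funTS.
    have -> : ind = fun t => (if x < t then 1 else 0) - (if y < t then 1 else 0).
      by apply/funext => t; rewrite /ind; do 2 case: ifP => _.
    by apply: (@measurable_funB _ RR); apply: measurable_fun_ifT => //;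
      apply: measurable_fun_ltr.
  have [] := @dominated_convergence _ _ _ mu D (measurable_itv _)
    (fun n t => (g t * plateau x y (h n) t)%:E) (fun t => (g t * ind t)%:E)
    (fun t => `|g t|%:E).
  - by move=> n; apply/measurable_EFinP; exact: measurable_funM.
  - by apply/measurable_EFinP; exact: measurable_funM.
  - apply: aeW => t _; apply: cvg_EFin; first exact: nearW.
    apply: cvgM; first exact: cvg_cst.
    by apply: cvgB; exact: ramp_cvg.
  - exact: integrable_norm ig.
  - apply: aeW => t n _; rewrite lee_fin normrM ler_piMr//.
    exact: plateau_norm.
  move=> iind _; rewrite limE => cvgE.
  have mD : measurable D by [].
  have fnum := integrable_fin_num mD iind.
  by apply: fine_cvg; rewrite /Rintegral fineK.
have E n : \int[mu]_(t in D) (u t * derive1 (plateau x y (h n)) t) =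
    - \int[mu]_(t in D) (g t * plateau x y (h n) t).
  exact/wg/test_plateau.
have : (- \int[mu]_(t in D) (g t * plateau x y (h n) t)) @[n --> \oo] --> u x - u y.
  by under eq_fun do rewrite -E.
move=> /(cvg_unique _ (cvgN cvgG)) H.
by have := H (@Rhausdorff R); lra.
Unshelve. all: by end_near. Qed.

End weak_derivatives.

Section weak_derivatives2.
Context {R : realType}.
Local Notation mu := (@lebesgue_measure R).
Local Notation RR := (measurableTypeR R).
Local Notation D := (`]-1, 1[%classic : set RR).

Lemma L2_sqr_integrable (g : R -> R) : L2 g ->
  mu.-integrable D (EFin \o (fun x => g x ^+ 2)).
Proof.
move=> /L2P[mg gfin]; apply/integrableP; split.
  by apply/measurable_EFinP; exact: measurable_funX.
by under eq_integral do rewrite /= ger0_norm ?sqr_ge0//.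
Qed.

(** Integrate (g - c)^2 >= 0 with c the mean value of g. *)
Lemma weak_derivative_holder (u g : R -> R) (x y : R) :
  L2 u -> {within `[-1, 1], continuous u} -> weak_derivatives u g ->
  -1 < x -> x < y -> y < 1 ->
  (((u y - u x) ^+ 2)%:E <= (y - x)%:E * \int[mu]_(t in D) (g t ^+ 2)%:E)%E.
Proof.
move=> Lu cu wg x1 xy y1.
have [Lg _] := wg.
have iE := weak_derivative_ftc Lu cu wg x1 xy y1.
have ig := L2_integrable Lg; have ig2 := L2_sqr_integrable Lg.
have mD : measurable D by [].
set I := (\int[mu]_(t in D) _)%E.
have Ifin : I \is a fin_num by have := integrable_fin_num mD ig2.
rewrite -(fineK Ifin) -EFinM lee_fin.
set d := u y - u x; pose c := d / (y - x).
have yx : 0 < y - x by lra.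
have mA : measurable (`]x, y]%classic : set RR) by [].
have xyD : `]x, y]%classic `<=` D.
  by move=> t /=; rewrite !in_itv/= => /andP[? ?]; apply/andP; split; lra.
have iA := integrable_sub ig (ltW x1) y1.
have iA2 : mu.-integrable `]x, y] (EFin \o (fun x => g x ^+ 2)).
  exact: integrableS ig2.
have muA : mu `]x, y] = (y - x)%:E by rewrite lebesgue_measure_itv/= lte_fin xy.
have ic k : mu.-integrable `]x, y] (EFin \o (cst k : R -> R)).
  by apply: integrable_cst => //; rewrite muA ltry.
have icA : mu.-integrable `]x, y] (EFin \o (fun t => 2 * c * g t)).
  have := integrableZl mA (2 * c) iA; congr (_.-integrable _ _).
have : \int[mu]_(t in `]x, y]) (2 * c * g t - c ^+ 2) <=
       \int[mu]_(t in `]x, y]) (g t ^+ 2).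
  apply: le_Rintegral => //.
    exact: (integrableB mA icA (ic (c ^+ 2))).
  by move=> t _; have := sqr_ge0 (g t - c); rewrite sqrrB; lra.
rewrite RintegralB//; last exact: (ic (c ^+ 2)).
rewrite RintegralZl// -iE -/d Rintegral_cst//.
rewrite [X in _ - c ^+ 2 * X](_ : _ = y - x); last first.
  exact: (congr1 fine muA).
have : \int[mu]_(t in `]x, y]) (g t ^+ 2) <= fine I.
  apply: fine_le => //; first exact: integrable_fin_num iA2.
  apply: ge0_subset_integral => //; first exact: measurable_int ig2.
  by move=> t _; rewrite lee_fin sqr_ge0.
have -> : d = c * (y - x) by rewrite /c divfK// gt_eqF.
nra.
Qed.

(** Both functions have the same integral over every subinterval, so their
    difference vanishes at each of its Lebesgue points. *)
Lemma weak_derivative_unique (u g1 g2 : R -> R) :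
  L2 u -> {within `[-1, 1], continuous u} ->
  weak_derivatives u g1 -> weak_derivatives u g2 ->
  ae_eq mu D (EFin \o g1) (EFin \o g2).
Proof.
move=> Lu cu w1 w2.
have [L1 _] := w1; have [L2' _] := w2.
have i1 := L2_integrable L1; have i2 := L2_integrable L2'.
have mD : measurable D by [].
(* The difference, extended by 0, has locally constant primitives in D. *)
pose k := (fun t => g1 t - g2 t) \_ D : R -> R.
have ik : mu.-integrable setT (EFin \o k).
  rewrite /k -restrict_EFin; apply/integrable_restrict => //.
  by rewrite setTI; exact: (integrableB mD i1 i2).
have lk : locally_integrable setT k.
  exact: integrable_locally_restrict mD (integrableB mD i1 i2).
have := lebesgue_differentiation lk.
apply: filterS; first exact: (ae_filter_ringOfSetsType mu).
move=> x lx xD; rewrite /= in_itv/= in xD; move/andP: xD => [x1 x2].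
pose a := (x - 1) / 2; pose b := (x + 1) / 2.
have ix : mu.-integrable [set` Interval (BRight a) (BRight b)] (EFin \o k).
  exact: integrableS ik.
have xb : x < b by rewrite /b; lra.
have ax : (BRight a < BRight x)%O by rewrite bnd_simp /a; lra.
have [_ kE] := FTC1_lebesgue_pt xb ix ax lx.
suff k0 : k x = 0.
  move: k0; rewrite /k patchE mem_set/= ?in_itv/= ?x1//.
  by move=> /eqP; rewrite subr_eq0 => /eqP ->.
rewrite -kE; rewrite derive1E.
rewrite (@near_eq_derive _ _ _ _ (cst 0)) ?derive_cst//.
near=> y.
have ya : a < y.
  by near: y; apply: lt_nbhsr; rewrite /a; lra.
have yb : y < b.
  by near: y; apply: lt_nbhsl; rewrite /b; lra.
have a1 : -1 < a by rewrite /a; clear -x1; lra.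
have b1 : b < 1 by rewrite /b; clear -x2; lra.
have sD : forall t, t \in `]a, y] -> t \in `]-1, 1[.
  clear - a1 yb b1; by move=> t; rewrite !in_itv/= => /andP[? ?]; apply/andP; split; lra.
transitivity (\int[mu]_(t in `]a, y]) (g1 t - g2 t)).
  apply: eq_Rintegral => t; rewrite inE/= => /sD tD.
  by rewrite /k patchE mem_set.
have y1' : y < 1 by exact: lt_trans b1.
rewrite RintegralB//; [|exact: integrable_sub (ltW a1) y1'..].
rewrite -(weak_derivative_ftc Lu cu w1 a1 ya y1').
by rewrite -(weak_derivative_ftc Lu cu w2 a1 ya y1') subrr.
Unshelve. all: by end_near. Qed.

Lemma continuous_bounded_itv (f : R -> R) (a b : R) : continuous f ->
  exists M, forall x, a <= x <= b -> `|f x| <= M.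
Proof.
move=> cf; have [ab|ba] := leP a b; last first.
  by exists 0 => x /andP[? ?]; exfalso; lra.
have cnf : {within `[a, b], continuous (fun x => `|f x|)}.
  by apply: continuous_subspaceT => x; apply: cvg_norm; exact: cf.
have [c _ cM] := EVT_max ab cnf.
by exists `|f c| => x xab; apply: cM; rewrite in_itv.
Qed.

Lemma test_function_continuous (phi : R -> R) : test_function phi -> continuous phi.
Proof.
move=> [dphi _ _ _] x; apply: differentiable_continuous.
by apply/derivable1_diffP; exact: dphi.
Qed.

Lemma test_function_ends (phi : R -> R) (x : R) : test_function phi ->
  ~ (-1 < x < 1) -> phi x = 0.
Proof.
move=> [_ _ _ sub] xD; apply/eqP/negP => /negP x0; apply: xD.
by have /= := sub x (@subset_closure R [set x | phi x != 0] x x0); rewrite in_itv.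
Qed.

Lemma test_function_ftc (phi : R -> R) (a : R) : test_function phi -> -1 <= a -> a < 1 ->
  (\int[mu]_(x in `[a, 1%R[) (derive1 phi x)%:E = (- phi a)%:E)%E.
Proof.
move=> tphi a1 a2; have [dphi cphi' _ _] := tphi.
have cphi := test_function_continuous tphi.
have mphi' : measurable_fun setT (derive1 phi : RR -> R).
  exact: continuous_measurable_fun.
rewrite (@integral_itv_bndo_bndc _ (BLeft a) 1 (fun x => (derive1 phi x)%:E)); last first.
  by apply: measurable_funTS; exact/measurable_EFinP.
rewrite (@continuous_FTC2 _ (derive1 phi) phi) => [|//|||].
- by rewrite (test_function_ends (x := 1)) ?sub0e// ltxx andbF.
- exact: continuous_subspaceT.
- split => [x _||]; first exact: dphi.
    by apply: cvg_at_right_filter; exact: cphi.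
  by apply: cvg_at_left_filter; exact: cphi.
- by [].
Qed.

(** Integration by parts, that is, Fubini's theorem on the triangle t <= x:
    the test function vanishes at the end points, so its derivative
    integrates to - phi t over [t, 1[. *)
Lemma weak_derivative_primitive (u g : R -> R) (c : R) : L2 u -> L2 g ->
  (forall x, -1 < x < 1 -> u x = c + \int[mu]_(t in `]-1, x]) g t) ->
  weak_derivatives u g.
Proof.
move=> Lu Lg uE; split => // phi tphi.
have [dphi cphi' _ _] := tphi.
have cphi := test_function_continuous tphi.
have mphi' : measurable_fun setT (derive1 phi : RR -> R).
  exact: continuous_measurable_fun.
have mD : measurable D by [].
have iu := L2_integrable Lu; have ig := L2_integrable Lg.
have [M phiM] := continuous_bounded_itv (-1) 1 cphi'.
have phiMD x : D x -> `|derive1 phi x| <= M.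
  by rewrite /= in_itv/= => /andP[? ?]; apply: phiM; apply/andP; split; lra.
have M0 : 0 <= M by apply: le_trans (phiMD 0 _) => //=; rewrite in_itv/=; apply/andP; split; lra.
pose G x := \int[mu]_(t in `]-1, x]) g t.
have mphiD : measurable_fun D (derive1 phi : RR -> R) by exact: measurable_funTS.
have iuphi := integrable_mulr_bounded mD iu mphiD phiMD.
have icphi : mu.-integrable D (EFin \o (fun x => c * derive1 phi x)).
  apply: (@integrable_mulr_bounded _ _ _ _ M) => //.
  by apply: integrable_cst => //; exact: lebesgue_measure_D_lty.
have i1phi : mu.-integrable D (EFin \o derive1 phi).
  have : mu.-integrable D (EFin \o (fun x => 1 * derive1 phi x)).
    apply: (@integrable_mulr_bounded _ _ _ _ M) => //.
    by apply: integrable_cst => //; exact: lebesgue_measure_D_lty.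
  by congr (_.-integrable _ _); apply/funext => x /=; rewrite mul1r.
have int0 : \int[mu]_(x in D) (derive1 phi x) = 0.
  rewrite /Rintegral integral_itv_obnd_cbnd; last exact/measurable_EFinP.
  have m11 : (-1 : R) < 1 by lra.
  rewrite (test_function_ftc tphi (lexx _) m11).
  by rewrite (test_function_ends tphi) ?oppr0// ltxx.
pose gD : RR -> R := g \_ D.
have igD : mu.-integrable setT (EFin \o gD).
  by rewrite /gD -restrict_EFin; apply/integrable_restrict => //; rewrite setTI.
have mgD : measurable_fun setT (gD : RR -> R) by apply/measurable_EFinP; exact: measurable_int igD.
have gDE t : -1 < t < 1 -> gD t = g t by move=> tD; rewrite /gD patchE mem_set//= in_itv.
have gD0 t : ~ (-1 < t < 1) -> gD t = 0 by move=> tD; rewrite /gD patchE memNset//= in_itv.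
pose F (z : RR * RR) : R := if ~~ (z.1 < z.2) && ((-1 < z.1) && (z.1 < 1))
  then gD z.2 * derive1 phi z.1 else 0.
have mF : measurable_fun setT F.
  by rewrite /F; meas.
have iF : (mu \x mu)%E.-integrable setT (EFin \o F).
  apply/integrable12ltyP; first exact/measurable_EFinP.
  apply: (@le_lt_trans _ _ (\int[mu]_(x in D) (M%:E * \int[mu]_t `|(gD t)%:E|))%E).
    rewrite [leRHS]integral_ooE; apply: ge0_le_integral => //.
    - by move=> x _; exact: integral_ge0.
    - apply: (measurable_fun_fubini_tonelli_F (fun z => `|(F z)%:E|%E)).
      + by apply: measurableT_comp => //; exact/measurable_EFinP.
      + by [].
    - by apply: measurable_fun_ifT => //; apply: measurable_and;
        apply: measurable_fun_ltr.
    move=> x _; case: ifP => xD; last first.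
      by rewrite integral0_eq// => t _; rewrite /F/= xD andbF ?normr0 ?abse0.
    rewrite -ge0_integralZl//; last by apply: measurableT_comp => //; exact/measurable_EFinP.
    apply: ge0_le_integral => //.
    - apply: measurableT_comp => //; apply/measurable_EFinP.
      exact: (measurable_fun_pair2 x mF).
    - by apply: emeasurable_funM => //; apply: measurableT_comp => //; exact/measurable_EFinP.
    move=> t _; rewrite /F/= xD andbT; case: ifP => _; last first.
      by rewrite ?normr0 ?abse0 mule_ge0.
    by rewrite -EFinM lee_fin normrM mulrC ler_wpM2r// phiMD//= in_itv.
  rewrite integral_cst//= lte_mul_pinfty ?mule_ge0 ?integral_ge0//.
    apply: fin_numM => //; apply: integrable_fin_num => //.
    exact: integrable_abse igD.
  exact: lebesgue_measure_D_lty.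
have gmul a (A : set RR) : measurable A -> A `<=` D ->
   (\int[mu]_(t in A) (g t * a)%:E = (\int[mu]_(t in A) g t * a)%:E)%E.
  move=> mA AD; have iA : mu.-integrable A (EFin \o g) by exact: integrableS ig.
  under eq_integral do rewrite EFinM.
  rewrite (integralZr mA iA) /Rintegral EFinM fineK//.
  exact: integrable_fin_num iA.
have LHS : (\int[mu]_(x in D) (G x * derive1 phi x)%:E = \int[mu]_x \int[mu]_t (F (x, t))%:E)%E.
  rewrite integral_ooE; apply: eq_integral => x _; case: ifP => xD; last first.
    by rewrite integral0_eq// => t _; rewrite /F/= xD andbF.
  rewrite -gmul//; last first.
    move=> t /=; rewrite !in_itv/=; move/andP : xD => [_ x1] /andP[t1 tx].
    by rewrite t1 (le_lt_trans tx x1).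
  rewrite integral_mkcond; apply: eq_integral => t _; rewrite patchE /F/= xD andbT -leNgt.
  case: ifPn => [|/negP]; rewrite inE/= in_itv/= => tx.
    move/andP : (tx) => [t1 tx2]; rewrite tx2 gDE// t1/=.
    by move/andP : xD => [_]; exact: le_lt_trans.
  case: ifP => // tx'; rewrite gD0 ?mul0r// => /andP[t1 _]; apply: tx.
  by rewrite t1.
have RHS : (\int[mu]_(t in D) (- (g t * phi t))%:E = \int[mu]_t \int[mu]_x (F (x, t))%:E)%E.
  rewrite integral_ooE; apply: eq_integral => t _; case: ifP => tD; last first.
    by rewrite integral0_eq// => x _; rewrite /F/= gD0 ?mul0r ?tD//; case: ifP.
  move/andP: (tD) => [t1 t2].
  transitivity (\int[mu]_(x in `[t, 1%R[) (g t * derive1 phi x)%:E)%E.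
    under eq_integral do rewrite EFinM.
    rewrite integralZl//.
      by rewrite (test_function_ftc tphi (ltW t1) t2) -EFinM mulrN.
    apply: integrableS i1phi => // x /=; rewrite !in_itv/= => /andP[tx ->].
    by rewrite (lt_le_trans t1 tx).
  rewrite integral_mkcond; apply: eq_integral => x _; rewrite patchE /F/= gDE//.
  case: ifPn => [|/negP]; rewrite inE/= in_itv/= -leNgt => tx.
    by move/andP : tx => [tx1 ->]; rewrite tx1 andbT (lt_le_trans t1 tx1).
  by case: ifP => // /andP[tx1 /andP[_ tx2]]; exfalso; apply: tx; rewrite tx1.
have key : (\int[mu]_(x in D) (G x * derive1 phi x)%:E =
    \int[mu]_(t in D) (- (g t * phi t))%:E)%E.
  by rewrite LHS RHS; exact: (Fubini iF).
transitivity (\int[mu]_(x in D) (c * derive1 phi x + G x * derive1 phi x)).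
  apply: eq_Rintegral => x; rewrite inE/= in_itv/= => xD.
  by rewrite uE// mulrDl.
have iG : mu.-integrable D (EFin \o (fun x => G x * derive1 phi x)).
  have := integrableB mD iuphi icphi; apply: eq_integrable => // x.
  rewrite inE/= in_itv/= => xD; rewrite uE// -/(G x) -EFinB; congr _%:E; lra.
rewrite RintegralD// RintegralZl// int0 mulr0 add0r /Rintegral key.
have igphi : mu.-integrable D (EFin \o (fun x => g x * phi x)).
  have [M' phiM'] := continuous_bounded_itv (-1) 1 cphi.
  apply: (@integrable_mulr_bounded _ _ _ _ M') => //.
    by apply: measurable_funTS; exact: continuous_measurable_fun.
  by move=> x; rewrite /= in_itv/= => /andP[? ?]; apply: phiM'; rewrite !ltW.
transitivity (\int[mu]_(t in D) (-1 * (g t * phi t))).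
  by apply: eq_Rintegral => t _; rewrite mulN1r.
by rewrite RintegralZl// mulN1r.
Qed.

End weak_derivatives2.

(** * Smooth functions and inner changes of variables in H^1 *)

Section sobolev.
Context {R : realType}.
Local Notation mu := (@lebesgue_measure R).
Local Notation RR := (measurableTypeR R).
Local Notation D := (`]-1, 1[%classic : set RR).

Lemma within_continuous_L2 (f : R -> R) : {within `[-1, 1], continuous f} -> L2 f.
Proof.
move=> cf; apply/L2P.
have cf2 : {within `[-1, 1], continuous (fun x => f x ^+ 2)}.
  rewrite (_ : (fun x => f x ^+ 2) = (fun x => f x * f x)).
    by move=> x; apply: cvgM; exact: cf.
  by apply/funext => x; rewrite expr2.
have iD : mu.-integrable D (EFin \o (fun x => f x ^+ 2)).
  have := continuous_compact_integrable (@segment_compact _ (-1 : R) 1) cf2.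
  by apply: integrableS => //; exact: subset_itv_oo_cc.
have if1 : mu.-integrable `[-1, 1] (EFin \o f).
  exact: (continuous_compact_integrable (@segment_compact _ (-1 : R) 1) cf).
split.
  have /measurable_int/measurable_EFinP := if1.
  by apply: measurable_funS => //; exact: subset_itv_oo_cc.
have /integrableP[_] := iD.
by under eq_integral do rewrite /= ger0_norm ?sqr_ge0//.
Qed.

(** The form in which the converse of weak_derivative_ftc is applied, with
    no reference to the value at -1. *)
Lemma weak_derivative_increments (u g : R -> R) : L2 u -> L2 g ->
  (forall x y, -1 < x -> x < y -> y < 1 ->
     u y - u x = \int[mu]_(t in `]x, y]) g t) ->
  weak_derivatives u g.
Proof.
move=> Lu Lg inc; have ig := L2_integrable Lg.
apply: (@weak_derivative_primitive _ _ _ (u 0 - \int[mu]_(t in `]-1, 0]) g t)) => //.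
move=> x /andP[x1 x2].
have ix y : y < 1 -> mu.-integrable `]-1, y] (EFin \o g).
  by move=> y1; apply: integrable_sub.
have split_int a b : -1 < a -> a < b -> b < 1 ->
  \int[mu]_(t in `]-1, b]) g t = \int[mu]_(t in `]-1, a]) g t + (u b - u a).
  move=> a1 ab b1; rewrite (inc a b)//.
  rewrite -(@Rintegral_itvB _ g (BRight (-1)) (BRight b) a); first by rewrite addrC subrK.
  - exact: ix.
  - by rewrite bnd_simp ltW.
  - by rewrite bnd_simp ltW.
have m10 : (-1 : R) < 0 by rewrite ltrN10.
have [x0|x0|x0] := ltgtP x 0.
- by rewrite (split_int x 0)//; lra.
- by rewrite (split_int 0 x)//; lra.
- by rewrite x0; lra.
Qed.

Lemma H1_weak_derivative (u : R -> R) : H1 u ->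
  weak_derivatives u (weak_derivative u).
Proof. by move=> [_ [g wg] _]; exact: (xgetI _ wg). Qed.

(** The Dirichlet energy can be computed with any version of the weak
    derivatives. *)
Lemma dirichletE (m : R -> R * R) (g1 g2 : R -> R) :
  H1 (fst \o m) -> H1 (snd \o m) ->
  weak_derivatives (fst \o m) g1 -> weak_derivatives (snd \o m) g2 ->
  dirichlet m = (\int[mu]_(x in D) (g1 x ^+ 2 + g2 x ^+ 2)%:E)%E.
Proof.
move=> H1m H2m w1 w2.
have W1 := H1_weak_derivative H1m; have W2 := H1_weak_derivative H2m.
have [L1 _ c1] := H1m; have [L2' _ c2] := H2m.
have mD : measurable D by [].
have mm g : L2 g -> measurable_fun D (fun x => g x ^+ 2 : R).
  by move=> /L2P[mg _]; exact: measurable_funX.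
apply: ae_eq_integral => //.
- by apply/measurable_EFinP; apply: measurable_funD; apply: mm;
    [case: W1|case: W2].
- by apply/measurable_EFinP; apply: measurable_funD; apply: mm;
    [case: w1|case: w2].
have e1 := weak_derivative_unique L1 c1 W1 w1.
have e2 := weak_derivative_unique L2' c2 W2 w2.
have FF : Filter (almost_everywhere mu) by exact: (ae_filter_ringOfSetsType mu).
apply: filterS2 e1 e2 => x e1 e2 xD.
by have [->] := e1 xD; have [->] := e2 xD.
Qed.

Lemma C1_H1 (u u' : R -> R) :
  (forall x : R, is_derive x 1 u (u' x)) -> continuous u' ->
  H1 u /\ weak_derivatives u u'.
Proof.
move=> du cu'.
have cu : continuous u.
  move=> x; apply: differentiable_continuous; apply/derivable1_diffP.
  by case: (du x).
have cwu : {within `[-1, 1], continuous u} by exact: continuous_subspaceT.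
have w : weak_derivatives u u'.
  apply: weak_derivative_increments.
  - exact: within_continuous_L2.
  - by apply: within_continuous_L2; exact: continuous_subspaceT.
  - move=> x y _ xy _; rewrite /Rintegral integral_itv_obnd_cbnd; last first.
      by apply/measurable_EFinP/measurable_funTS; exact: continuous_measurable_fun.
    rewrite (@continuous_FTC2 _ u' u) => [//|//|||].
    + exact: continuous_subspaceT.
    + split => [z _||]; first by case: (du z).
        by apply: cvg_at_right_filter; exact: cu.
      by apply: cvg_at_left_filter; exact: cu.
    + by move=> z _; rewrite derive1E; apply: derive_val.
split => //; split => //; first exact: within_continuous_L2.
by exists u'.
Qed.

Lemma integral_subst (Phi theta : R -> R) (f : RR -> R) : diffeo Phi theta ->
  measurable_fun setT f ->
  (\int[mu]_x (f x)%:E = \int[mu]_x (f (Phi x) * theta x)%:E)%E.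
Proof.
move=> dPhi mf; have t0 x : 0 <= theta x by case: dPhi.
rewrite integralE [RHS]integralE; congr (_ - _)%E.
  rewrite (ge0_integral_subst dPhi)//; last by apply: measurable_funepos; exact/measurable_EFinP.
  apply: eq_integral => x _; rewrite !funeposE/= -EFin_max -EFin_max -EFinM; congr _%:E.
  by rewrite maxr_pMl// mul0r.
rewrite (ge0_integral_subst dPhi)//; last by apply: measurable_funeneg; exact/measurable_EFinP.
apply: eq_integral => x _; rewrite !funenegE/= -EFin_max -EFin_max -EFinM; congr _%:E.
by rewrite maxr_pMl// mul0r mulNr.
Qed.

Variables (Phi theta : R -> R) (M : R).
Hypothesis dPhi : diffeo Phi theta.
Hypothesis thetaM : forall x, theta x <= M.
Hypotheses (Phim1 : Phi (-1) = -1) (Phi1 : Phi 1 = 1).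

Let le_Phi x y : (Phi x <= Phi y) = (x <= y).
Proof. by case: dPhi => h _ _ _ _; rewrite (diffeo_mono h). Qed.
Let lt_Phi x y : (Phi x < Phi y) = (x < y).
Proof. by rewrite !ltNge le_Phi. Qed.
Let Phi_gtm1 x : (-1 < Phi x) = (-1 < x). Proof. by rewrite -{1}Phim1 lt_Phi. Qed.
Let Phi_lt1 x : (Phi x < 1) = (x < 1). Proof. by rewrite -{1}Phi1 lt_Phi. Qed.
Let Phi_gem1 x : (-1 <= Phi x) = (-1 <= x). Proof. by rewrite -{1}Phim1 le_Phi. Qed.
Let Phi_le1 x : (Phi x <= 1) = (x <= 1). Proof. by rewrite -{1}Phi1 le_Phi. Qed.

Lemma comp_diffeo_continuous (u : R -> R) : {within `[-1, 1], continuous u} ->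
  {within `[-1, 1], continuous (u \o Phi)}.
Proof.
move=> cu; apply/subspace_continuousP => x x1.
have /subspace_continuousP/(_ (Phi x)) := cu.
have Px : [set` `[-1, 1]] (Phi x).
  by move: x1; rewrite /= !in_itv/= Phi_gem1 Phi_le1.
move=> /(_ Px); apply: cvg_trans.
move=> A nA; have cP := diffeo_continuous dPhi.
have nA2 : \forall t \near x, [set` `[-1, 1]] (Phi t) -> A (u (Phi t)).
  exact: cP x _ nA.
suff : \forall t \near x, [set` `[-1, 1]] t -> A (u (Phi t)) by [].
apply: filterS nA2 => t /= At.
by rewrite in_itv/= => t1; apply: At; rewrite in_itv/= Phi_gem1 Phi_le1.
Qed.

(** One factor theta is the Jacobian, the other one is bounded by M. *)
Lemma integral_diffeo_sqr (g : R -> R) : L2 g ->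
  (\int[mu]_(x in D) ((g (Phi x) * theta x) ^+ 2)%:E <=
   M%:E * \int[mu]_(x in D) (g x ^+ 2)%:E)%E.
Proof.
move=> Lg; have [mg _] := L2P g; have /L2P[mgD _] := Lg.
have mth : measurable_fun setT (theta : RR -> R).
  exact: diffeo_derivative_measurable dPhi.
have mP : measurable_fun setT (Phi : RR -> RR) by exact: diffeo_measurable dPhi.
have t0 x : 0 <= theta x by case: dPhi.
have M0 : 0 <= M by exact: le_trans (t0 0) (thetaM 0).
pose gD : RR -> R := g \_ D.
have mG : measurable_fun setT gD by apply/(measurable_restrictT g).
have gDE t : -1 < t < 1 -> gD t = g t by move=> tD; rewrite /gD patchE mem_set//= in_itv.
rewrite [leRHS](_ : _ = (M%:E * \int[mu]_x (gD x ^+ 2)%:E)%E); last first.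
  congr (_ * _)%E; rewrite integral_ooE; apply: eq_integral => x _.
  case: ifP => xD; first by rewrite gDE.
  by rewrite /gD patchE memNset ?expr0n//= in_itv/= xD.
have mGP : measurable_fun setT (fun x : RR => gD (Phi x)) by exact: measurableT_comp.
rewrite (ge0_integral_subst dPhi); last 2 first.
- by apply/measurable_EFinP; exact: measurable_funX.
- by move=> x; rewrite lee_fin sqr_ge0.
rewrite -ge0_integralZl//=; first last.
- by move=> x _; rewrite -EFinM lee_fin mulr_ge0// sqr_ge0.
- by apply/measurable_EFinP/measurable_funM => //; exact: measurable_funX.
rewrite [leLHS]integral_ooE; apply: ge0_le_integral => //.
- by move=> x _; case: ifP => // _; rewrite lee_fin sqr_ge0.
- apply: (@eq_measurable_fun _ _ _ _ _ (fun x : RR => ((gD (Phi x) * theta x) ^+ 2)%:E)).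
    move=> x _; case: ifP => xD; first by rewrite gDE// Phi_gtm1 Phi_lt1.
    by rewrite /gD patchE memNset/= ?in_itv/= ?Phi_gtm1 ?Phi_lt1 ?xD// mul0r expr0n.
  by apply/measurable_EFinP; meas.
- by apply/measurable_EFinP; meas.
- move=> x _; case: ifP => xD; last first.
    by rewrite -!EFinM lee_fin; do 2 apply: mulr_ge0 => //; exact: sqr_ge0.
  rewrite gDE ?Phi_gtm1 ?Phi_lt1// -!EFinM lee_fin exprMn [theta x ^+ 2]expr2.
  have h1 : 0 <= g (Phi x) ^+ 2 * theta x by apply: mulr_ge0 => //; exact: sqr_ge0.
  have h2 : 0 <= M - theta x by rewrite subr_ge0.
  have := mulr_ge0 h1 h2; lra.
Qed.

Lemma comp_diffeo_H1 (u g : R -> R) : H1 u -> weak_derivatives u g ->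
  H1 (u \o Phi) /\ weak_derivatives (u \o Phi) (fun x => g (Phi x) * theta x).
Proof.
move=> [Lu _ cu] wg; have [Lg _] := wg.
have cuP := comp_diffeo_continuous cu.
have mth : measurable_fun setT (theta : RR -> R).
  exact: diffeo_derivative_measurable dPhi.
have mP : measurable_fun setT (Phi : RR -> RR) by exact: diffeo_measurable dPhi.
have /L2P[mgD gfin] := Lg.
pose gD : RR -> R := g \_ D.
have mG : measurable_fun setT gD by apply/(measurable_restrictT g).
have gDE t : -1 < t < 1 -> gD t = g t by move=> tD; rewrite /gD patchE mem_set//= in_itv.
have mGP : measurable_fun setT (fun x : RR => gD (Phi x)) by exact: measurableT_comp.
have LgP : L2 (fun x => g (Phi x) * theta x).
  apply/L2P; split.
    apply: (@eq_measurable_fun _ _ _ _ _ (fun x : RR => gD (Phi x) * theta x)).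
      by move=> x; rewrite inE/= in_itv/= => xD; rewrite gDE// Phi_gtm1 Phi_lt1.
    by apply: measurable_funTS; meas.
  apply: le_lt_trans (integral_diffeo_sqr Lg) _.
  have ig2 := L2_sqr_integrable Lg; have mD : measurable D by [].
  by have := integrable_fin_num mD ig2; case: (\int[mu]_(x in D) _)%E => // r _; rewrite ltry.
have w : weak_derivatives (u \o Phi) (fun x => g (Phi x) * theta x).
  apply: weak_derivative_increments => //; first exact: within_continuous_L2.
  move=> x y x1 xy y1 /=.
  rewrite (weak_derivative_ftc Lu cu wg) ?Phi_gtm1 ?Phi_lt1 ?lt_Phi// /Rintegral.
  congr fine.
  pose f : RR -> R := g \_ `]Phi x, Phi y].
  have mf : measurable_fun setT f.
    apply/(measurable_restrictT g) => //; apply: measurable_funS mgD => // t /=.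
    rewrite !in_itv/= => /andP[? ?]; apply/andP; split.
      by apply: lt_trans (_ : Phi x < _) => //; rewrite Phi_gtm1.
    by apply: le_lt_trans (_ : _ <= Phi y) _ => //; rewrite Phi_lt1.
  transitivity (\int[mu]_t (f t)%:E)%E.
    by rewrite integral_mkcond restrict_EFin.
  rewrite (integral_subst dPhi)// [RHS]integral_mkcond; apply: eq_integral => t _.
  rewrite /f !patchE; have -> : (Phi t \in [set` `]Phi x, Phi y]]) = (t \in [set` `]x, y]]).
    by apply/idP/idP; rewrite !inE/= !in_itv/= lt_Phi le_Phi.
  by case: ifP => // _; rewrite mul0r.
by split => //; split => //; [exact: within_continuous_L2|eexists; exact: w].
Qed.

Lemma comp_diffeo_dirichlet (m : R -> R * R) : H1 (fst \o m) -> H1 (snd \o m) ->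
  [/\ H1 (fst \o (m \o Phi)), H1 (snd \o (m \o Phi)) &
   (dirichlet (m \o Phi) <= M%:E * dirichlet m)%E].
Proof.
move=> h1 h2.
have w1 := H1_weak_derivative h1; have w2 := H1_weak_derivative h2.
have [h1P w1P] := comp_diffeo_H1 h1 w1; have [h2P w2P] := comp_diffeo_H1 h2 w2.
split => //; rewrite (dirichletE h1P h2P w1P w2P) (dirichletE h1 h2 w1 w2).
have mD : measurable D by [].
have mm g : L2 g -> measurable_fun D (fun x => (g x ^+ 2)%:E).
  by move=> /L2P[mg _]; apply/measurable_EFinP; exact: measurable_funX.
have [L1 _] := w1; have [L1' _] := w2; have [L2' _] := w1P; have [L3' _] := w2P.
under eq_integral do rewrite EFinD.
under [in leRHS]eq_integral do rewrite EFinD.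
rewrite !ge0_integralD; [|by []|by move=> x _; rewrite lee_fin sqr_ge0|exact: mm
  |by move=> x _; rewrite lee_fin sqr_ge0|exact: mm
  |by []|by move=> x _; rewrite lee_fin sqr_ge0|exact: mm
  |by move=> x _; rewrite lee_fin sqr_ge0|exact: mm].
rewrite ge0_muleDr; last 2 first.
- by apply: integral_ge0 => x _; rewrite lee_fin sqr_ge0.
- by apply: integral_ge0 => x _; rewrite lee_fin sqr_ge0.
by apply: leeD; exact: integral_diffeo_sqr.
Qed.

End sobolev.

(** * The logarithmic kernel and its constants *)

Section constants.
Context {R : realType}.
Local Notation mu := (@lebesgue_measure R).
Local Notation RR := (measurableTypeR R).

(** Applied twice, it substitutes l - 1 = z^4, which turns the integral of
    wgt below into one with a bounded integrand that decays like z^-2. *)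
Lemma diffeo_signed_square : diffeo (fun y : R => y * `|y|) (fun y => 2 * `|y|).
Proof.
split.
- move=> x y xy; have [x0|x0] := leP 0 x.
    rewrite !ger0_norm//; last by lra.
    nra.
  rewrite [X in x * X]ltr0_norm//; have [y0|y0] := leP 0 y.
    rewrite ger0_norm//; nra.
  by rewrite ltr0_norm//; nra.
- move=> y; have [y0|y0] := leP 0 y.
    by exists (Num.sqrt y); rewrite ger0_norm ?sqrtr_ge0// -expr2 sqr_sqrtr.
  exists (- Num.sqrt (- y)); rewrite normrN ger0_norm ?sqrtr_ge0// mulNr -expr2.
  by rewrite sqr_sqrtr ?opprK// oppr_ge0 ltW.
- move=> x; apply: (@is_derive_quadratic _ _ _ _ 1) => h; rewrite mul1r.
  rewrite ler_norml; have [x0|x0] := leP 0 x; have [y0|y0] := leP 0 (x + h);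
    rewrite ?(ger0_norm x0) ?(ger0_norm y0) ?(ltr0_norm x0) ?(ltr0_norm y0);
    apply/andP; split; nra.
- by move=> x; apply: cvgM; [exact: cvg_cst|exact: norm_continuous].
- by move=> x; rewrite mulr_ge0.
Qed.

Lemma measurable_gt (a : R) : measurable_fun setT (fun x : RR => a < x).
Proof. by apply: (@measurable_fun_ltr _ RR R setT (cst a) id). Qed.

(** What (s - t)^-2 contributes at t = l s and at t = - l s once the powers
    of s are factored out. *)
Definition kern (l : R) : R := (l - 1) ^- 2 + (l + 1) ^- 2.

Lemma kern_ge0 l : 0 <= kern l.
Proof. by rewrite addr_ge0// invr_ge0 sqr_ge0. Qed.

Lemma measurable_kern : measurable_fun setT (kern : RR -> R).
Proof. by rewrite /kern; apply: measurable_funD; apply: measurable_funV; apply: measurable_funX; apply: measurable_funD. Qed.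

Lemma measurable_lnR : measurable_fun setT (@ln R : RR -> R).
Proof. exact: measurable_ln. Qed.

Lemma measurable_sqrtR : measurable_fun setT (@Num.sqrt R : RR -> R).
Proof. by apply: continuous_measurable_fun; exact: sqrt_continuous. Qed.

Lemma ln_le_sub1 (x : R) : 0 < x -> ln x <= x - 1.
Proof. move=> x0; have := @le_ln1Dx R (x - 1).
by rewrite (_ : 1 + (x - 1) = x); [apply; lra|lra]. Qed.

Lemma ln_le_sqrt (l : R) : 1 <= l -> ln l <= 2 * Num.sqrt (l - 1).
Proof.
move=> l1; set t := Num.sqrt (l - 1).
have t0 : 0 <= t by exact: sqrtr_ge0.
have lE : l = 1 + t ^+ 2 by rewrite sqr_sqrtr; lra.
have le2 : l <= (1 + t) ^+ 2 by rewrite lE; nra.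
have : ln l <= ln ((1 + t) ^+ 2).
  by rewrite ler_ln ?posrE//; [lra|rewrite exprn_gt0//; lra].
rewrite lnXn; last lra.
have := @ln_le_sub1 (1 + t); rewrite -mulr_natr; lra.
Qed.

(** The weight with which the boundary terms of the telescoping enter the
    lower bound; the square root, which comes from the choice of the weight
    in boundary_term, makes it integrable at l = 1 and leaves it integrable
    at infinity. *)
Definition wgt (l : R) : R := kern l * ln l * Num.sqrt (l - 1).

(** The left-hand side is the integrand after the substitution l = z^4 + 1,
    with its two Jacobian factors; the logarithm is at most z^4 and at most
    4 z. *)
Lemma wgt_bound (z : R) : 0 < z ->
  wgt (z ^+ 4 + 1) * (2 * z ^+ 2) * (2 * z) <= 64 * (1 + z ^+ 2)^-1.
Proof.
move=> z0; set w := z ^+ 4.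
have w0 : 0 < w by rewrite exprn_gt0.
have l0 : 0 <= ln (w + 1) by rewrite ln_ge0//; lra.
have kE : kern (w + 1) <= 2 * w ^- 2.
  rewrite /kern addrK; suff : (w + 1 + 1) ^- 2 <= w ^- 2 by lra.
  by rewrite lef_pV2 ?posrE ?exprn_gt0//; nra.
have sE : Num.sqrt (w + 1 - 1) = z ^+ 2.
  by rewrite addrK /w (_ : z ^+ 4 = (z ^+ 2) ^+ 2) ?sqrtr_sqr ?ger0_norm ?sqr_ge0// -exprM.
have key : ln (w + 1) * (1 + z ^+ 2) <= 8 * z ^+ 3.
  have h1 : ln (w + 1) <= w by have := @ln_le_sub1 (w + 1); lra.
  have h2 : ln (w + 1) <= 4 * z.
    have le4 : w + 1 <= (1 + z) ^+ 4 by rewrite /w; nra.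
    have : ln (w + 1) <= ln ((1 + z) ^+ 4).
      by rewrite ler_ln ?posrE//; [lra|rewrite exprn_gt0//; lra].
    rewrite lnXn; last lra.
    have := @ln_le_sub1 (1 + z); rewrite -mulr_natr; lra.
  have z20 : 0 < z ^+ 2 by rewrite exprn_gt0.
  have z30 : 0 < z ^+ 3 by rewrite exprn_gt0.
  have [z1|z1] := leP z 1.
    have z21 : z ^+ 2 <= 1 by rewrite expr_le1// ltW.
    have : w <= z ^+ 3 by rewrite /w exprS ler_piMl// ltW.
    nra.
  have z21 : 1 <= z ^+ 2 by rewrite expr_ge1// ltW.
  have : ln (w + 1) * (1 + z ^+ 2) <= 4 * z * (2 * z ^+ 2).
    by apply: ler_pM => //; lra.
  rewrite (_ : 4 * z * (2 * z ^+ 2) = 8 * z ^+ 3)//; rewrite [z ^+ 3]exprS; lra.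
rewrite ler_pdivlMr; last by have := sqr_ge0 z; lra.
rewrite /wgt sE.
apply: (@le_trans _ _ (2 * w ^- 2 * ln (w + 1) * z ^+ 2 * (2 * z ^+ 2) * (2 * z) * (1 + z ^+ 2))).
  have z20 := sqr_ge0 z.
  do 5 (apply: ler_wpM2r; first by [lra|nra|]).
  by [].
have -> : 2 * w ^- 2 * ln (w + 1) * z ^+ 2 * (2 * z ^+ 2) * (2 * z) * (1 + z ^+ 2) =
   (8 * z ^+ 5 * (ln (w + 1) * (1 + z ^+ 2))) / w ^+ 2.
  rewrite [z ^+ 5](_ : _ = z ^+ 2 * z ^+ 2 * z); last by rewrite -!exprD -exprSr.
  lra.
rewrite ler_pdivrMr ?exprn_gt0//.
apply: (@le_trans _ _ (8 * z ^+ 5 * (8 * z ^+ 3))).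
  by rewrite ler_wpM2l// mulr_ge0// exprn_ge0// ltW.
rewrite /w -exprM (_ : z ^+ (4 * 2) = z ^+ 5 * z ^+ 3); last by rewrite -exprD.
lra.
Qed.

Lemma measurable_wgt : measurable_fun setT (wgt : RR -> R).
Proof.
rewrite /wgt; apply: measurable_funM.
  by apply: measurable_funM; [exact: measurable_kern|exact: measurable_lnR].
by apply: (measurableT_comp measurable_sqrtR); apply: measurable_funD.
Qed.

Lemma wgt_ge0 l : 1 <= l -> 0 <= wgt l.
Proof.
move=> l1; rewrite /wgt; apply: mulr_ge0; last exact: sqrtr_ge0.
by apply: mulr_ge0; [exact: kern_ge0|exact: ln_ge0].
Qed.

Lemma wgt_integral_lty : (\int[mu]_(l in `]1%R, +oo[) (wgt l)%:E < +oo)%E.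
Proof.
rewrite integral_gtE.
have mw := measurable_wgt.
have mf : measurable_fun setT (fun l : RR => if (1 < l)%R then (wgt l)%:E else 0%E).
  by apply: measurable_fun_ifT => //; [exact: measurable_gt|exact/measurable_EFinP].
have f0 l : (0 <= (if (1 < l)%R then (wgt l)%:E else 0%E))%E.
  by case: ifP => // l1; rewrite lee_fin wgt_ge0// ltW.
rewrite (integral_shift 1)//.
have mf1 : measurable_fun setT (fun l : RR => if (1 < l + 1)%R then (wgt (l + 1))%:E else 0%E).
  apply: (measurableT_comp mf); exact: measurable_funD.
rewrite (ge0_integral_subst diffeo_signed_square)//.
set F := fun x : RR => ((if (1 < x * `|x| + 1)%R then (wgt (x * `|x| + 1))%:E else 0%E) *
  (2 * `|x|)%:E)%E.
have mn : measurable_fun setT (fun x : RR => `|x|) by exact: normr_measurable.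
have mF : measurable_fun setT F.
  apply: emeasurable_funM; last by apply/measurable_EFinP; apply: measurable_funM.
  by apply: (measurableT_comp mf1); apply: measurable_funM.
have F0 x : (0 <= F x)%E by rewrite /F mule_ge0// lee_fin mulr_ge0.
rewrite (ge0_integral_subst diffeo_signed_square mF F0).
have mO : measurable_fun setT (fun x : RR => (64%:E * (oneDsqr x)^-1%:E)%E).
  apply/measurable_EFinP; apply: measurable_funM => //; apply: measurable_funV.
  by apply: measurable_funD => //; exact: measurable_funX.
apply: (@le_lt_trans _ _ (\int[mu]_(x in `[0%R, +oo[) (64%:E * (oneDsqr x)^-1%:E))%E).
  rewrite [leRHS]integral_mkcond; apply: ge0_le_integral => //.
  - by move=> x _; rewrite mule_ge0// lee_fin mulr_ge0.
  - apply: emeasurable_funM; last by apply/measurable_EFinP; apply: measurable_funM.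
    by apply: (measurableT_comp mF); apply: measurable_funM.
  - apply: (iffLR (measurable_restrictT _ (measurable_itv `[0, +oo[))).
    exact: measurable_funTS.
  - move=> x _; rewrite patchE; case: ifPn => [|/negP]; rewrite inE/= in_itv/= andbT => x0.
      rewrite /F !ger0_norm ?mulr_ge0//.
      have [->|xn0] := eqVneq x 0; first by rewrite !mul0r !mulr0 mule0 mule_ge0// lee_fin invr_ge0.
      have xp : 0 < x by rewrite lt_def xn0.
      have -> : x * x * (x * x) + 1 = x ^+ 4 + 1 by congr (_ + _); rewrite !exprS expr0; lra.
      rewrite ltrDr exprn_gt0// -!EFinM lee_fin -expr2.
      exact: wgt_bound.
    rewrite /F; have -> : (1 < x * `|x| * `|x * `|x| | + 1) = false.
      apply/negbTE; rewrite -leNgt; have : x < 0 by rewrite ltNge; apply/negP.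
      move=> xn; rewrite (ltr0_norm xn); rewrite ler0_norm; last nra.
      have : 0 <= x * - x * (x * - x) by rewrite -expr2 sqr_ge0.
      lra.
    by rewrite !mul0e.
rewrite ge0_integralZl//.
- by rewrite integral0y_oneDsqr lte_mul_pinfty// ltry.
- apply/measurable_EFinP; apply: measurable_funTS; apply: measurable_funV.
  by apply: measurable_funD => //; exact: measurable_funX.
Qed.

(** The constant of the leading term: a wall of height gam with logarithmic
    size L has total energy 4 Kln gam^2 / L at leading order. *)
Definition Kln : R := fine (\int[mu]_(l in `]1%R, +oo[) (kern l * ln l ^+ 2)%:E)%E.
Definition Ksqrt : R := fine (\int[mu]_(l in `]1%R, +oo[) (wgt l)%:E)%E.

Lemma KsqrtE : (\int[mu]_(l in `]1%R, +oo[) (wgt l)%:E = Ksqrt%:E)%E.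
Proof.
rewrite fineK// ge0_fin_numE; first exact: wgt_integral_lty.
by apply: integral_ge0 => l; rewrite /= in_itv/= andbT => l1; rewrite lee_fin wgt_ge0// ltW.
Qed.

Lemma KlnE : (\int[mu]_(l in `]1%R, +oo[) (kern l * ln l ^+ 2)%:E = Kln%:E)%E.
Proof.
rewrite fineK// ge0_fin_numE; last first.
  by apply: integral_ge0 => l _; rewrite lee_fin mulr_ge0 ?kern_ge0 ?sqr_ge0.
apply: (@le_lt_trans _ _ (\int[mu]_(l in `]1%R, +oo[) (2%:E * (wgt l)%:E))%E).
  apply: ge0_le_integral => //.
  - by move=> l _; rewrite lee_fin mulr_ge0 ?kern_ge0 ?sqr_ge0.
  - apply/measurable_EFinP/measurable_funTS/measurable_funM; first exact: measurable_kern.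
    by apply: measurable_funX; exact: measurable_lnR.
  - apply/measurable_EFinP/measurable_funTS/measurable_funM => //.
    exact: measurable_wgt.
  - move=> l; rewrite /= in_itv/= andbT => /ltW l1; rewrite lee_fin /wgt.
    have := ler_wpM2l (mulr_ge0 (kern_ge0 l) (ln_ge0 l1)) (ln_le_sqrt l1).
    by rewrite expr2; lra.
rewrite ge0_integralZl//; last 2 first.
- by apply/measurable_EFinP/measurable_funTS; exact: measurable_wgt.
- by move=> l; rewrite /= in_itv/= andbT => l1; rewrite lee_fin wgt_ge0// ltW.
by rewrite KsqrtE -EFinM ltry.
Qed.

Lemma Kln_ge0 : 0 <= Kln.
Proof.
rewrite fine_ge0// integral_ge0// => l _.
by rewrite lee_fin mulr_ge0 ?kern_ge0 ?sqr_ge0.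
Qed.

Lemma Ksqrt_ge0 : 0 <= Ksqrt.
Proof.
rewrite fine_ge0// integral_ge0// => l; rewrite /= in_itv/= andbT => l1.
by rewrite lee_fin wgt_ge0// ltW.
Qed.

End constants.

(** * Telescoping along dilations *)

Section radial.
Context {R : realType}.
Local Notation mu := (@lebesgue_measure R).
Local Notation RR := (measurableTypeR R).

Lemma integrable_bounded_itv (G : R -> R) (a b M : R) :
  measurable_fun `]a, b] (G : RR -> R) -> (forall x, a < x <= b -> `|G x| <= M) ->
  mu.-integrable `]a, b] (EFin \o G).
Proof.
move=> mG GM; apply: measurable_bounded_integrable => //.
  by rewrite [X in (X < _)%E]lebesgue_measure_itv/=; case: ifP; rewrite ?ltry// -EFinB ltry.
exists M; split; first by rewrite num_real.
move=> N MN x /=; rewrite in_itv/= => xab; apply: le_trans (ltW MN); exact: GM.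
Qed.

Lemma Rintegral_FTC2_oc (f F : R -> R) (a b : R) : a < b ->
  {within `[a, b], continuous f} ->
  (forall x : R, a <= x <= b -> is_derive x 1 F (f x)) ->
  \int[mu]_(x in `]a, b]) f x = F b - F a.
Proof.
move=> ab cf dF.
have cF x : a <= x <= b -> {for x, continuous F}.
  move=> xab; apply: differentiable_continuous; apply/derivable1_diffP.
  by case: (dF x xab).
have mf : measurable_fun `]a, b] (f : RR -> R).
  have := continuous_compact_integrable (@segment_compact _ a b) cf.
  move=> /measurable_int/measurable_EFinP; apply: measurable_funS => //.
  exact: subset_itv_oc_cc.
rewrite /Rintegral integral_itv_obnd_cbnd; last exact/measurable_EFinP.
rewrite (@continuous_FTC2 _ f F) => [//|//|//||].
- split => [z|| ].
  + by rewrite in_itv/= => /andP[az zb]; case: (dF z _); rewrite ?(ltW az) ?(ltW zb).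
  + by apply: cvg_at_right_filter; apply: cF; rewrite lexx ltW.
  + by apply: cvg_at_left_filter; apply: cF; rewrite lexx ltW.
- move=> x; rewrite in_itv/= => /andP[ax xb]; rewrite derive1E; apply: derive_val.
  by apply: dF; rewrite !ltW.
Qed.

Lemma within_continuous_inv (a b : R) (n : nat) : 0 < a ->
  {within `[a, b], continuous (fun x : R => x ^- n)}.
Proof.
move=> a0; apply: continuous_in_subspaceT => x; rewrite inE/= in_itv/= => /andP[ax xb].
apply: cvgV; first by rewrite expf_neq0// gt_eqF// (lt_le_trans a0).
exact: exprn_continuous.
Qed.

Lemma Rintegral_inv (a b : R) : 0 < a -> a < b ->
  \int[mu]_(x in `]a, b]) x^-1 = ln (b / a).
Proof.
move=> a0 ab.
have d (x : R) : a <= x <= b -> is_derive x 1 (@ln R) x^-1.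
  by move=> /andP[ax _]; apply: is_derive1_ln; exact: lt_le_trans ax.
rewrite (Rintegral_FTC2_oc ab (@within_continuous_inv a b 1 a0) d).
by rewrite ln_div ?posrE// (lt_trans a0).
Qed.

Lemma Rintegral_inv2 (a b : R) : 0 < a -> a < b ->
  \int[mu]_(x in `]a, b]) x ^- 2 = a^-1 - b^-1.
Proof.
move=> a0 ab.
have d (x : R) : a <= x <= b -> is_derive x 1 (fun x : R => - x^-1) (x ^- 2).
  move=> /andP[ax _]; have x0 : x != 0 by rewrite gt_eqF// (lt_le_trans a0).
  have h := @is_deriveV R id x 1 1 x0.
  have h' := is_deriveN (h (is_derive_id x 1)).
  apply: (is_derive_eq h').
  by rewrite /GRing.scale/= mulr1 opprK.
rewrite (Rintegral_FTC2_oc ab (@within_continuous_inv a b 2 a0) d).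
by rewrite opprK addrC.
Qed.

Variables (F : R -> R) (gam e0 sig rho lam : R).
Hypothesis mF : measurable_fun setT (F : RR -> R).
Hypothesis F2 : forall s, `|F s| <= 2.
Hypothesis sig0 : 0 < sig.
Hypothesis sigrho : sig < rho.
Hypothesis lam1 : 1 < lam.
Hypothesis Fcore : forall s, 0 < s <= sig -> gam - e0 <= F s.

Let lam0 : 0 < lam. Proof. exact: lt_trans ltr01 lam1. Qed.
Let rho0 : 0 < rho. Proof. exact: lt_trans sig0 sigrho. Qed.

Let mFs : measurable_fun setT (fun s : RR => F (lam * s) : R).
Proof. by apply: measurableT_comp => //; exact: measurable_funM. Qed.

Let Finv : measurable_fun setT (fun s : RR => F s / s).
Proof. by apply: measurable_funM => //; exact: measurable_invr. Qed.

Let iF a b : 0 < a -> mu.-integrable `]a, b] (EFin \o (fun s => F s / s)).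
Proof.
move=> a0; apply: (@integrable_bounded_itv _ _ _ (2 / a)).
  exact: measurable_funTS.
move=> x /andP[ax xb]; rewrite normrM ler_pM// normfV lef_pV2 ?posrE ?normr_gt0//.
- by rewrite ger0_norm// ltW// (lt_trans a0).
- by rewrite gt_eqF// (lt_trans a0).
Qed.

Let iFl a b : 0 < a -> mu.-integrable `]a, b] (EFin \o (fun s => F (lam * s) / s)).
Proof.
move=> a0; apply: (@integrable_bounded_itv _ _ _ (2 / a)).
  by apply: measurable_funTS; apply: measurable_funM => //; exact: measurable_invr.
move=> x /andP[ax xb]; rewrite normrM ler_pM// normfV lef_pV2 ?posrE ?normr_gt0//.
- by rewrite ger0_norm// ltW// (lt_trans a0).
- by rewrite gt_eqF// (lt_trans a0).
Qed.

Let iinv c a b : 0 < a -> mu.-integrable `]a, b] (EFin \o (fun s => c * s^-1)).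
Proof.
move=> a0; apply: (@integrable_bounded_itv _ _ _ (`|c| / a)).
  by apply: measurable_funTS; apply: measurable_funM => //; exact: measurable_invr.
move=> x /andP[ax xb]; rewrite normrM ler_pM// normfV lef_pV2 ?posrE ?normr_gt0//.
- by rewrite ger0_norm// ltW// (lt_trans a0).
- by rewrite gt_eqF// (lt_trans a0).
Qed.

(** The measure ds / s is invariant under dilations. *)
Lemma Rintegral_dilation a b : 0 < a ->
  \int[mu]_(s in `]a / lam, b / lam]) (F (lam * s) / s) =
  \int[mu]_(s in `]a, b]) (F s / s).
Proof.
move=> a0; apply/esym; rewrite /Rintegral; congr fine.
pose f : RR -> R := (fun s => F s / s) \_ `]a, b].
have mf : measurable_fun setT f.
  by apply: (iffLR (measurable_restrictT _ (measurable_itv `]a, b]))); exact: measurable_funTS.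
transitivity (\int[mu]_t (f t)%:E)%E.
  by rewrite integral_mkcond restrict_EFin.
rewrite (integral_subst (diffeo_affine 0 lam0))// [RHS]integral_mkcond.
apply: eq_integral => t _; rewrite /f !patchE addr0/=.
have -> : (lam * t \in [set` `]a, b]]) = (t \in [set` `]a / lam, b / lam]]).
  by apply/idP/idP; rewrite !inE/= !in_itv/= ltr_pdivrMr// ler_pdivlMr// [lam * t]mulrC.
case: ifPn => [|_]; last by rewrite mul0r.
rewrite inE/= in_itv/= => /andP[t0 _]; congr _%:E.
have tp : 0 < t by apply: lt_trans t0; rewrite divr_gt0.
by rewrite invfM [_^-1 * _]mulrC mulrA divfK// gt_eqF.
Qed.

(** Integrate 2 c (F s - F (lam s)) <= (F s - F (lam s))^2 + c^2 against ds
    / s.  By dilation invariance the left-hand side reduces to the integrals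
    of F over ]sig / lam, sig], where F is close to gam, and over ]rho /
    lam, rho], which is the error term. *)
Lemma telescope_lower c : 0 <= c ->
  2 * c * (gam - e0) * ln lam <=
  \int[mu]_(s in `]sig / lam, rho / lam]) ((F s - F (lam * s)) ^+ 2 / s) +
  c ^+ 2 * ln (rho / sig) +
  2 * c * \int[mu]_(s in `]rho / lam, rho]) (`|F s| / s).
Proof.
move=> c0.
have sl0 : 0 < sig / lam by rewrite divr_gt0.
have rl0 : 0 < rho / lam by rewrite divr_gt0.
have slsig : sig / lam < sig by rewrite ltr_pdivrMr// ltr_pMr.
have rlrho : rho / lam < rho by rewrite ltr_pdivrMr// ltr_pMr.
have slrl : sig / lam < rho / lam by rewrite ltr_pM2r// invr_gt0.
pose T := \int[mu]_(s in `]sig / lam, rho]) (F s / s).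
pose U0 := \int[mu]_(s in `]sig / lam, sig]) (F s / s).
pose U1 := \int[mu]_(s in `]rho / lam, rho]) (F s / s).
have iT := @iF _ rho sl0.
have E1 : T - \int[mu]_(s in `]sig / lam, rho / lam]) (F s / s) = U1.
  by apply: (Rintegral_itvB iT); rewrite bnd_simp ltW.
have E2 : T - U0 = \int[mu]_(s in `]sig, rho]) (F s / s).
  by apply: (Rintegral_itvB iT); rewrite bnd_simp ltW.
have E3 := @Rintegral_dilation sig rho sig0.
have U0ge : (gam - e0) * ln lam <= U0.
  have -> : ln lam = \int[mu]_(s in `]sig / lam, sig]) s^-1.
    by rewrite Rintegral_inv// invfM invrK mulrA divff ?mul1r// gt_eqF.
  rewrite -RintegralZl//; last first.
    have := iinv 1 sig sl0; congr (_.-integrable _ _).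
    by apply/funext => s /=; rewrite mul1r.
  apply: le_Rintegral => //; [exact: iinv|exact: iF|].
  move=> s /=; rewrite in_itv/= => /andP[s0 s1]; have sp := lt_trans sl0 s0.
  by rewrite ler_pM2r ?invr_gt0// Fcore// sp.
have iA : mu.-integrable `]rho / lam, rho] (EFin \o (fun s => `|F s| / s)).
  apply: (@integrable_bounded_itv _ _ _ (2 / (rho / lam))).
    apply: measurable_funTS; apply: measurable_funM; last exact: measurable_invr.
    exact: measurableT_comp.
  move=> x /andP[ax xb]; rewrite normrM normr_id ler_pM// normfV lef_pV2 ?posrE ?normr_gt0//.
  - by rewrite ger0_norm// ltW// (lt_trans rl0).
  - by rewrite gt_eqF// (lt_trans rl0).
have U1le : U1 <= \int[mu]_(s in `]rho / lam, rho]) (`|F s| / s).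
  apply: le_Rintegral => //; first exact: iF.
  move=> s /=; rewrite in_itv/= => /andP[s0 s1]; have sp := lt_trans rl0 s0.
  by rewrite ler_pM2r ?invr_gt0// ler_norm.
have iJ : mu.-integrable `]sig / lam, rho / lam]
    (EFin \o (fun s => (F s - F (lam * s)) ^+ 2 / s)).
  apply: (@integrable_bounded_itv _ _ _ (16 / (sig / lam))).
    apply: measurable_funTS; apply: measurable_funM; last exact: measurable_invr.
    by apply: measurable_funX; exact: measurable_funB.
  move=> x /andP[ax xb]; rewrite normrM ler_pM//.
    rewrite normrX -[16](_ : (4:R) ^+ 2 = _); last by rewrite expr2; lra.
    rewrite lerXn2r ?nnegrE//; apply: le_trans (ler_normB _ _) _.
    by have := F2 x; have := F2 (lam * x); lra.
  rewrite normfV lef_pV2 ?posrE ?normr_gt0//.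
  - by rewrite ger0_norm// ltW// (lt_trans sl0).
  - by rewrite gt_eqF// (lt_trans sl0).
pose A : set RR := [set` `]sig / lam, rho / lam]].
have mA : measurable A by exact: measurable_itv.
have iFA := iF (rho / lam) sl0.
have iFlA := iFl (rho / lam) sl0.
have iD : mu.-integrable A (EFin \o (fun s => F s / s - F (lam * s) / s)).
  exact: (integrableB mA iFA iFlA).
have i2D : mu.-integrable A (EFin \o (fun s => 2 * c * (F s / s - F (lam * s) / s))).
  by have := integrableZl mA (2 * c) iD; congr (_.-integrable _ _).
have iR : mu.-integrable A (EFin \o (fun s => (F s - F (lam * s)) ^+ 2 / s + c ^+ 2 * s^-1)).
  exact: (integrableD mA iJ (iinv (c ^+ 2) (rho / lam) sl0)).
have i1 : mu.-integrable A (EFin \o (fun s : R => s^-1)).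
  have := iinv 1 (rho / lam) sl0; congr (_.-integrable _ _).
  by apply/funext => s /=; rewrite mul1r.
have : \int[mu]_(s in A) (2 * c * (F s / s - F (lam * s) / s)) <=
    \int[mu]_(s in A) ((F s - F (lam * s)) ^+ 2 / s + c ^+ 2 * s^-1).
  apply: le_Rintegral => // s; rewrite /A/= in_itv/= => /andP[s0 s1].
  have sp := lt_trans sl0 s0.
  rewrite -mulrBl mulrA -mulrDl ler_pM2r ?invr_gt0//.
  have := sqr_ge0 (F s - F (lam * s) - c); rewrite !expr2; lra.
rewrite RintegralZl// (RintegralB mA iFA iFlA) (RintegralD mA iJ (iinv _ _ sl0)).
rewrite RintegralZl// Rintegral_inv//.
have -> : rho / lam / (sig / lam) = rho / sig.
  by rewrite invfM invrK mulrACA mulVf ?mulr1// gt_eqF.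
rewrite E3 -E2.
have -> : \int[mu]_(x in A) (F x / x) = T - U1 by move: E1; rewrite /A; lra.
have h1 := ler_wpM2l (mulr_ge0 (ltW (ltr0Sn R 1)) c0) U0ge.
have h2 := ler_wpM2l (mulr_ge0 (ltW (ltr0Sn R 1)) c0) U1le.
lra.
Qed.

(** Young's inequality with a free weight m, to be chosen proportional to
    sqrt (lam - 1) so that both terms remain integrable in lam. *)
Lemma boundary_term (m : R) : 0 < m ->
  ((\int[mu]_(s in `]rho / lam, rho]) (`|F s| / s))%:E <=
   (m / 2)%:E * \int[mu]_(s in `]0%R, rho[) (F s ^+ 2)%:E +
   ((lam - 1) / (2 * m * rho))%:E)%E.
Proof.
move=> m0.
have rl0 : 0 < rho / lam by rewrite divr_gt0.
have rlrho : rho / lam < rho by rewrite ltr_pdivrMr// ltr_pMr.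
pose A : set RR := [set` `]rho / lam, rho]].
have mA : measurable A by exact: measurable_itv.
have iA : mu.-integrable A (EFin \o (fun s => `|F s| / s)).
  apply: (@integrable_bounded_itv _ _ _ (2 / (rho / lam))).
    apply: measurable_funTS; apply: measurable_funM; last exact: measurable_invr.
    exact: measurableT_comp.
  move=> x /andP[ax xb]; rewrite normrM normr_id ler_pM// normfV lef_pV2 ?posrE ?normr_gt0//.
  - by rewrite ger0_norm// ltW// (lt_trans rl0).
  - by rewrite gt_eqF// (lt_trans rl0).
have iQ : mu.-integrable A (EFin \o (fun s => F s ^+ 2)).
  apply: (@integrable_bounded_itv _ _ _ 4).
    by apply: measurable_funTS; apply: measurable_funX.
  move=> x _; rewrite normrX -[4](_ : (2:R) ^+ 2 = _); last by rewrite expr2; lra.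
  by rewrite lerXn2r ?nnegrE.
have iV : mu.-integrable A (EFin \o (fun s : R => s ^- 2)).
  have := continuous_compact_integrable (@segment_compact _ (rho / lam) rho)
    (within_continuous_inv (b := rho) (n := 2) rl0).
  by apply: integrableS => //; exact: subset_itv_oc_cc.
have iQm : mu.-integrable A (EFin \o (fun s => m / 2 * F s ^+ 2)).
  by have := integrableZl mA (m / 2) iQ; congr (_.-integrable _ _).
have iVm : mu.-integrable A (EFin \o (fun s : R => (2 * m)^-1 * s ^- 2)).
  by have := integrableZl mA (2 * m)^-1 iV; congr (_.-integrable _ _).
have : \int[mu]_(s in A) (`|F s| / s) <=
    \int[mu]_(s in A) (m / 2 * F s ^+ 2 + (2 * m)^-1 * s ^- 2).
  apply: le_Rintegral => //; first exact: (integrableD mA iQm iVm).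
  move=> s _; rewrite -[F s ^+ 2]real_normK ?num_real// -exprVn invfM.
  set x := `|F s|; set y := s^-1.
  have : 0 <= 2^-1 * m^-1 * (m * x - y) ^+ 2.
    by apply: mulr_ge0; [rewrite mulr_ge0// invr_ge0// ltW|exact: sqr_ge0].
  rewrite sqrrB exprMn mulrDr mulrBr.
  have -> : 2^-1 * m^-1 * (m ^+ 2 * x ^+ 2) = m / 2 * x ^+ 2.
    by rewrite expr2 -mulrA [m^-1 * _]mulrA [m^-1 * (m * m)]mulKf ?gt_eqF//; lra.
  have -> : 2^-1 * m^-1 * (m * x * y *+ 2) = x * y.
    by rewrite -mulrA -mulrnAr -mulrA mulKf ?gt_eqF// -mulr_natr; lra.
  lra.
rewrite (RintegralD mA iQm iVm) (RintegralZl _ mA iQ) (RintegralZl _ mA iV) Rintegral_inv2//.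
have -> : (2 * m)^-1 * ((rho / lam)^-1 - rho^-1) = (lam - 1) / (2 * m * rho).
  by rewrite !invfM invrK; lra.
move=> key; apply: le_trans (_ : (m / 2 * \int[mu]_(s in A) (F s ^+ 2) + (lam - 1) / (2 * m * rho))%:E <= _)%E.
  by rewrite lee_fin.
rewrite EFinD leeD2r// EFinM; apply: lee_wpmul2l; first by rewrite lee_fin ltW// divr_gt0.
rewrite /Rintegral fineK; last exact: integrable_fin_num iQ.
have := @integral_itv_bndo_bndc _ (BRight (rho / lam)) rho (EFin \o (fun s => F s ^+ 2)).
move=> <-; last by apply: measurable_funTS; apply/measurable_EFinP; exact: measurable_funX.
apply: ge0_subset_integral => //.
- by apply: measurable_funTS; apply/measurable_EFinP; exact: measurable_funX.
- by move=> x _; rewrite lee_fin sqr_ge0.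
- by move=> x /=; rewrite !in_itv/= => /andP[x0 ->]; rewrite (lt_trans rl0 x0).
Qed.

End radial.

(** * Lower bound for the energy of one wall *)

Section wall_lower.
Context {R : realType}.
Local Notation mu := (@lebesgue_measure R).
Local Notation RR := (measurableTypeR R).

(** The integrand of the seminorm. *)
Definition quot (f : R -> R) (s t : R) : R := (f s - f t) ^+ 2 / (s - t) ^+ 2.

Lemma quot_ge0 f s t : 0 <= quot f s t.
Proof. by rewrite /quot divr_ge0 ?sqr_ge0. Qed.

Lemma quotC f s t : quot f s t = quot f t s.
Proof. by rewrite /quot -sqrrN opprB; congr (_ / _); rewrite -sqrrN opprB. Qed.

Lemma measurable_quot (f : R -> R) : measurable_fun setT (f : RR -> R) ->
  measurable_fun setT (fun z : RR * RR => quot f z.1 z.2).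
Proof.
move=> mf; rewrite /quot; apply: measurable_funM.
  by apply: measurable_funX; apply: measurable_funB; apply: (measurableT_comp mf).
by apply: measurable_funV; apply: measurable_funX; apply: measurable_funB.
Qed.

Lemma quot_dilation (f : R -> R) (s l : R) : 0 < s -> 1 < l ->
  quot f s (l * s) = (f s - f (l * s)) ^+ 2 / s ^+ 2 * (l - 1) ^- 2.
Proof.
move=> s0 l1; rewrite /quot -mulrA; congr (_ * _).
by rewrite -invfM -exprMn -sqrrN; congr (_ ^- 2); lra.
Qed.

Lemma quot_opp_dilation (f : R -> R) (s l : R) :
  quot f s (- (l * s)) = (f s - f (- (l * s))) ^+ 2 / s ^+ 2 * (l + 1) ^- 2.
Proof.
rewrite /quot -mulrA; congr (_ * _).
by rewrite -invfM -exprMn; congr (_ ^- 2); lra.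
Qed.

Definition evenpart (f : R -> R) (s : R) : R := (f s + f (- s)) / 2.

(** By convexity of the square, replacing f by its even part decreases the
    eight contributions of a pair of radii. *)
Lemma quot_even_lower (f : R -> R) (s l : R) : 0 < s -> 1 < l ->
  4 * kern l * ((evenpart f s - evenpart f (l * s)) ^+ 2 / s) <=
  (quot f s (l * s) + quot f s (- (l * s)) +
   (quot f (- s) (l * s) + quot f (- s) (- (l * s))) +
   (quot f (l * s) s + quot f (l * s) (- s) +
   (quot f (- (l * s)) s + quot f (- (l * s)) (- s)))) * s.
Proof.
move=> s0 l1.
rewrite [quot f (l * s) s]quotC [quot f (- (l * s)) s]quotC.
rewrite [quot f (l * s) (- s)]quotC [quot f (- (l * s)) (- s)]quotC.
have q1 := quot_dilation f s0 l1; have q2 := quot_opp_dilation f s l.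
have q3 : quot f (- s) (l * s) = (f (- s) - f (l * s)) ^+ 2 / s ^+ 2 * (l + 1) ^- 2.
  by have := quot_opp_dilation f (- s) l; rewrite mulrN opprK sqrrN.
have q4 : quot f (- s) (- (l * s)) = (f (- s) - f (- (l * s))) ^+ 2 / s ^+ 2 * (l - 1) ^- 2.
  rewrite /quot -mulrA; congr (_ * _).
  by rewrite -invfM -exprMn; congr (_ ^- 2); lra.
rewrite q1 q2 q3 q4 /kern.
set a := f s; set b := f (- s); set c := f (l * s); set d := f (- (l * s)).
set u := (l - 1) ^- 2; set v := (l + 1) ^- 2.
have u0 : 0 <= u by rewrite invr_ge0 sqr_ge0.
have v0 : 0 <= v by rewrite invr_ge0 sqr_ge0.
rewrite /evenpart -/a -/b -/c -/d.
have si : s ^+ 2 = s * s by rewrite expr2.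
have E x : x / s ^+ 2 * s = x / s by rewrite si invfM mulrA divfK// gt_eqF.
have i0 : 0 <= s^-1 by rewrite invr_ge0 ltW.
have -> : ((a - c) ^+ 2 / s ^+ 2 * u + (a - d) ^+ 2 / s ^+ 2 * v +
  ((b - c) ^+ 2 / s ^+ 2 * v + (b - d) ^+ 2 / s ^+ 2 * u) +
  ((a - c) ^+ 2 / s ^+ 2 * u + (b - c) ^+ 2 / s ^+ 2 * v +
   ((a - d) ^+ 2 / s ^+ 2 * v + (b - d) ^+ 2 / s ^+ 2 * u))) * s =
  2 * (((a - c) ^+ 2 + (b - d) ^+ 2) * u + ((a - d) ^+ 2 + (b - c) ^+ 2) * v) / s.
  by rewrite -E; lra.
rewrite mulrA ler_wpM2r//.
set w := (a + b) / 2 - (c + d) / 2.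
have h1 : 2 * w ^+ 2 <= (a - c) ^+ 2 + (b - d) ^+ 2.
  have := sqr_ge0 ((a - c) - (b - d)); rewrite /w !expr2; lra.
have h2 : 2 * w ^+ 2 <= (a - d) ^+ 2 + (b - c) ^+ 2.
  have := sqr_ge0 ((a - d) - (b - c)); rewrite /w !expr2; lra.
have := ler_wpM2r u0 h1; have := ler_wpM2r v0 h2; lra.
Qed.

Lemma measurable_evenpart (f : R -> R) : measurable_fun setT (f : RR -> R) ->
  measurable_fun setT (evenpart f : RR -> R).
Proof.
move=> mf; rewrite /evenpart; apply: measurable_funM => //.
apply: measurable_funD => //; apply: (measurableT_comp mf); exact: oppr_measurable.
Qed.

Definition square_pairs (p rho : R) (s t : R) : bool :=
  (`|s - p| <= rho) && (`|t - p| <= rho).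

Lemma measurable_square_pairs (p rho : R) :
  measurable_fun setT (fun z : RR * RR => square_pairs p rho z.1 z.2).
Proof.
rewrite /square_pairs; apply: measurable_and; apply: measurable_fun_ler => //;
  apply: (measurableT_comp (@normr_measurable R setT)); exact: measurable_funB.
Qed.

(** For each ratio l, telescope_lower is applied to the even part of f with
    c = gam ln l / L, which maximizes 2 c gam ln l - c^2 L; the result is
    integrated against kern l.  The L^2 norm on the right comes from
    boundary_term. *)
Lemma wall_lower_pos (f : R -> R) (gam e0 sig rho tau L : R) : L = ln (rho / sig) ->
  measurable_fun setT (f : RR -> R) -> (forall s, `|f s| <= 2) ->
  0 <= gam -> 0 <= e0 -> 0 < sig -> sig < rho -> 0 < tau ->
  (forall s, `|s| <= sig -> gam - e0 <= f s) ->
  ((4 * gam ^+ 2 / L * Kln)%:E <=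
   \int[mu]_s \int[mu]_t (if square_pairs 0 rho s t then (quot f s t)%:E else 0) +
   (8 * gam * e0 / L * Kln)%:E +
   (8 * gam / L * Ksqrt)%:E *
     ((tau / 4)%:E * \int[mu]_(s in `](- rho)%R, rho[) (f s ^+ 2)%:E +
      (1 / (2 * tau * rho))%:E))%E.
Proof.
move=> LE mf f2 g0 e00 sig0 sigrho tau0 core.
have rho0 : 0 < rho by exact: lt_trans sig0 sigrho.
have L0 : 0 < L by rewrite LE ln_gt0// ltr_pdivlMr// mul1r.
pose F := evenpart f.
have mF : measurable_fun setT (F : RR -> R) by exact: measurable_evenpart.
have F2 s : `|F s| <= 2.
  rewrite /F /evenpart normrM (ger0_norm (_ : 0 <= 2^-1)) ?invr_ge0//.
  rewrite ler_pdivrMr//; apply: le_trans (ler_normD _ _) _.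
  by have := f2 s; have := f2 (- s); lra.
have Fcore s : 0 < s <= sig -> gam - e0 <= F s.
  move=> /andP[s0 s1]; rewrite /F /evenpart.
  have h1 : `|s| <= sig by rewrite gtr0_norm.
  have := core s h1; have := core (- s); rewrite normrN => /(_ h1); lra.
pose Q := (\int[mu]_(s in `]0%R, rho[) (F s ^+ 2)%:E)%E.
have Q0 : (0 <= Q)%E by apply: integral_ge0 => s _; rewrite lee_fin sqr_ge0.
have Qf : Q \is a fin_num.
  have i1 : mu.-integrable `]0, rho] (EFin \o (fun s => F s ^+ 2)).
    apply: (@integrable_bounded_itv _ _ _ _ 4).
      by apply: measurable_funTS; apply: measurable_funX.
    move=> x _; rewrite normrX -[4](_ : (2:R) ^+ 2 = _); last by rewrite expr2; lra.
    by rewrite lerXn2r ?nnegrE.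
  have i2 : mu.-integrable (`]0, rho[%classic : set RR) (EFin \o (fun s => F s ^+ 2)).
    by apply: integrableS i1 => //; exact: subset_itv_oo_oc.
  have mA : measurable (`]0, rho[%classic : set RR) by exact: measurable_itv.
  by have := integrable_fin_num mA i2.
have mf2 : measurable_fun setT (fun s : RR => (f s ^+ 2)%:E).
  by apply/measurable_EFinP; exact: measurable_funX.
have QE : (Q <= 2^-1%:E * \int[mu]_(s in `](- rho)%R, rho[) (f s ^+ 2)%:E)%E.
  have mI : measurable_fun setT (fun s : RR => if (- rho < s < rho)%R then (f s ^+ 2)%:E else 0%E).
    apply: measurable_fun_ifT => //; apply: measurable_and; exact: measurable_fun_ltr.
  rewrite [in leRHS]integral_ooE (integral_pos_neg mI); last first.
    by move=> s; case: ifP => // _; rewrite lee_fin sqr_ge0.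
  rewrite -ge0_integralZl//; first last.
  - by move=> s _; apply: adde_ge0; case: ifP => // _; rewrite lee_fin sqr_ge0.
  - apply: measurable_funTS; apply: emeasurable_funD => //.
    by apply: (measurableT_comp mI); exact: oppr_measurable.
  rewrite /Q [leLHS]integral_ooE [leRHS]integral_gtE; apply: ge0_le_integral => //.
  - by move=> s _; case: ifP => // _; rewrite lee_fin sqr_ge0.
  - apply: measurable_fun_ifT => //.
      by apply: measurable_and; exact: measurable_fun_ltr.
    by apply/measurable_EFinP; exact: measurable_funX.
  - apply: measurable_fun_ifT => //; first exact: measurable_gt.
    apply: emeasurable_funM => //; apply: emeasurable_funD => //.
    by apply: (measurableT_comp mI); exact: oppr_measurable.
  move=> s _; case: ifP => [/andP[s0 s1]|_]; last first.
    case: ifP => // _; rewrite mule_ge0// ?lee_fin ?invr_ge0//.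
    by apply: adde_ge0; case: ifP => // _; rewrite lee_fin sqr_ge0.
  rewrite s0 s1 andbT !ifT; [|lra..].
  rewrite -EFinD -EFinM lee_fin /F /evenpart.
  have := sqr_ge0 (f s - f (- s)); rewrite !expr2; lra.
pose h (z : RR * RR) := if square_pairs 0 rho z.1 z.2 then (quot f z.1 z.2)%:E else 0%E.
have mh : measurable_fun setT h.
  apply: measurable_fun_ifT => //; first exact: measurable_square_pairs.
  by apply/measurable_EFinP; exact: measurable_quot.
have h0 z : (0 <= h z)%E by rewrite /h; case: ifP => // _; rewrite lee_fin quot_ge0.
rewrite (polar mh h0).
set inner := (fun l : RR => \int[mu]_(s in _) _)%E.
have inner0 l : (0 <= inner l)%E.
  apply: integral_ge0 => s; rewrite /= in_itv/= andbT => s0.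
  by rewrite mule_ge0 ?adde_ge0// lee_fin ltW.
have minner : measurable_fun setT inner.
  pose P (z : RR * RR) := if (0 < z.2)%R then
     ((h (z.2, ((z.1 : R) * (z.2 : R))%R) + h (z.2, - ((z.1 : R) * (z.2 : R)))%R +
      (h (- (z.2 : R), (z.1 : R) * (z.2 : R))%R + h (- (z.2 : R), - ((z.1 : R) * (z.2 : R)))%R) +
      (h ((z.1 : R) * (z.2 : R), z.2)%R + h ((z.1 : R) * (z.2 : R), - (z.2 : R))%R +
      (h (- ((z.1 : R) * (z.2 : R)), z.2)%R + h (- ((z.1 : R) * (z.2 : R)), - (z.2 : R))%R))) * (z.2 : R)%:E)%E
     else 0%E.
  have mP : measurable_fun setT P by rewrite /P; meas.
  have P0 z : (0 <= P z)%E.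
    by rewrite /P; case: ifP => // z0; rewrite mule_ge0 ?adde_ge0// lee_fin ltW.
  have -> : inner = fun l : RR => (\int[mu]_s P (l, s))%E.
    by apply/funext => l; rewrite /inner integral_gtE.
  exact: (measurable_fun_fubini_tonelli_F P).
have key l : 1 < l -> ((4 * gam ^+ 2 / L * (kern l * ln l ^+ 2))%:E <=
   inner l + (8 * gam * e0 / L * (kern l * ln l ^+ 2))%:E +
   (8 * gam / L * wgt l)%:E * ((tau / 2)%:E * Q + (1 / (2 * tau * rho))%:E))%E.
  move=> l1; have l0 : 0 < l by exact: lt_trans ltr01 l1.
  have ll : 0 < ln l by rewrite ln_gt0.
  pose J := \int[mu]_(s in `]sig / l, rho / l]) ((F s - F (l * s)) ^+ 2 / s).
  pose X := \int[mu]_(s in `]rho / l, rho]) (`|F s| / s).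
  pose q := Num.sqrt (l - 1).
  have q0 : 0 < q by rewrite sqrtr_gt0 subr_gt0.
  have qq : l - 1 = q ^+ 2 by rewrite sqr_sqrtr// subr_ge0 ltW.
  (* The optimal slope: F drops from gam to 0 along a logarithmic length L. *)
  pose c := gam * ln l / L.
  have c0 : 0 <= c by rewrite divr_ge0 ?mulr_ge0// ltW.
  have tl := telescope_lower mF F2 sig0 sigrho l1 Fcore c0.
  rewrite -/J -/X -LE in tl.
  have bt := boundary_term mF F2 sig0 sigrho l1 (mulr_gt0 tau0 q0).
  rewrite -/X -/Q in bt.
  have k0 := kern_ge0 l.
  have innerJ : ((4 * kern l * J)%:E <= inner l)%E.
    have iJ : mu.-integrable `]sig / l, rho / l]
        (EFin \o (fun s => (F s - F (l * s)) ^+ 2 / s)).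
      have sl0 : 0 < sig / l by rewrite divr_gt0.
      apply: (@integrable_bounded_itv _ _ _ _ (16 / (sig / l))).
        apply: measurable_funTS; apply: measurable_funM; last exact: measurable_invr.
        apply: measurable_funX; apply: measurable_funB => //.
        by apply: (measurableT_comp mF); exact: measurable_funM.
      move=> x /andP[ax xb]; rewrite normrM ler_pM//.
        rewrite normrX -[16](_ : (4:R) ^+ 2 = _); last by rewrite expr2; lra.
        rewrite lerXn2r ?nnegrE//; apply: le_trans (ler_normB _ _) _.
        by have := F2 x; have := F2 (l * x); lra.
      rewrite normfV lef_pV2 ?posrE ?normr_gt0//.
      - by rewrite ger0_norm// ltW// (lt_trans sl0).
      - by rewrite gt_eqF// (lt_trans sl0).
    have mJ : measurable_fun setT (fun s : RR => ((F s - F (l * s)) ^+ 2 / s)%:E).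
      apply/measurable_EFinP; apply: measurable_funM; last exact: measurable_invr.
      apply: measurable_funX; apply: measurable_funB => //.
      by apply: (measurableT_comp mF); exact: measurable_funM.
    rewrite EFinM /J /Rintegral fineK; last exact: integrable_fin_num iJ.
    rewrite -ge0_integralZl//; first last.
    - by rewrite lee_fin mulr_ge0.
    - move=> s; rewrite /= in_itv/= => /andP[s0 _].
      have sp : 0 < s by apply: lt_trans s0; rewrite divr_gt0.
      by rewrite lee_fin divr_ge0 ?sqr_ge0// ltW.
    - exact: measurable_funTS.
    rewrite /inner [leLHS]integral_mkcond [leRHS]integral_gtE.
    apply: ge0_le_integral => //.
    - move=> s _; rewrite patchE; case: ifPn => //; rewrite inE/= in_itv/= => /andP[s0 _].
      have sp : 0 < s by apply: lt_trans s0; rewrite divr_gt0.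
      rewrite -EFinM lee_fin; apply: mulr_ge0; first exact: mulr_ge0.
      by apply: divr_ge0; [exact: sqr_ge0|exact: ltW].
    - apply: (iffLR (measurable_restrictT _ (measurable_itv `]sig / l, rho / l]))).
      by apply: measurable_funTS; apply: emeasurable_funM.
    - apply: measurable_fun_ifT => //; first exact: measurable_gt.
      by meas.
    move=> s _; rewrite patchE; case: ifPn; last first.
      by move=> _; case: ifP => // s0; rewrite mule_ge0 ?adde_ge0// lee_fin ltW.
    rewrite inE/= in_itv/= => /andP[s0 s1].
    have sp : 0 < s by apply: lt_trans s0; rewrite divr_gt0.
    rewrite sp /h/= /square_pairs !subr0 !normrN.
    have lsp : 0 < l * s by exact: mulr_gt0.
    have ls1 : l * s <= rho by move: s1; rewrite ler_pdivlMr// mulrC.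
    have sr : s <= rho by apply: le_trans ls1; rewrite ler_peMl// ltW.
    rewrite (gtr0_norm sp) (gtr0_norm lsp) sr ls1/=.
    rewrite -!EFinD -!EFinM lee_fin.
    exact: quot_even_lower.
  have kl0 : 0 <= kern l * ln l by rewrite mulr_ge0// ltW.
  have wE : wgt l = kern l * ln l * q by [].
  apply: le_trans (leeD2r _ (leeD2r _ innerJ)).
  rewrite -(fineK Qf) in bt *; set Qr := fine Q in bt *.
  rewrite -!EFinM -!EFinD lee_fin in bt *.
  have mq : (l - 1) / (2 * (tau * q) * rho) = q / (2 * tau * rho).
    rewrite qq (_ : 2 * (tau * q) * rho = q * (2 * tau * rho)); last lra.
    by rewrite expr2 -mulf_div divff ?mul1r// gt_eqF.
  rewrite mq in bt.
  have tlE : gam ^+ 2 * ln l ^+ 2 / L <= J + 2 * (gam * e0 * ln l ^+ 2 / L) + 2 * c * X.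
    have -> : gam ^+ 2 * ln l ^+ 2 / L = 2 * c * (gam - e0) * ln l - c ^+ 2 * L +
       2 * (gam * e0 * ln l ^+ 2 / L).
      have -> : c ^+ 2 * L = gam ^+ 2 * ln l ^+ 2 / L.
        by rewrite /c expr_div_n exprMn expr2 [L ^+ 2]expr2 invfM !mulrA divfK ?gt_eqF// -!expr2.
      rewrite /c !expr2; lra.
    lra.
  have := ler_wpM2l (mulr_ge0 (mulr_ge0 (ltW (ltr0Sn R 3)) k0) (ler0n _ 1)) tlE.
  have := ler_wpM2l (mulr_ge0 (mulr_ge0 (ltW (ltr0Sn R 7)) k0) c0) bt.
  rewrite lee_fin wE /c !expr2 !mulr1.
  lra.
apply: (@le_trans _ _ (\int[mu]_(l in `]1%R, +oo[) (inner l + (8 * gam * e0 / L * (kern l * ln l ^+ 2))%:E +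
   (8 * gam / L * wgt l)%:E * ((tau / 2)%:E * Q + (1 / (2 * tau * rho))%:E)))%E).
  have -> : ((4 * gam ^+ 2 / L * Kln)%:E = \int[mu]_(l in `]1%R, +oo[)
     (4 * gam ^+ 2 / L * (kern l * ln l ^+ 2))%:E)%E.
    under eq_integral do rewrite EFinM.
    rewrite ge0_integralZl//.
    - by rewrite KlnE.
    - apply: measurable_funTS; apply/measurable_EFinP; apply: measurable_funM; first exact: measurable_kern.
      by apply: measurable_funX; exact: measurable_lnR.
    - by move=> l _; rewrite lee_fin mulr_ge0 ?kern_ge0 ?sqr_ge0.
    - by rewrite lee_fin divr_ge0 ?mulr_ge0 ?sqr_ge0// ltW.
  apply: ge0_le_integral => //.
  - move=> l _; rewrite lee_fin mulr_ge0//; first by rewrite divr_ge0 ?mulr_ge0 ?sqr_ge0// ltW.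
    by rewrite mulr_ge0 ?kern_ge0 ?sqr_ge0.
  - apply: measurable_funTS; apply/measurable_EFinP; apply: measurable_funM => //.
    apply: measurable_funM; first exact: measurable_kern.
    by apply: measurable_funX; exact: measurable_lnR.
  - apply: measurable_funTS; apply: emeasurable_funD; first apply: emeasurable_funD => //.
      apply/measurable_EFinP; apply: measurable_funM => //.
      apply: measurable_funM; first exact: measurable_kern.
      by apply: measurable_funX; exact: measurable_lnR.
    apply: emeasurable_funM => //; apply/measurable_EFinP.
    by apply: measurable_funM => //; exact: measurable_wgt.
  - by move=> l; rewrite /= in_itv/= andbT; exact: key.
have mk : measurable_fun (`]1, +oo[%classic : set RR) (fun l : RR => (kern l * ln l ^+ 2)%:E).
  apply: measurable_funTS; apply/measurable_EFinP; apply: measurable_funM; first exact: measurable_kern.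
  by apply: measurable_funX; exact: measurable_lnR.
have mw : measurable_fun (`]1, +oo[%classic : set RR) (fun l : RR => (wgt l)%:E).
  by apply: measurable_funTS; apply/measurable_EFinP; exact: measurable_wgt.
have w0 l : (`]1, +oo[%classic : set RR) l -> (0 <= (wgt l)%:E)%E.
  by rewrite /= in_itv/= andbT => /ltW l1; rewrite lee_fin wgt_ge0.
have kl0 l : (0 <= (kern l * ln l ^+ 2)%:E)%E by rewrite lee_fin mulr_ge0 ?kern_ge0 ?sqr_ge0.
have a1 : (0 <= (8 * gam * e0 / L)%:E)%E by rewrite lee_fin divr_ge0 ?mulr_ge0// ltW.
have a2 : (0 <= (8 * gam / L)%:E)%E by rewrite lee_fin divr_ge0 ?mulr_ge0// ltW.
set Z := ((tau / 2)%:E * Q + (1 / (2 * tau * rho))%:E)%E.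
have Z0 : (0 <= Z)%E.
  rewrite adde_ge0// ?mule_ge0// lee_fin ?divr_ge0// ?mulr_ge0// ltW//.
under eq_integral => l _ do
  rewrite (EFinM (8 * gam * e0 / L)) (EFinM (8 * gam / L)).
rewrite ge0_integralD; first last.
- by apply: emeasurable_funM => //; apply: emeasurable_funM.
- by move=> l l1; rewrite mule_ge0// mule_ge0// w0.
- apply: emeasurable_funD; first exact: measurable_funTS.
  by apply: emeasurable_funM.
- by move=> l l1; rewrite adde_ge0// mule_ge0.
- exact: measurable_itv.
rewrite ge0_integralD//; first last.
- by apply: emeasurable_funM.
- by move=> l l1; rewrite mule_ge0.
- exact: measurable_funTS.
rewrite ge0_integralZr//; first last.
- by move=> l l1; rewrite mule_ge0// w0.
- by apply: emeasurable_funM.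
rewrite ge0_integralZl// ge0_integralZl// KlnE KsqrtE -!EFinM.
rewrite leeD2l// lee_wpmul2l//; first by rewrite lee_fin mulr_ge0// ?Ksqrt_ge0// divr_ge0 ?mulr_ge0// ltW.
rewrite leeD2r//; apply: le_trans (lee_wpmul2l _ QE) _; first by rewrite lee_fin divr_ge0 ?ltW.
rewrite muleA -EFinM (_ : tau / 2 / 2 = tau / 4)//; lra.
Qed.

End wall_lower.

(** * Profiles and the decomposition into cores *)

Section profiles.
Context {R : realType}.
Local Notation mu := (@lebesgue_measure R).
Local Notation RR := (measurableTypeR R).
Local Notation D := (`]-1, 1[%classic : set RR).

Definition profile (alpha : R) (m : R -> R * R) (x : R) : R :=
  extend_cos alpha (fst \o m) x - cos alpha.

Lemma profileE alpha m x :
  profile alpha m x = if -1 < x < 1 then (m x).1 - cos alpha else 0.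
Proof.
rewrite /profile /extend_cos in_itv/=; case: ifP => // _.
by rewrite subrr.
Qed.

Lemma measurable_profile alpha m : H1S1 m ->
  measurable_fun setT (profile alpha m : RR -> R).
Proof.
move=> [[L1 _ _] _ _]; have /L2P[mu1 _] := L1.
have -> : profile alpha m = (fun x => (m x).1 - cos alpha) \_ D.
  apply/funext => x; rewrite profileE patchE; case: ifPn => xD.
    by rewrite mem_set//= in_itv.
  by rewrite memNset//= in_itv/=; apply/negP.
apply: (iffLR (measurable_restrictT _ (measurable_itv `]-1, 1[))).
exact: measurable_funB.
Qed.

Lemma H1S1_bound (m : R -> R * R) (x : R) : H1S1 m -> -1 <= x <= 1 -> `|(m x).1| <= 1.
Proof.
move=> [_ _ mS] xD; have := mS x; rewrite in_itv/= => /(_ xD) h.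
rewrite -[leRHS](@ger0_norm _ 1)// -ler_sqr ?nnegrE//.
rewrite !real_normK ?num_real// expr1n; have := sqr_ge0 (m x).2; lra.
Qed.

Lemma profile_bound alpha m s : H1S1 m -> `|profile alpha m s| <= 2.
Proof.
move=> mS; rewrite profileE; case: ifP => [/andP[s1 s2]|_]; last by rewrite normr0.
apply: le_trans (ler_normB _ _) _.
have sD : -1 <= s <= 1 by rewrite !ltW.
have h := H1S1_bound mS sD.
have : `|cos alpha| <= 1 by rewrite ler_norml cos_geN1 cos_le1.
lra.
Qed.

Lemma dirichlet_fin_num (m : R -> R * R) : H1S1 m -> dirichlet m \is a fin_num.
Proof.
move=> [H1m H2m _].
have w1 := H1_weak_derivative H1m; have w2 := H1_weak_derivative H2m.
have mD : measurable D by [].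
have := integrableD mD (L2_sqr_integrable (proj1 w1)) (L2_sqr_integrable (proj1 w2)).
by move=> /(integrable_fin_num mD).
Qed.

Lemma dirichlet_ge0 (m : R -> R * R) : (0 <= dirichlet m)%E.
Proof. by apply: integral_ge0 => x _; rewrite lee_fin addr_ge0// sqr_ge0. Qed.

Lemma H1S1_increment (m : R -> R * R) (x y : R) : H1S1 m -> -1 < x -> x < y -> y < 1 ->
  ((m y).1 - (m x).1) ^+ 2 + ((m y).2 - (m x).2) ^+ 2 <=
    (y - x) * fine (dirichlet m).
Proof.
move=> mS x1 xy y1; have dfin := dirichlet_fin_num mS.
have [H1m H2m _] := mS.
have w1 := H1_weak_derivative H1m; have w2 := H1_weak_derivative H2m.
have [L1 _ c1] := H1m; have [L2' _ c2] := H2m.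
have h1 := weak_derivative_holder L1 c1 w1 x1 xy y1.
have h2 := weak_derivative_holder L2' c2 w2 x1 xy y1.
have mD : measurable D by [].
have dE : (dirichlet m = \int[mu]_(t in D) (weak_derivative (fst \o m) t ^+ 2)%:E +
   \int[mu]_(t in D) (weak_derivative (snd \o m) t ^+ 2)%:E)%E.
  rewrite /dirichlet; under eq_integral do rewrite EFinD.
  have mm g : L2 g -> measurable_fun D (fun x => (g x ^+ 2)%:E).
    by move=> /L2P[mg _]; apply/measurable_EFinP; exact: measurable_funX.
  rewrite ge0_integralD//.
  - by move=> t _; rewrite lee_fin sqr_ge0.
  - exact: mm (proj1 w1).
  - by move=> t _; rewrite lee_fin sqr_ge0.
  - exact: mm (proj1 w2).
rewrite -lee_fin EFinD (EFinM (y - x)) fineK// dE.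
rewrite ge0_muleDr; [|by apply: integral_ge0 => t _; rewrite lee_fin sqr_ge0..].
exact: (leeD h1 h2).
Qed.

(** On the circle |m - m p|^2 = 2 (1 - d m_1), so the Hoelder bound for m
    gives a bound on m_1 that is of first order in |x - p|. *)
Lemma wall_core (m : R -> R * R) (p d x : R) : H1S1 m -> -1 < p < 1 -> (m p).1 = d -> d = 1 \/ d = -1 ->
  -1 < x < 1 -> `|(m x).1 - d| <= `|x - p| * fine (dirichlet m) / 2.
Proof.
move=> mS /andP[p1 p2] mp d1 /andP[x1 x2].
have dd : d ^+ 2 = 1 by case: d1 => ->; rewrite ?sqrrN expr1n.
have [_ _ S] := mS.
have Sp := S p; rewrite in_itv/= !ltW// in Sp; have {}Sp := Sp isT.
have Sx := S x; rewrite in_itv/= !ltW// in Sx; have {}Sx := Sx isT.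
have p20 : (m p).2 = 0.
  by apply/eqP; rewrite -sqrf_eq0; apply/eqP; move: Sp; rewrite mp dd; lra.
have inc : ((m x).1 - d) ^+ 2 + ((m x).2) ^+ 2 <= `|x - p| * fine (dirichlet m).
  have [xp|px|->] := ltgtP x p.
  - have := H1S1_increment mS x1 xp p2; rewrite mp p20 sub0r sqrrN.
    rewrite (distrC x p) gtr0_norm ?subr_gt0//.
    by rewrite (_ : (d - (m x).1) ^+ 2 = ((m x).1 - d) ^+ 2)// -sqrrN opprB.
  - have := H1S1_increment mS p1 px x2; rewrite mp p20 subr0.
    by rewrite gtr0_norm ?subr_gt0.
  - by rewrite mp p20 !subrr normr0 mul0r expr0n/= addr0.
have E : ((m x).1 - d) ^+ 2 + ((m x).2) ^+ 2 = 2 * (1 - d * (m x).1).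
  rewrite sqrrB dd -[(m x).2 ^+ 2](addKr ((m x).1 ^+ 2)) Sx -mulr_natr; lra.
have xD : -1 <= x <= 1 by rewrite !ltW.
have bx := H1S1_bound mS xD.
have : `|(m x).1 - d| = 1 - d * (m x).1.
  move: bx; rewrite ler_norml => /andP[b1 b2].
  by case: d1 => ->; [rewrite ler0_norm|rewrite ger0_norm]; lra.
move=> ->; lra.
Qed.

Variable N : nat.

(** The margin leaves room for cores of radius rho with gaps of size 2 rho,
    and for the deformation of their neighbourhoods of radius 2 rho. *)
Definition separated (rho : R) (p : 'I_N -> R) : Prop :=
  (forall n, -1 + 2 * rho <= p n <= 1 - 2 * rho) /\
  (forall i j, i != j -> 4 * rho <= `|p i - p j|).

Definition same_core (rho : R) (p : 'I_N -> R) (s t : R) : bool :=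
  [exists n, square_pairs (p n) rho s t].

Definition local_energy (rho p : R) (f : R -> R) : \bar R :=
  (\int[mu]_s \int[mu]_t (if square_pairs p rho s t then (quot f s t)%:E else 0))%E.

Definition off_energy (rho : R) (p : 'I_N -> R) (f : R -> R) : \bar R :=
  (\int[mu]_s \int[mu]_t (if same_core rho p s t then 0 else (quot f s t)%:E))%E.

Definition total_energy (f : R -> R) : \bar R :=
  (\int[mu]_s \int[mu]_t (quot f s t)%:E)%E.

Lemma measurable_same_core (rho : R) (p : 'I_N -> R) :
  measurable_fun setT (fun z : RR * RR => same_core rho p z.1 z.2).
Proof.
have -> : (fun z : RR * RR => same_core rho p z.1 z.2) =
    (fun z => has (fun n => square_pairs (p n) rho z.1 z.2) (enum 'I_N)).
  apply/funext => z; apply/existsP/hasP => [[n h]|[n _ h]]; exists n => //.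
  by rewrite mem_enum.
elim: (enum 'I_N) => [|n s IH] /=; first exact: measurable_cst.
by apply: measurable_or => //; exact: measurable_square_pairs.
Qed.

Lemma square_pairs_disjoint rho p i j s t : 0 < rho -> separated rho p ->
  square_pairs (p i) rho s t -> square_pairs (p j) rho s t -> i = j.
Proof.
move=> r0 [_ sep] /andP[h1 _] /andP[h2 _]; apply/eqP/negP => /negP ij.
have := sep _ _ ij; have := ler_distD s (p i) (p j).
rewrite (distrC (p i) s); lra.
Qed.

Lemma core_decomposition rho p (f : R -> R) : 0 < rho -> separated rho p ->
  measurable_fun setT (f : RR -> R) ->
  (\sum_(n < N) local_energy rho (p n) f + off_energy rho p f = total_energy f)%E.
Proof.
move=> r0 sep mf.
have mq := measurable_quot mf.
pose h (n : 'I_N) (z : RR * RR) := if square_pairs (p n) rho z.1 z.2 then (quot f z.1 z.2)%:E else 0%E.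
pose g (z : RR * RR) := if same_core rho p z.1 z.2 then 0%E else (quot f z.1 z.2)%:E.
have mh n : measurable_fun setT (h n).
  apply: measurable_fun_ifT => //; first exact: measurable_square_pairs.
  exact/measurable_EFinP.
have mg : measurable_fun setT g.
  apply: measurable_fun_ifT => //; first exact: measurable_same_core.
  exact/measurable_EFinP.
have h0 n z : (0 <= h n z)%E by rewrite /h; case: ifP => // _; rewrite lee_fin quot_ge0.
have g0 z : (0 <= g z)%E by rewrite /g; case: ifP => // _; rewrite lee_fin quot_ge0.
have mhi n : measurable_fun setT (fun s => \int[mu]_t h n (s, t))%E.
  exact: measurable_fun_fubini_tonelli_F.
have -> : (\sum_(n < N) local_energy rho (p n) f =
   \int[mu]_s \int[mu]_t (\sum_(n < N) h n (s, t)))%E.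
  rewrite -ge0_integral_sum; [|by []|exact: mhi
    |by move=> n s _; apply: integral_ge0 => t _; exact: (h0 n (s, t))].
  apply: eq_integral => s _; rewrite -ge0_integral_sum; [by []|by []
    |by move=> n; exact: (measurable_fun_pair2 s (mh n))
    |by move=> n t _; exact: (h0 n (s, t))].
rewrite /off_energy -ge0_integralD//; first last.
- exact: (measurable_fun_fubini_tonelli_F g).
- by move=> s _; apply: integral_ge0 => t _; exact: (g0 (s, t)).
- apply: (measurable_fun_fubini_tonelli_F (fun z => \sum_(n < N) h n z)%E) => //.
    exact: emeasurable_sum.
  by move=> z; exact: sume_ge0.
- by move=> s _; apply: integral_ge0 => t _; exact: sume_ge0.
apply: eq_integral => s _; rewrite -ge0_integralD//; first last.
- exact: (measurable_fun_pair2 s mg).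
- by move=> t _; exact: (g0 (s, t)).
- by apply: emeasurable_sum => n; exact: (measurable_fun_pair2 s (mh n)).
- by move=> t _; exact: sume_ge0.
apply: eq_integral => t _; case: ifPn => [/existsP[n hn]|/existsPn hn].
  rewrite (bigD1 n)//= /h/= hn big1 ?adde0// => i ni.
  case: ifP => // hi; have := square_pairs_disjoint r0 sep hi hn.
  by move=> /eqP; rewrite (negbTE ni).
by rewrite big1 ?add0e// => i _; rewrite /h/= (negbTE (hn i)).
Qed.

(** A point of a core interacts with all points of ]1, 2[, where f vanishes
    and which are at distance at most 3. *)
Lemma off_controls_core rho p alpha m n : 0 < rho -> separated rho p -> H1S1 m ->
  (\int[mu]_(s in `](p n - rho)%R, (p n + rho)%R[) (profile alpha m s ^+ 2)%:E <=
   9%:E * off_energy rho p (profile alpha m))%E.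
Proof.
move=> r0 sep mS; have mf := measurable_profile alpha mS; set f := profile alpha m in mf *.
have [/(_ n)/andP[p1 p2] _] := sep.
pose g (z : RR * RR) := if same_core rho p z.1 z.2 then 0%E else (quot f z.1 z.2)%:E.
have mg : measurable_fun setT g.
  apply: measurable_fun_ifT => //; first exact: measurable_same_core.
  by apply/measurable_EFinP; exact: measurable_quot.
have g0 z : (0 <= g z)%E by rewrite /g; case: ifP => // _; rewrite lee_fin quot_ge0.
have mgs s : measurable_fun setT (fun t => g (s, t)) by exact: (measurable_fun_pair2 s mg).
have mI : measurable_fun setT (fun s => \int[mu]_t g (s, t))%E.
  exact: (measurable_fun_fubini_tonelli_F g).
rewrite (_ : off_energy _ _ _ = \int[mu]_s \int[mu]_t g (s, t))%E//.
rewrite -ge0_integralZl//; last by move=> s _; apply: integral_ge0 => t _; exact: g0.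
rewrite integral_ooE; apply: ge0_le_integral => //.
- by move=> s _; case: ifP => // _; rewrite lee_fin sqr_ge0.
- apply: measurable_fun_ifT => //.
    by apply: measurable_and; exact: measurable_fun_ltr.
  by apply/measurable_EFinP; exact: measurable_funX.
- exact: emeasurable_funM.
move=> s _; case: ifP => [/andP[s1 s2]|_]; last first.
  by rewrite mule_ge0// integral_ge0// => t _; exact: g0.
rewrite -ge0_integralZl//.
have -> : ((f s ^+ 2)%:E = \int[mu]_(t in `]1%R, 2%R[) (f s ^+ 2)%:E)%E.
  rewrite integral_cst// [X in (_ * X)%E]lebesgue_measure_itv/= lte_fin ifT; last lra.
  by rewrite -EFinB -EFinM; congr _%:E; lra.
rewrite integral_ooE; apply: ge0_le_integral => //.
- by move=> t _; case: ifP => // _; rewrite lee_fin sqr_ge0.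
- apply: measurable_fun_ifT => //.
  by apply: measurable_and; exact: measurable_fun_ltr.
- by apply: emeasurable_funM => //; exact: mgs.
move=> t _; case: ifP => [/andP[t1 t2]|_]; last by rewrite mule_ge0//; exact: (g0 (s, t)).
rewrite /g/=.
have -> : same_core rho p s t = false.
  apply/negbTE/existsP => -[i /andP[_ ti]].
  have [/(_ i)/andP[q1 q2] _] := sep.
  by move: ti; rewrite ler_distl => /andP[? ?]; lra.
rewrite -EFinM lee_fin /quot.
have -> : f t = 0.
  by rewrite /f profileE ifF//; apply/negP => /andP[? ?]; lra.
rewrite subr0 mulrA ler_pdivlMr; last by rewrite exprn_even_gt0//= subr_eq0; apply/negP => /eqP; lra.
rewrite mulrC ler_wpM2r ?sqr_ge0// expr2; nra.
Qed.

End profiles.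

(** * Lower bound for the energy *)

Section lower_bound.
Context {R : realType}.
Local Notation mu := (@lebesgue_measure R).
Local Notation RR := (measurableTypeR R).
Local Notation D := (`]-1, 1[%classic : set RR).
Local Notation Kln := (@Kln R).
Local Notation Ksqrt := (@Ksqrt R).

(** Multiplication by the sign d makes the wall positive, which
    wall_lower_pos requires. *)
Lemma local_energy_shift (rho p d : R) (f : R -> R) : d ^+ 2 = 1 ->
  measurable_fun setT (f : RR -> R) ->
  local_energy rho p f = local_energy rho 0 (fun x => d * f (x + p)).
Proof.
move=> d2 mf; have mq := measurable_quot mf.
pose h (z : RR * RR) := if square_pairs p rho z.1 z.2 then (quot f z.1 z.2)%:E else 0%E.
have mh : measurable_fun setT h.
  apply: measurable_fun_ifT => //; first exact: measurable_square_pairs.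
  exact/measurable_EFinP.
have h0 z : (0 <= h z)%E by rewrite /h; case: ifP => // _; rewrite lee_fin quot_ge0.
have mI : measurable_fun setT (fun s => \int[mu]_t h (s, t))%E.
  exact: (measurable_fun_fubini_tonelli_F h).
transitivity (\int[mu]_s \int[mu]_t h (s, t))%E; first by [].
rewrite (integral_shift p mI); last first.
  by move=> s; apply: integral_ge0 => t _; exact: h0.
apply: eq_integral => s _.
rewrite (integral_shift p (measurable_fun_pair2 (s + p) mh)); last by move=> t; exact: h0.
apply: eq_integral => t _; rewrite /h/= /square_pairs !subr0 !addrK.
case: ifP => // _; congr _%:E; rewrite /quot -mulrBr exprMn d2 mul1r.
by congr (_ / _); congr (_ ^+ 2); lra.
Qed.

Lemma integral_core_shift (rho p d : R) (f : R -> R) : d ^+ 2 = 1 ->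
  measurable_fun setT (f : RR -> R) ->
  (\int[mu]_(s in `](- rho)%R, rho[) ((d * f (s + p)%R) ^+ 2)%:E =
   \int[mu]_(s in `](p - rho)%R, (p + rho)%R[) (f s ^+ 2)%:E)%E.
Proof.
move=> d2 mf; rewrite !integral_ooE [RHS](integral_shift p).
- apply: eq_integral => s _; rewrite exprMn d2 mul1r; congr (if _ then _ else _).
  by congr (_ && _); apply/idP/idP; lra.
- apply: measurable_fun_ifT => //.
    by apply: measurable_and; exact: measurable_fun_ltr.
  by apply/measurable_EFinP; exact: measurable_funX.
- by move=> s; case: ifP => // _; rewrite lee_fin sqr_ge0.
Qed.

Variables (alpha : R) (N : nat) (d : 'I_N -> R).
Hypothesis hd : signs d.

Definition wall (n : 'I_N) : R := d n - cos alpha.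

Definition Gamma : R := \sum_(n < N) wall n ^+ 2.

Lemma sqr_sign n : d n ^+ 2 = 1.
Proof. by case: (hd n) => ->; rewrite ?sqrrN expr1n. Qed.

Lemma wall_local_lower (rho sig tau L : R) (p : 'I_N -> R) (m : R -> R * R) (n : 'I_N) :
  L = ln (rho / sig) ->
  H1S1 m -> 0 < sig -> sig < rho -> separated rho p -> (m (p n)).1 = d n ->
  0 < tau ->
  ((4 * wall n ^+ 2 / L * Kln)%:E <= local_energy rho (p n) (profile alpha m) +
     (8 * sig * fine (dirichlet m) / L * Kln)%:E +
     (16 / L * Ksqrt)%:E * ((tau / 4)%:E * (9%:E * off_energy rho p (profile alpha m)) +
        (1 / (2 * tau * rho))%:E))%E.
Proof.
move=> LE mS sig0 sigrho sep mp tau0; set f := profile alpha m.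
have rho0 : 0 < rho by exact: lt_trans sig0 sigrho.
have L0 : 0 < L by rewrite LE ln_gt0// ltr_pdivlMr// mul1r.
have mf : measurable_fun setT (f : RR -> R) by exact: measurable_profile.
have d2 := sqr_sign n.
have [/(_ n)/andP[p1 p2] _] := sep.
set A := fine (dirichlet m).
have A0 : 0 <= A by apply: fine_ge0; exact: dirichlet_ge0.
pose g x := d n * f (x + p n).
have mg : measurable_fun setT (g : RR -> R).
  apply: measurable_funM => //; apply: (measurableT_comp mf); exact: measurable_funD.
have g2 s : `|g s| <= 2.
  have := profile_bound alpha (s + p n) mS.
  by rewrite /g normrM; case: (hd n) => ->; rewrite ?normrN normr1 mul1r.
have cle : -1 <= cos alpha <= 1 by rewrite cos_geN1 cos_le1.
pose gam := d n * wall n.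
have gamE : gam = 1 - d n * cos alpha by rewrite /gam /wall mulrBr -expr2 d2.
have gam02 : 0 <= gam <= 2.
  rewrite gamE; case: (hd n) => ->; case/andP: cle => ? ?; lra.
have [gam0 gamle] := andP gam02.
have core s : `|s| <= sig -> gam - sig * A / 2 <= g s.
  move=> ss; move: (ss); rewrite ler_norml => /andP[s1 s2].
  have pn : -1 < p n < 1 by apply/andP; split; lra.
  have sn : -1 < s + p n < 1 by apply/andP; split; lra.
  have := wall_core mS pn mp (hd n) sn; rewrite addrK -/A => h.
  have hA : `|s| * A / 2 <= sig * A / 2 by do 2 apply: ler_wpM2r => //.
  rewrite /g /f profileE sn gamE mulrBr.
  have : `|(m (s + p n)).1 - d n| <= sig * A / 2 by exact: le_trans hA.
  rewrite ler_norml => /andP[? ?].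
  by case: (hd n) => dn; rewrite dn in d2 *; rewrite dn in h *; lra.
have e0 : 0 <= sig * A / 2 by rewrite divr_ge0// mulr_ge0// ltW.
have := wall_lower_pos LE mg g2 gam0 e0 sig0 sigrho tau0 core.
rewrite -/(local_energy rho 0 g) -(local_energy_shift rho (p n) d2 mf).
rewrite (integral_core_shift rho (p n) d2 mf).
have -> : gam ^+ 2 = wall n ^+ 2 by rewrite /gam exprMn d2 mul1r.
move=> /le_trans; apply.
apply: leeD.
  apply: leeD => //; rewrite lee_fin ler_wpM2r ?Kln_ge0//.
  rewrite ler_pM2r ?invr_gt0//.
  have : 0 <= sig * A by rewrite mulr_ge0// ltW.
  nra.
apply: lee_pmul.
- have gL : 0 <= 8 * gam / L by apply: divr_ge0; [apply: mulr_ge0|exact: ltW].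
  by rewrite lee_fin; apply: mulr_ge0 => //; exact: Ksqrt_ge0.
- rewrite adde_ge0//; last by rewrite lee_fin divr_ge0// !mulr_ge0// ltW.
  apply: mule_ge0; first by rewrite lee_fin divr_ge0// ltW.
  by apply: integral_ge0 => s _; rewrite lee_fin sqr_ge0.
- rewrite lee_fin ler_wpM2r ?Ksqrt_ge0// ler_pM2r ?invr_gt0//; lra.
- apply: leeD => //; apply: lee_wpmul2l; first by rewrite lee_fin divr_ge0// ltW.
  exact: off_controls_core.
Qed.

Lemma total_energy_ge0 (f : R -> R) : (0 <= total_energy f)%E.
Proof. by apply: integral_ge0 => s _; apply: integral_ge0 => t _; rewrite lee_fin quot_ge0. Qed.

Lemma off_energy_ge0 (rho : R) (p : 'I_N -> R) (f : R -> R) : (0 <= off_energy rho p f)%E.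
Proof.
apply: integral_ge0 => s _; apply: integral_ge0 => t _.
by case: ifP => // _; rewrite lee_fin quot_ge0.
Qed.

Lemma local_energy_ge0 (rho p : R) (f : R -> R) : (0 <= local_energy rho p f)%E.
Proof.
apply: integral_ge0 => s _; apply: integral_ge0 => t _.
by case: ifP => // _; rewrite lee_fin quot_ge0.
Qed.

Lemma energyE (eps : R) (m : R -> R * R) :
  energy alpha eps m = ((eps / 2)%:E * dirichlet m +
    (4 * pi)^-1%:E * total_energy (profile alpha m))%E.
Proof.
rewrite /energy; congr (_ + _)%E.
rewrite /Hhalf_seminorm2 muleA -EFinM.
congr (_%:E * _)%E.
by rewrite -invfM; congr (_^-1); lra.
Qed.

(** The walls are summed: by the choice of eta the boundary errors use half
    of the energy Q outside the cores, and by the choice of sig the errors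
    in the cores use half of the Dirichlet energy A. *)
Lemma lower_arithmetic (sig rho eps L eta T Q A : R) (loc : 'I_N -> R) :
  0 < L -> 0 < eta -> 0 < rho -> 0 <= Q -> 0 <= A ->
  72 * N%:R * Ksqrt * eta <= 1 ->
  8 * N%:R * Kln * sig / (4 * pi * L) <= eps / 4 ->
  \sum_(n < N) loc n + Q = T ->
  (forall n, 4 * wall n ^+ 2 / L * Kln <= loc n + 8 * sig * A / L * Kln +
    16 / L * Ksqrt * (eta * L / 4 * (9 * Q) + 1 / (2 * (eta * L) * rho))) ->
  Kln * Gamma / (pi * L) + eps / 4 * A + (8 * pi)^-1 * Q <=
  eps / 2 * A + (4 * pi)^-1 * T + 2 * N%:R * Ksqrt / (pi * eta * rho) / L ^+ 2.
Proof.
move=> L0 eta0 rho0 O0 A0 etale sigle dec wl.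
have p0 : 0 < pi :> R by exact: pi_gt0.
have {}wl n : 4 * Kln / L * wall n ^+ 2 <= loc n +
    (8 * sig * A / L * Kln + 36 * eta * Ksqrt * Q + 8 * Ksqrt / (eta * rho) / L ^+ 2).
  rewrite (_ : 4 * Kln / L * wall n ^+ 2 = 4 * wall n ^+ 2 / L * Kln); last lra.
  apply: le_trans (wl n) _.
  rewrite -addrA lerD2l -addrA lerD2l.
  rewrite le_eqVlt; apply/orP; left; apply/eqP.
  rewrite mulrDr; congr (_ + _).
    rewrite (_ : 16 / L * Ksqrt * (eta * L / 4 * (9 * Q)) = 36 * eta * Ksqrt * Q * (L / L)); last lra.
    by rewrite divff ?mulr1// gt_eqF.
  rewrite expr2 !invfM; lra.
have := @ler_sum _ _ (index_enum 'I_N) predT _ _ (fun n _ => wl n).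
rewrite big_split/= sumr_const card_ord -mulr_sumr -/Gamma -mulr_natl => h.
have hO : 72 * N%:R * Ksqrt * eta * Q <= Q by rewrite -[leRHS]mul1r ler_wpM2r.
have hA : 8 * N%:R * Kln * sig / (4 * pi * L) * A <= eps / 4 * A by rewrite ler_wpM2r.
have := ler_wpM2l (_ : 0 <= (4 * pi)^-1) h.
rewrite invr_ge0 mulr_ge0 ?(ltW p0)// => /(_ isT) {}h.
move: hA h; rewrite -dec !expr2 !invfM; set X := \sum_(i < N) loc i.
set P := pi^-1; set Li := L^-1 => hA h.
have P0 : 0 < P by rewrite invr_gt0.
have := ler_wpM2l (ltW P0) hO.
nra.
Qed.
(** Half of the Dirichlet part and half of the seminorm outside the cores
    are kept on the left; this surplus is what controls near-minimizers
    later. *)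
Lemma energy_lower (rho sig eps L eta : R) (p : 'I_N -> R) (m : R -> R * R) :
  L = ln (rho / sig) -> H1S1 m -> 0 < sig -> sig < rho -> separated rho p ->
  (forall n, (m (p n)).1 = d n) -> 0 < eta -> 72 * N%:R * Ksqrt * eta <= 1 ->
  8 * N%:R * Kln * sig / (4 * pi * L) <= eps / 4 ->
  ((Kln * Gamma / (pi * L))%:E + (eps / 4 * fine (dirichlet m))%:E +
   (8 * pi)^-1%:E * off_energy rho p (profile alpha m) <=
   energy alpha eps m + (2 * N%:R * Ksqrt / (pi * eta * rho) / L ^+ 2)%:E)%E.
Proof.
move=> LE mS sig0 sigrho sep mp eta0 etale sigle.
have rho0 : 0 < rho by exact: lt_trans sig0 sigrho.
have L0 : 0 < L by rewrite LE ln_gt0// ltr_pdivlMr// mul1r.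
have tau0 : 0 < eta * L by exact: mulr_gt0.
have wl n := wall_local_lower LE mS sig0 sigrho sep (mp n) tau0.
have mf := measurable_profile alpha mS.
have p0 : 0 < pi :> R by exact: pi_gt0.
move: mf wl; rewrite energyE; set f := profile alpha m => mf wl.
have dec := core_decomposition rho0 sep mf.
have [toty|] := eqVneq (total_energy f) +oo%E.
  rewrite toty gt0_muley ?lte_fin ?invr_gt0 ?mulr_gt0//.
  have dfin := dirichlet_fin_num mS.
  by rewrite -(fineK dfin) -EFinM /= leey.
rewrite -ltey => tfin.
have offle : (off_energy rho p f <= total_energy f)%E.
  by rewrite -dec; apply: leeDr; apply: sume_ge0 => n _; exact: local_energy_ge0.
have locle n : (local_energy rho (p n) f <= total_energy f)%E.
  rewrite -dec (bigD1 n)//= -addeA; apply: leeDl; apply: adde_ge0; last exact: off_energy_ge0.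
  by apply: sume_ge0 => i _; exact: local_energy_ge0.
have finE (x : \bar R) : (0 <= x)%E -> (x < +oo)%E -> exists r, x = r%:E.
  by case: x => [r|//|//] _ _; exists r.
have [Q QE] := finE _ (off_energy_ge0 rho p f) (le_lt_trans offle tfin).
have [T TE] := finE _ (total_energy_ge0 f) tfin.
have /choice[loc locE] : forall n, exists r, local_energy rho (p n) f = r%:E.
  by move=> n; exact: finE (local_energy_ge0 _ _ _) (le_lt_trans (locle n) tfin).
have dE := esym (fineK (dirichlet_fin_num mS)).
have A0 : 0 <= fine (dirichlet m) by apply: fine_ge0; exact: dirichlet_ge0.
have O0 := off_energy_ge0 rho p f.
rewrite QE lee_fin in O0.
have dec' : \sum_(n < N) loc n + Q = T.
  apply/EFin_inj; rewrite EFinD -sumEFin -TE -dec QE; congr (_ + _)%E.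
  by apply: eq_bigr => n _; rewrite locE.
rewrite QE TE {2}dE -!EFinM -!EFinD lee_fin.
apply: (lower_arithmetic L0 eta0 rho0 O0 A0 etale sigle dec') => n.
have := wl n; rewrite locE QE -!EFinM -!EFinD lee_fin; exact.
Qed.
End lower_bound.

(** * The profile of a single wall *)

Section single_wall.
Context {R : realType}.
Local Notation mu := (@lebesgue_measure R).
Local Notation RR := (measurableTypeR R).
Local Notation Kln := (@Kln R).

Lemma derive_itv01_increment (f df : R -> R) (x y : R) :
  (forall t : R, is_derive t 1 f (df t)) -> (forall t, 0 <= df t <= 1) ->
  x <= y -> 0 <= f y - f x <= y - x.
Proof.
move=> fdf df01; rewrite le_eqVlt => /predU1P[->|xy]; first by rewrite !subrr lexx.
have cf : {within `[x, y], continuous f}.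
  apply: continuous_subspaceT => t; apply: differentiable_continuous.
  by apply/derivable1_diffP; case: (fdf t).
have [c _ ->] := MVT xy (fun t _ => fdf t) cf.
have /andP[? ?] := df01 c; have yx : 0 <= y - x by rewrite subr_ge0 ltW.
by rewrite mulr_ge0//= -[leRHS]mul1r ler_wpM2r.
Qed.

Section clip.
Variable eta : R.
Hypothesis eta0 : 0 < eta.
Hypothesis eta1 : eta <= 1.

(** A C^1 version of the minimum of v and 1, equal to it for |v - 1| >= eta. *)
Definition clip (v : R) : R :=
  v - (pospart (v - (1 - eta)) ^+ 2 - pospart (v - (1 + eta)) ^+ 2) / (4 * eta).

Definition dclip (v : R) : R :=
  1 - (pospart (v - (1 - eta)) - pospart (v - (1 + eta))) / (2 * eta).

Lemma is_derive_clip (v : R) : is_derive v 1 clip (dclip v).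
Proof.
have H (b : R) : is_derive v 1 (fun v => pospart (v - b) ^+ 2) (2 * pospart (v - b)).
  have d1 : is_derive v 1 (fun v : R => v - b) 1.
    by apply: is_derive_eq; rewrite subr0.
  have := @is_derive1_comp R (fun t => pospart t ^+ 2) (fun v => v - b) v _ _
    (is_derive_pospart2 (v - b)) d1.
  by rewrite mulr1.
have H2 := is_deriveB (H (1 - eta)) (H (1 + eta)).
have H3 := is_deriveZ (4 * eta)^-1 H2.
have H4 := is_deriveB (is_derive_id v 1) H3.
rewrite (_ : clip = id - (4 * eta)^-1 *:
  ((fun v => pospart (v - (1 - eta)) ^+ 2) - (fun v => pospart (v - (1 + eta)) ^+ 2))).
  apply: is_derive_eq H4 _; rewrite /dclip /GRing.scale/= !invfM; lra.
by apply/funext => x; rewrite /clip/= !fctE /GRing.scale/= mulrC.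
Qed.

Lemma dclip_itv (v : R) : 0 <= dclip v <= 1.
Proof.
have e2 : 0 < 2 * eta by rewrite mulr_gt0.
suff : 0 <= (pospart (v - (1 - eta)) - pospart (v - (1 + eta))) / (2 * eta) <= 1.
  by rewrite /dclip => /andP[? ?]; apply/andP; split; lra.
rewrite ler_pdivrMr// divr_ge0 ?(ltW e2)//= /pospart;
have [x0|x0] := ltP (v - (1 - eta)) 0; have [xh0|xh0] := ltP (v - (1 + eta)) 0;
  rewrite ?(max_r (ltW x0)) ?(max_l x0) ?(max_r (ltW xh0)) ?(max_l xh0); lra.
Qed.

Lemma dclip_continuous : continuous dclip.
Proof.
move=> x; apply: cvgB; first exact: cvg_cst.
apply: cvgM; last exact: cvg_cst.
by apply: cvgB; exact: pospart_shift_continuous.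
Qed.

Lemma clip_increment (x y : R) : x <= y -> 0 <= clip y - clip x <= y - x.
Proof. exact: derive_itv01_increment is_derive_clip dclip_itv. Qed.

Lemma clip0 : clip 0 = 0.
Proof.
have h1 : 0 - (1 - eta) <= 0 by rewrite sub0r oppr_le0 subr_ge0.
have h2 : 0 - (1 + eta) <= 0 by rewrite sub0r oppr_le0 addr_ge0// ltW.
by rewrite /clip !pospart_le// subrr mul0r subr0.
Qed.

Lemma clip1 (v : R) : 1 + eta <= v -> clip v = 1.
Proof.
move=> v1; have h1 : 0 <= v - (1 - eta).
  have e : 0 < eta := eta0.
  clear -v1 e. lra.
have h2 : 0 <= v - (1 + eta) by lra.
rewrite /clip !pospart_ge//.
rewrite (_ : _ - _ ^+ 2 = (v - 1) * (4 * eta)); last by rewrite !expr2; lra.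
by rewrite mulfK; [lra|rewrite mulf_neq0// gt_eqF].
Qed.

Lemma clip_itv (v : R) : 0 <= v -> 0 <= clip v <= 1.
Proof.
move=> v0; have := clip_increment v0; rewrite clip0 !subr0 => /andP[-> _]/=.
have [v1|v1] := leP (1 + eta) v; first by rewrite clip1.
by have /andP[] := clip_increment (ltW v1); rewrite (@clip1 (1 + eta))// subr_ge0.
Qed.

Lemma clip_le (v : R) : 0 <= v -> clip v <= v.
Proof. by move=> v0; have /andP[_] := clip_increment v0; rewrite clip0 !subr0. Qed.

(** clip is nondecreasing, 1-Lipschitz and at most the identity; factor the
    differences of squares. *)
Lemma clip_sqr_increment (x y : R) : 0 <= x -> x <= y ->
  0 <= clip y ^+ 2 - clip x ^+ 2 <= y ^+ 2 - x ^+ 2.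
Proof.
move=> x0 xy; have /andP[i0 i1] := clip_increment xy.
have y0 : 0 <= y by exact: le_trans xy.
have /andP[cx _] := clip_itv x0; have /andP[cy _] := clip_itv y0.
have lx := clip_le x0; have ly := clip_le y0.
rewrite !subr_sqr; apply/andP; split; first by rewrite mulr_ge0// addr_ge0.
by apply: ler_pM => //; [exact: addr_ge0|exact: lerD].
Qed.

End clip.

Variables sig ell : R.
Hypothesis sig0 : 0 < sig.
Hypothesis ell1 : 1 <= ell.

Let ell0 : 0 < ell. Proof. exact: lt_le_trans ell1. Qed.

(** The logarithm of the distance in units of sig, smoothed so that it
    vanishes quadratically at 0. *)
Definition logh (s : R) : R := ln (1 + s ^+ 2 / sig ^+ 2) / 2.

Let arg_ge1 (s : R) : 1 <= 1 + s ^+ 2 / sig ^+ 2.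
Proof. by rewrite lerDl divr_ge0 ?sqr_ge0. Qed.

Lemma logh_ge0 s : 0 <= logh s.
Proof. by rewrite /logh divr_ge0// ln_ge0. Qed.

Lemma loghN s : logh (- s) = logh s.
Proof. by rewrite /logh sqrrN. Qed.

Lemma logh0 : logh 0 = 0.
Proof. by rewrite /logh expr0n mul0r addr0 ln1 mul0r. Qed.

Lemma logh_dilation s l : 1 <= l -> 0 <= logh (l * s) - logh s <= ln l.
Proof.
move=> l1; have l0 : 0 < l by exact: lt_le_trans l1.
have a0 t : 0 < 1 + t ^+ 2 / sig ^+ 2 by exact: lt_le_trans (arg_ge1 t).
have l2 : 1 <= l ^+ 2 by rewrite exprn_ege1.
have q0 : 0 <= s ^+ 2 / sig ^+ 2 by rewrite divr_ge0 ?sqr_ge0.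
rewrite /logh exprMn -[l ^+ 2 * _ / _]mulrA.
set q := s ^+ 2 / sig ^+ 2 in q0 *.
apply/andP; split.
  rewrite -mulrBl divr_ge0// subr_ge0 ler_ln ?posrE; [|nra..].
  nra.
have : ln (1 + l ^+ 2 * q) <= ln (l ^+ 2 * (1 + q)).
  rewrite ler_ln ?posrE; [|nra..]; nra.
rewrite lnM ?posrE; [|nra..].
rewrite lnXn//; lra.
Qed.

Lemma logh_le s : logh s <= s ^+ 2 / (2 * sig ^+ 2).
Proof.
rewrite /logh; have := ln_le_sub1 (lt_le_trans ltr01 (arg_ge1 s)).
rewrite invfM; lra.
Qed.

Lemma logh_ge s : 0 < s -> ln (s / sig) <= logh s.
Proof.
move=> s0; have q0 : 0 < s / sig by rewrite divr_gt0.
rewrite /logh -[leLHS](mulfK (_ : 2 != 0))// ler_pM2r//.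
rewrite mulrC mulr2n mulrDl mul1r -lnM ?posrE// -expr2 expr_div_n.
by rewrite ler_ln ?posrE ?lerDr// ?divr_gt0 ?exprn_gt0//; exact: lt_le_trans (arg_ge1 s).
Qed.

Lemma is_derive_logh (s : R) : is_derive s 1 logh (s / (s ^+ 2 + sig ^+ 2)).
Proof.
have d1 : is_derive s 1 (fun s : R => 1 + s ^+ 2 / sig ^+ 2) (2 * s / sig ^+ 2).
  apply: is_derive_eq; rewrite /GRing.scale/=.
  lra.
have a0 : 0 < 1 + s ^+ 2 / sig ^+ 2 by exact: lt_le_trans (arg_ge1 s).
have d2 := @is_derive1_comp R (@ln R) _ s _ _ (is_derive1_ln a0) d1.
have d3 := is_deriveZ 2^-1 d2.
rewrite (_ : logh = 2^-1 *: (@ln R \o (fun s : R => 1 + s ^+ 2 / sig ^+ 2))); last first.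
  by apply/funext => x; rewrite /logh/= !fctE /GRing.scale/= mulrC.
apply: is_derive_eq d3 _; rewrite /GRing.scale/=.
have s2 : sig ^+ 2 != 0 by rewrite expf_neq0// gt_eqF.
have E : 1 + s ^+ 2 / sig ^+ 2 = (s ^+ 2 + sig ^+ 2) / sig ^+ 2.
  by rewrite mulrDl divff// addrC.
rewrite E invf_div; set X := (s ^+ 2 + _)^-1.
rewrite (_ : 2^-1 * (sig ^+ 2 * X * (2 * s / sig ^+ 2)) = s * X * (sig ^+ 2 / sig ^+ 2)); last lra.
by rewrite divff// mulr1.
Qed.

(** Auxiliary to vh: with w = wroot, the function w - 1 / w is smooth at 0
    whereas the square root of logh is not. *)
Definition wroot (s : R) : R := Num.sqrt (1 + logh s).

(** By vh_sqr its square is logh / ell up to a bounded multiple of 1 / ell,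
    and it is smooth. *)
Definition vh (s : R) : R := (wroot s - (wroot s)^-1) / Num.sqrt ell.

Definition dvh (s : R) : R :=
  (1 + (wroot s)^-2) / (2 * wroot s) * (s / (s ^+ 2 + sig ^+ 2)) / Num.sqrt ell.

Lemma wroot_ge1 s : 1 <= wroot s.
Proof.
by rewrite /wroot -[leLHS]sqrtr1 ler_wsqrtr// lerDl logh_ge0.
Qed.

Lemma is_derive_vh (s : R) : is_derive s 1 vh (dvh s).
Proof.
have a0 : 0 < 1 + logh s by rewrite ltr_pwDl// logh_ge0.
have d1 : is_derive s 1 (fun s : R => 1 + logh s) (s / (s ^+ 2 + sig ^+ 2)).
  have := is_deriveD (is_derive_cst (1 : R) s 1) (is_derive_logh s).
  by rewrite add0r.
have d2 := @is_derive1_comp R Num.sqrt _ s _ _ (is_derive1_sqrt a0) d1.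
have w0 : 0 < wroot s by exact: lt_le_trans (wroot_ge1 s).
have wN : wroot s != 0 by rewrite gt_eqF.
have d3 := is_deriveV wN d2.
have d4 := is_deriveZ (Num.sqrt ell)^-1 (is_deriveB d2 d3).
rewrite (_ : vh = (Num.sqrt ell)^-1 *: (Num.sqrt \o (fun s : R => 1 + logh s) -
   (fun y => ((Num.sqrt \o (fun s : R => 1 + logh s)) y)^-1))); last first.
  by apply/funext => x; rewrite /vh /wroot/= !fctE /GRing.scale/= mulrC.
apply: is_derive_eq d4 _; rewrite /GRing.scale/= -/(wroot s) /dvh invfM.
lra.
Qed.

Lemma vhN s : vh (- s) = vh s.
Proof. by rewrite /vh /wroot loghN. Qed.

Lemma vh0 : vh 0 = 0.
Proof. by rewrite /vh /wroot logh0 addr0 sqrtr1 invr1 subrr mul0r. Qed.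

Lemma vh_ge0 s : 0 <= vh s.
Proof.
rewrite /vh divr_ge0 ?sqrtr_ge0// subr_ge0.
by apply: le_trans (wroot_ge1 s); rewrite invf_le1 ?wroot_ge1// (lt_le_trans _ (wroot_ge1 s)).
Qed.

Lemma vh_sqr s : vh s ^+ 2 = (logh s - 1 + (1 + logh s)^-1) / ell.
Proof.
have a0 : 0 <= 1 + logh s by rewrite addr_ge0// logh_ge0.
have w0 : wroot s != 0 by rewrite gt_eqF// (lt_le_trans _ (wroot_ge1 s)).
rewrite /vh expr_div_n sqr_sqrtr ?(ltW ell0)//; congr (_ / _).
rewrite sqrrB mulfV// exprVn sqr_sqrtr//; lra.
Qed.

Lemma vh_sqr_dilation s l : 1 <= l -> 0 <= s ->
  vh s <= vh (l * s) /\ vh (l * s) ^+ 2 - vh s ^+ 2 <= ln l / ell.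
Proof.
move=> l1 s0; have /andP[i0 i1] := logh_dilation s l1.
have a0 t : 0 < 1 + logh t by rewrite ltr_pwDl// logh_ge0.
rewrite !vh_sqr -mulrBl; split.
  rewrite ler_pM2r ?invr_gt0 ?sqrtr_gt0//.
  have h : wroot s <= wroot (l * s) by rewrite ler_wsqrtr// lerD2l -subr_ge0.
  have w0 t : 0 < wroot t by exact: lt_le_trans (wroot_ge1 t).
  by apply: lerB => //; rewrite lef_pV2 ?posrE.
rewrite ler_pM2r ?invr_gt0//.
have : (1 + logh (l * s))^-1 <= (1 + logh s)^-1 by rewrite lef_pV2 ?posrE ?a0// lerD2l -subr_ge0.
lra.
Qed.

Lemma dvh_sqr_le s : dvh s ^+ 2 <= ell^-1 / (s ^+ 2 + sig ^+ 2).
Proof.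
have w1 := wroot_ge1 s; have w0 : 0 < wroot s by exact: lt_le_trans w1.
set X := s ^+ 2 + sig ^+ 2.
have X0 : 0 < X by rewrite ltr_wpDl ?sqr_ge0// exprn_gt0.
rewrite /dvh expr_div_n (@sqr_sqrtr _ ell) ?(ltW ell0)//.
rewrite mulrC ler_pM2l ?invr_gt0//.
rewrite exprMn; have h : 0 <= (1 + (wroot s)^-2) / (2 * wroot s) <= 1.
  rewrite divr_ge0 ?addr_ge0 ?invr_ge0 ?sqr_ge0 ?mulr_ge0 ?(ltW w0)//=.
  rewrite ler_pdivrMr ?mulr_gt0// mul1r.
  have : (wroot s)^-2 <= 1 by rewrite invf_le1 ?exprn_ege1 ?exprn_gt0.
  lra.
have h2 : (s / X) ^+ 2 <= X^-1.
  rewrite expr_div_n ler_pdivrMr ?exprn_gt0// [X ^+ 2]expr2 mulKf ?gt_eqF// /X lerDl sqr_ge0//.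
move: h => /andP[ha hb].
apply: le_trans h2; rewrite -[leRHS]mul1r ler_wpM2r ?sqr_ge0//.
exact: exprn_ile1.
Qed.

Let eta0 : 0 < ell^-1. Proof. by rewrite invr_gt0. Qed.
Let eta1 : ell^-1 <= 1. Proof. by rewrite invf_le1. Qed.

(** With this function b, a wall of height gam is d - gam b^2 and its second
    component is b times a smooth positive function of b. *)
Definition wallb (s : R) : R := clip ell^-1 (vh s).

Definition dwallb (s : R) : R := dclip ell^-1 (vh s) * dvh s.

(** Decreases from 1 at the centre to 0 at distance rho, essentially
    affinely in ln |s|: the extremal shape in telescope_lower. *)
Definition wallf (s : R) : R := 1 - wallb s ^+ 2.

Lemma is_derive_wallb (s : R) : is_derive s 1 wallb (dwallb s).
Proof.
have := @is_derive1_comp R (clip ell^-1) vh s _ _ (is_derive_clip ell^-1 (vh s)) (is_derive_vh s).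
exact.
Qed.

Lemma is_derive_cont (f : R -> R) (df x : R) : is_derive x 1 f df -> {for x, continuous f}.
Proof.
move=> dfx; apply: differentiable_continuous; apply/derivable1_diffP.
by case: dfx.
Qed.

Lemma wallb_continuous : continuous wallb.
Proof. by move=> x; apply: is_derive_cont (is_derive_wallb x). Qed.

Lemma logh_continuous : continuous logh.
Proof. by move=> x; apply: is_derive_cont (is_derive_logh x). Qed.

Lemma vh_continuous : continuous vh.
Proof. by move=> x; apply: is_derive_cont (is_derive_vh x). Qed.

Lemma wroot_continuous : continuous wroot.
Proof.
move=> x; apply: (@continuous_comp _ _ _ (fun x => 1 + logh x) Num.sqrt).
  by apply: cvgD; [exact: cvg_cst|exact: logh_continuous].
exact: sqrt_continuous.
Qed.

Lemma dvh_continuous : continuous dvh.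
Proof.
have w0 t : 0 < wroot t by exact: lt_le_trans (wroot_ge1 t).
move=> x; apply: cvgM; last exact: cvg_cst.
apply: cvgM; apply: cvgM.
- apply: cvgD; first exact: cvg_cst.
  apply: cvgV; first by rewrite expf_neq0// gt_eqF.
  by apply: cvgM; exact: wroot_continuous.
- apply: cvgV; first by rewrite mulf_neq0// gt_eqF.
  by apply: cvgM; [exact: cvg_cst|exact: wroot_continuous].
- exact: cvg_id.
- apply: cvgV; first by rewrite gt_eqF// ltr_wpDl ?sqr_ge0// exprn_gt0.
  apply: cvgD; last exact: cvg_cst.
  by apply: cvgM; exact: cvg_id.
Qed.

Lemma dwallb_continuous : continuous dwallb.
Proof.
move=> x; apply: cvgM; last exact: dvh_continuous.
apply: (@continuous_comp _ _ _ vh); first exact: vh_continuous.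
exact: dclip_continuous.
Qed.

Lemma wallb_itv s : 0 <= wallb s <= 1.
Proof. by apply: clip_itv => //; exact: vh_ge0. Qed.

Lemma dwallb_sqr_le s : dwallb s ^+ 2 <= ell^-1 / (s ^+ 2 + sig ^+ 2).
Proof.
apply: le_trans (dvh_sqr_le s); rewrite exprMn -[leRHS]mul1r ler_wpM2r ?sqr_ge0//.
by have /andP[? ?] := dclip_itv eta0 (vh s); exact: exprn_ile1.
Qed.

Lemma psi_itv s : 0 <= wallf s <= 1.
Proof.
have /andP[b0 b1] := wallb_itv s.
have h1 : wallb s ^+ 2 <= 1 by exact: exprn_ile1.
by have h2 := sqr_ge0 (wallb s); rewrite /wallf; apply/andP; split; lra.
Qed.

Lemma psi0 : wallf 0 = 1.
Proof. by rewrite /wallf /wallb vh0 clip0// expr0n subr0. Qed.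

Lemma psiN s : wallf (- s) = wallf s.
Proof. by rewrite /wallf /wallb vhN. Qed.

Lemma psi_dilation s l : 1 <= l -> 0 <= s ->
  0 <= wallf s - wallf (l * s) <= ln l / ell.
Proof.
move=> l1 s0; have [v1 v2] := vh_sqr_dilation l1 s0.
have := clip_sqr_increment eta0 eta1 (vh_ge0 s) v1.
rewrite -/(wallb s) -/(wallb (l * s)) /wallf => /andP[h1 h2].
by apply/andP; split; lra.
Qed.

Lemma psi_near0 s : 1 - wallf s <= s ^+ 2 / (2 * sig ^+ 2 * ell).
Proof.
have h0 := vh_ge0 s; have /andP[c0 _] := clip_itv eta0 eta1 h0.
have : wallb s ^+ 2 <= vh s ^+ 2.
  by rewrite lerXn2r ?nnegrE//; exact: clip_le.
rewrite vh_sqr; have := logh_le s; have y0 := logh_ge0 s.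
have : (1 + logh s)^-1 <= 1 by rewrite invf_le1 ?lerDl// ltr_pwDl.
move=> h1 h2; rewrite /wallf opprB addrCA subrr addr0 => /le_trans; apply.
rewrite invfM mulrA ler_pM2r//; lra.
Qed.

(** The shift by 4 in the choice of ell pays for the smoothing: logh >= ell
    + 4 forces vh >= 1 + 1 / ell. *)
Lemma psi_outside rho s : 0 < rho -> ell + 4 <= ln (rho / sig) -> rho <= `|s| -> wallf s = 0.
Proof.
move=> rho0 lrho sr.
have -> : wallf s = wallf `|s| by case: (ger0P s) => // _; rewrite psiN.
move: `|s| sr => {}s sr; have s0 : 0 < s by exact: lt_le_trans sr.
have y4 : ell + 4 <= logh s.
  apply: le_trans (logh_ge s0); apply: le_trans lrho _.
  by rewrite ler_ln ?posrE ?divr_gt0// ler_pM2r ?invr_gt0.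
have h0 := vh_ge0 s.
suff v1 : 1 + ell^-1 <= vh s by rewrite /wallf /wallb clip1// expr1n subrr.
rewrite -(@ler_pXn2r _ 2)// ?nnegrE ?addr_ge0 ?(ltW eta0)// vh_sqr.
rewrite ler_pdivlMr//.
have i0 : 0 <= (1 + logh s)^-1 by rewrite invr_ge0 addr_ge0// logh_ge0.
have e : ell^-1 * ell = 1 by rewrite mulVf// gt_eqF.
rewrite (_ : (1 + ell^-1) ^+ 2 * ell = ell + 2 * (ell^-1 * ell) + ell^-1 * (ell^-1 * ell)).
  rewrite e; have := eta1; lra.
rewrite expr2; lra.
Qed.

Lemma psi_continuous : continuous wallf.
Proof.
move=> x; apply: cvgB; first exact: cvg_cst.
by apply: cvgM; exact: wallb_continuous.
Qed.

Lemma measurable_psi : measurable_fun setT (wallf : RR -> R).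
Proof. by apply: continuous_measurable_fun; exact: psi_continuous. Qed.

End single_wall.

(** * Integrals of the single wall *)

Section wall_integrals.
Context {R : realType}.
Local Notation mu := (@lebesgue_measure R).
Local Notation RR := (measurableTypeR R).
Local Notation Kln := (@Kln R).

Variables sig ell rho : R.
Hypothesis sig0 : 0 < sig.
Hypothesis ell1 : 1 <= ell.
Hypothesis rho0 : 0 < rho.
Hypothesis ellrho : ell + 4 <= ln (rho / sig).

Local Notation psi := (wallf sig ell).

Let ell0 : 0 < ell. Proof. exact: lt_le_trans ell1. Qed.

Let mpsi : measurable_fun setT (psi : RR -> R).
Proof. exact: measurable_psi. Qed.

Let psi01 s : 0 <= psi s <= 1.
Proof. exact: psi_itv. Qed.

Let psi_out s : rho <= `|s| -> psi s = 0.
Proof. exact: psi_outside. Qed.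

Let mdil (l : R) : measurable_fun setT (fun s : RR => psi (l * s) : R).
Proof. by apply: (measurableT_comp mpsi); apply: measurable_funM. Qed.

Lemma ge0_integralDT (f g : RR -> \bar R) :
  measurable_fun setT f -> (forall x, 0 <= f x)%E ->
  measurable_fun setT g -> (forall x, 0 <= g x)%E ->
  (\int[mu]_x f x + \int[mu]_x g x = \int[mu]_x (f x + g x))%E.
Proof.
move=> mf f0 mg g0; rewrite ge0_integralD//.
Qed.

Lemma ge0_le_integralT (f g : RR -> \bar R) :
  measurable_fun setT f -> (forall x, 0 <= f x)%E -> measurable_fun setT g ->
  (forall x, f x <= g x)%E -> (\int[mu]_x f x <= \int[mu]_x g x)%E.
Proof. by move=> mf f0 mg fg; apply: ge0_le_integral. Qed.

Lemma integral_ocE (a b : R) (f : RR -> \bar R) :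
  (\int[mu]_(x in `]a, b]) f x =
   \int[mu]_x (if (a < x <= b)%R then f x else 0))%E.
Proof.
by rewrite [RHS]integral_if; congr integral; apply/seteqP; split => x /=; rewrite in_itv.
Qed.

Lemma integral_inv (a b : R) : 0 < a -> a < b ->
  (\int[mu]_(x in `]a, b]) (x^-1)%:E = (ln (b / a))%:E)%E.
Proof.
move=> a0 ab; rewrite -Rintegral_inv// fineK//.
have i : mu.-integrable `]a, b] (EFin \o (fun x : RR => x^-1 : R)).
  apply: (@integrable_bounded_itv _ _ _ _ a^-1).
    by apply: measurable_funTS; exact: measurable_invr.
  move=> x /andP[ax _]; have x0 := lt_trans a0 ax.
  by rewrite gtr0_norm ?invr_gt0// lef_pV2 ?posrE// ltW.
exact: integrable_fin_num i.
Qed.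

(** Dilation invariance again: the integrals of psi s / s and psi (l s) / s
    over ]a, +oo[ differ by the one over ]a, l a], and psi <= 1. *)
Lemma psi_log_tail (l a : R) : 1 < l -> 0 < a ->
  (\int[mu]_(s in `]a, +oo[) ((psi s - psi (l * s)) / s)%:E <= (ln l)%:E)%E.
Proof.
move=> l1 a0; have l0 : 0 < l by exact: lt_trans l1.
have ala : a < l * a by rewrite ltr_pMl.
have q0 s : a < s -> 0 <= psi s / s.
  move=> as_; have /andP[p0 _] := psi01 s.
  by rewrite divr_ge0// ltW// (lt_trans a0).
have mi : measurable_fun setT (GRing.inv : RR -> R) by exact: measurable_invr.
have ma (b : R) : measurable_fun setT (fun s : RR => b < s) by exact: measurable_fun_ltr.
have mb (b : R) : measurable_fun setT (fun s : RR => s <= b) by exact: measurable_fun_ler.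
have ml := mdil l.
pose h (s : RR) : \bar R := if (l * a < s)%R then (psi s / s)%:E else 0%E.
pose u (s : RR) : \bar R := if (a < s)%R then ((psi s - psi (l * s)) / s)%:E else 0%E.
pose k (s : RR) : \bar R := if (a < s)%R then (psi (l * s) / s)%:E else 0%E.
pose w (s : RR) : \bar R := if (a < s <= l * a)%R then (s^-1)%:E else 0%E.
pose w' (s : RR) : \bar R := if (a < s <= a + rho)%R then (a^-1)%:E else 0%E.
have mh : measurable_fun setT h by rewrite /h; meas.
have mu' : measurable_fun setT u by rewrite /u; meas.
have mk : measurable_fun setT k by rewrite /k; meas.
have mw : measurable_fun setT w by apply: measurable_fun_ifT; [exact: measurable_and|exact/measurable_EFinP|].
have mw' : measurable_fun setT w' by apply: measurable_fun_ifT => //; exact: measurable_and.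
have h0 s : (0 <= h s)%E.
  by rewrite /h; case: ifP => // as_; rewrite lee_fin q0// (lt_trans ala).
have u0 s : (0 <= u s)%E.
  rewrite /u; case: ifP => // as_; have s0 := lt_trans a0 as_.
  have /andP[p0 _] := psi_dilation sig ell1 (ltW l1) (ltW s0).
  by rewrite lee_fin divr_ge0// ltW.
have k0 s : (0 <= k s)%E.
  rewrite /k; case: ifP => // as_; have s0 := lt_trans a0 as_.
  by have /andP[p0 p1] := psi01 (l * s); rewrite lee_fin divr_ge0// ltW.
have w0 s : (0 <= w s)%E.
  by rewrite /w; case: ifP => // /andP[as_ _]; rewrite lee_fin invr_ge0 ltW// (lt_trans a0).
have hw' s : (h s <= w' s)%E.
  have w'0 : (0 <= w' s)%E by rewrite /w'; case: ifP => // _; rewrite lee_fin invr_ge0 ltW.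
  have [sr|sr] := leP rho `|s|.
    by rewrite /h psi_out// mul0r; case: ifP.
  rewrite /h; case: ifP => [las|_//].
  have as_ := lt_trans ala las; have s0 := lt_trans a0 as_.
  rewrite gtr0_norm// in sr.
  rewrite /w' as_/= ifT; last lra.
  have /andP[p0 p1] := psi01 s.
  rewrite lee_fin -[leRHS]mul1r ler_pM ?invr_ge0 ?(ltW s0)//.
  by rewrite lef_pV2 ?posrE// ltW.
have uk s : (u s + k s <= w s + h s)%E.
  rewrite /u /k /w /h; have [as_|as_] := ltP a s; last first.
    by rewrite adde0 ltNge (le_trans as_ (ltW ala)) adde0.
  rewrite -EFinD -mulrDl subrK/=; have s0 := lt_trans a0 as_.
  have /andP[p0 p1] := psi01 s.
  have [la|la] := ltP (l * a) s; first by rewrite add0e.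
  by rewrite adde0 lee_fin -[leRHS]mul1r ler_pM2r ?invr_gt0.
pose T := (\int[mu]_s h s)%E.
have TE : T = (\int[mu]_s k s)%E.
  rewrite /T (integral_scale l0 mh h0); apply: eq_integral => s _.
  rewrite /h /k ltr_pM2l//; case: ifP => [as_|_]; last by rewrite mul0e.
  rewrite -EFinM invfM mulrA mulrAC -!mulrA; congr (_ * _)%:E.
  by rewrite mulrA mulVf ?mul1r// gt_eqF.
have Tfin : T \is a fin_num.
  rewrite ge0_fin_numE; last by apply: integral_ge0 => s _; exact: h0.
  apply: (@le_lt_trans _ _ (\int[mu]_(s in `]a, (a + rho)%R]) (a^-1)%:E)%E).
    rewrite integral_ocE; exact: ge0_le_integralT.
  rewrite integral_cst; last exact: measurable_itv.
  rewrite [X in (_ * X)%E]lebesgue_measure_itv/= lte_fin ltrDl rho0.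
  by rewrite -EFinB -EFinM ltry.
have main : (\int[mu]_(s in `]a, +oo[) ((psi s - psi (l * s)) / s)%:E + T <= (ln l)%:E + T)%E.
  have Wl : (\int[mu]_s w s)%E = (ln l)%:E.
    by rewrite -[in RHS](mulfK (lt0r_neq0 a0) l) -(integral_inv a0 ala) integral_ocE.
  rewrite {1}TE integral_gtE -Wl.
  rewrite (ge0_integralDT mu' u0 mk k0) (ge0_integralDT mw w0 mh h0).
  apply: ge0_le_integralT; last exact: uk.
  - exact: emeasurable_funD.
  - by move=> s; exact: adde_ge0.
  - exact: emeasurable_funD.
by move: main; rewrite leeD2rE.
Qed.

(** The bound on the tails does not depend on a, and near 0 the integrand is
    O(s). *)
Lemma psi_log_integral (l : R) : 1 < l ->
  (\int[mu]_(s in `]0%R, +oo[) ((psi s - psi (l * s)) / s)%:E <= (ln l)%:E)%E.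
Proof.
move=> l1; have l0 : 0 < l by exact: lt_trans l1.
have d0 (s : R) : 0 < s -> 0 <= (psi s - psi (l * s)) / s.
  move=> s0; have /andP[p0 _] := psi_dilation sig ell1 (ltW l1) (ltW s0).
  by rewrite divr_ge0// ltW.
pose M := l ^+ 2 / (2 * sig ^+ 2 * ell).
have M0 : 0 < M by rewrite divr_gt0 ?exprn_gt0 ?mulr_gt0 ?exprn_gt0.
have dM (s : R) : 0 < s -> (psi s - psi (l * s)) / s <= M * s.
  move=> s0; rewrite ler_pdivrMr//.
  have /andP[_ p1] := psi01 s; have := psi_near0 sig ell1 (l * s).
  rewrite exprMn mulrAC -/M expr2; lra.
apply/lee_addgt0Pr => e e0.
(* The interval ]0, a] contributes at most M a^2 <= M a <= e. *)
pose a := Num.min 1 (e / M).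
have a0 : 0 < a by rewrite lt_min ltr01 divr_gt0.
have aM : M * a * a <= e.
  have a1 : a <= 1 by rewrite ge_min lexx.
  have ae : a <= e / M by rewrite ge_min lexx orbT.
  rewrite ler_pdivlMr// in ae; nra.
have mq : measurable_fun setT (fun s : RR => ((psi s - psi (l * s)) / s)%:E).
  by meas; try exact: measurable_invr; try exact: mdil.
rewrite (_ : `]0, +oo[%classic = `]0, a] `|` `]a, +oo[ :> set RR)%classic; last first.
  apply/seteqP; split => s /=; rewrite !in_itv/= !andbT.
    by move=> s0; rewrite s0/=; case: (leP s a) => h; [left|right].
  by move=> [/andP[]//|]; exact: lt_trans.
rewrite ge0_integral_setU//; first last.
- rewrite disj_set2E; apply/eqP/seteqP; split => // s /=; rewrite !in_itv/= andbT.
  by move=> [/andP[_ h1] h2]; move: h1; rewrite leNgt h2.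
- move=> s [|]; rewrite /= in_itv/= ?andbT; first by move=> /andP[s0 _]; rewrite lee_fin d0.
  by move=> as_; rewrite lee_fin d0// (lt_trans a0).
- exact: measurable_funTS.
rewrite addeC; apply: leeD; first exact: psi_log_tail.
apply: (@le_trans _ _ (\int[mu]_(s in `]0%R, a]) (M * a)%:E)%E).
  apply: ge0_le_integral => //.
  - by move=> s; rewrite /= in_itv/= => /andP[s0 _]; rewrite lee_fin d0.
  - exact: measurable_funTS.
  - move=> s; rewrite /= in_itv/= => /andP[s0 sa]; rewrite lee_fin.
    by apply: le_trans (dM _ s0) _; rewrite ler_pM2l.
rewrite integral_cst// [X in (_ * X)%E]lebesgue_measure_itv/= lte_fin a0.
by rewrite oppr0 adde0 -EFinM lee_fin.
Qed.

Lemma quot_even (f : R -> R) (s l : R) : (forall x, f (- x) = f x) -> 0 < s -> 1 < l ->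
  (quot f s (l * s) + quot f s (- (l * s)) +
   (quot f (- s) (l * s) + quot f (- s) (- (l * s))) +
   (quot f (l * s) s + quot f (l * s) (- s) +
   (quot f (- (l * s)) s + quot f (- (l * s)) (- s)))) * s =
  4 * kern l * ((f s - f (l * s)) ^+ 2 / s).
Proof.
move=> fN s0 l1.
rewrite [quot f (l * s) s]quotC [quot f (- (l * s)) s]quotC.
rewrite [quot f (l * s) (- s)]quotC [quot f (- (l * s)) (- s)]quotC.
have q1 := quot_dilation f s0 l1; have q2 := quot_opp_dilation f s l.
have q3 : quot f (- s) (l * s) = (f s - f (l * s)) ^+ 2 / s ^+ 2 * (l + 1) ^- 2.
  by have := quot_opp_dilation f (- s) l; rewrite mulrN opprK sqrrN fN.
have q4 : quot f (- s) (- (l * s)) = (f s - f (l * s)) ^+ 2 / s ^+ 2 * (l - 1) ^- 2.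
  rewrite /quot -mulrA !fN; congr (_ * _).
  by rewrite -invfM -exprMn; congr (_ ^- 2); lra.
rewrite q1 q2 q3 q4 fN /kern.
set a := (f s - f (l * s)) ^+ 2; set u := (l - 1) ^- 2; set v := (l + 1) ^- 2.
have E : a / s ^+ 2 * s = a / s by rewrite expr2 invfM mulrA divfK// gt_eqF.
by rewrite -E; lra.
Qed.

(** Of the two factors psi s - psi (l s), one is at most ln l / ell
    pointwise and the other one integrates against ds / s to at most ln l. *)
Lemma psi_energy : (total_energy psi <= (4 * Kln / ell)%:E)%E.
Proof.
have mq : measurable_fun setT (fun z : RR * RR => (quot psi z.1 z.2)%:E).
  by apply/measurable_EFinP; exact: measurable_quot.
rewrite /total_energy (polar mq); last by move=> z; rewrite lee_fin quot_ge0.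
apply: (@le_trans _ _ (\int[mu]_(l in `]1%R, +oo[) ((4 / ell)%:E * (kern l * ln l ^+ 2)%:E))%E); last first.
  rewrite ge0_integralZl//.
  - by rewrite KlnE -EFinM lee_fin; lra.
  - apply/measurable_EFinP; apply: measurable_funTS; apply: measurable_funM; first exact: measurable_kern.
    by apply: measurable_funX; exact: measurable_lnR.
  - by move=> l _; rewrite lee_fin mulr_ge0 ?kern_ge0 ?sqr_ge0.
  - by rewrite lee_fin divr_ge0// ltW.
pose G (z : RR * RR) : \bar R := if (0 < z.2)%R then
  (4 * kern z.1 * ((psi z.2 - psi (z.1 * z.2)) ^+ 2 / z.2))%:E else 0%E.
have kG0 (l s : R) : 0 < s -> 0 <= 4 * kern l * ((psi s - psi (l * s)) ^+ 2 / s).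
  move=> s0; apply: mulr_ge0; first by rewrite mulr_ge0 ?kern_ge0.
  by rewrite divr_ge0 ?sqr_ge0 ?(ltW s0).
have G0 z : (0 <= G z)%E by rewrite /G; case: ifP => // s0; rewrite lee_fin kG0.
have mk : measurable_fun setT (kern : RR -> R) by exact: measurable_kern.
have mi : measurable_fun setT (GRing.inv : RR -> R) by exact: measurable_invr.
have mG : measurable_fun setT G by rewrite /G; meas.
have mGl l : measurable_fun setT (fun s => G (l, s)) by exact: (measurable_fun_pair2 l mG).
rewrite (_ : (\int[mu]_(l in `]1%R, +oo[) _)%E =
   (\int[mu]_(l in `]1%R, +oo[) (\int[mu]_s G (l, s)))%E); last first.
  apply: eq_integral => l; rewrite inE/= in_itv/= andbT => l1.
  rewrite integral_gtE; apply: eq_integral => s _; rewrite /G/=; case: ifP => // s0.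
  by rewrite -!EFinD -EFinM (quot_even (@psiN _ sig ell) s0 l1).
apply: ge0_le_integral => //.
- by move=> l _; apply: integral_ge0 => s _; exact: G0.
- by apply: measurable_funTS; exact: (measurable_fun_fubini_tonelli_F G).
- apply: measurable_funTS; apply/measurable_EFinP; apply: measurable_funM => //.
  by apply: measurable_funM => //; apply: measurable_funX; exact: measurable_lnR.
move=> l; rewrite /= in_itv/= andbT => l1.
have k0 := kern_ge0 l; have ln0 : 0 <= ln l by rewrite ln_ge0// ltW.
have c0 : 0 <= 4 * kern l * (ln l / ell) by rewrite !mulr_ge0// invr_ge0 ltW.
have ml := mdil l.
have d0 (s : R) : 0 < s -> 0 <= (psi s - psi (l * s)) / s.
  move=> s0; have /andP[p0 _] := psi_dilation sig ell1 (ltW l1) (ltW s0).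
  by rewrite divr_ge0// ltW.
have md : measurable_fun (`]0, +oo[%classic : set RR) (fun s : RR => ((psi s - psi (l * s)) / s)%:E).
  by apply: measurable_funTS; meas.
apply: (@le_trans _ _ (\int[mu]_(s in `]0%R, +oo[)
  ((4 * kern l * (ln l / ell))%:E * ((psi s - psi (l * s)) / s)%:E))%E).
  rewrite [leRHS]integral_gtE; apply: ge0_le_integral; [by []|by move=> s _; exact: G0|exact: mGl| |].
    apply: measurable_fun_ifT => //; first exact: measurable_fun_ltr.
    by apply: emeasurable_funM => //; meas.
  move=> s _; rewrite /G/=; case: ifP => s0 //.
  rewrite -EFinM lee_fin.
  have /andP[p0 p1] := psi_dilation sig ell1 (ltW l1) (ltW s0).
  rewrite -[leRHS]mulrA ler_wpM2l ?mulr_ge0//.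
  by rewrite mulrA ler_pM2r ?invr_gt0// expr2 ler_wpM2r.
rewrite ge0_integralZl//; last first.
  by move=> s; rewrite /= in_itv/= andbT => s0; rewrite lee_fin d0.
apply: (@le_trans _ _ ((4 * kern l * (ln l / ell))%:E * (ln l)%:E)%E).
  by apply: lee_wpmul2l => //; exact: psi_log_integral.
by rewrite -!EFinM lee_fin expr2; lra.
Qed.

(** Comparison with the dilation by 2: psi s - psi (2 s) is at most 1 / ell
    and is supported in the core, and dilating by 2 halves the integral. *)
Lemma psi_L1 : (\int[mu]_s (psi s)%:E <= (4 * rho / ell)%:E)%E.
Proof.
have mp : measurable_fun setT (fun s : RR => (psi s)%:E) by exact/measurable_EFinP.
have p0 s : (0 <= (psi s)%:E)%E by rewrite lee_fin; have /andP[] := psi01 s.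
rewrite (integral_pos_neg mp)//.
under eq_integral do rewrite psiN -EFinD.
have ms0 (b : R) : measurable_fun setT (fun s : RR => b < s) by exact: measurable_fun_ltr.
have m2 := mdil 2.
pose h (s : RR) : \bar R := if (0 < s)%R then (psi s)%:E else 0%E.
pose k (s : RR) : \bar R := if (0 < s)%R then (psi (2 * s))%:E else 0%E.
pose w (s : RR) : \bar R := if (0 < s < rho)%R then (ell^-1)%:E else 0%E.
have mh : measurable_fun setT h by rewrite /h; meas.
have mk : measurable_fun setT k by rewrite /k; meas.
have mw : measurable_fun setT w.
  by apply: measurable_fun_ifT => //; apply: measurable_and => //; exact: measurable_fun_ltr.
have h0 s : (0 <= h s)%E by rewrite /h; case: ifP.
have k0 s : (0 <= k s)%E by rewrite /k; case: ifP.
have w0 s : (0 <= w s)%E by rewrite /w; case: ifP => // _; rewrite lee_fin invr_ge0 ltW.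
have hkw s : (h s <= k s + w s)%E.
  rewrite /h /k /w; case: ifP => [s0|_] /=; last by rewrite adde0.
  have [sr|sr] := ltP s rho; last first.
    by rewrite adde0 lee_fin !psi_out// ger0_norm ?mulr_ge0 ?(ltW s0)//; lra.
  rewrite -EFinD lee_fin.
  have /andP[_ p1] := psi_dilation sig ell1 (ltW (ltr1n R 2) : 1 <= 2) (ltW s0).
  have : ln 2 / ell <= ell^-1.
    rewrite -[leRHS]mul1r ler_wpM2r ?invr_ge0 ?(ltW ell0)//.
    have := @ln_le_sub1 R 2 (ltr0n _ 2); lra.
  lra.
pose I := (\int[mu]_s h s)%E.
have IE : I = (2%:E * \int[mu]_s k s)%E.
  rewrite /I (integral_scale (ltr0n _ 2) mh h0).
  rewrite -ge0_integralZl//.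
  by apply: eq_integral => s _; rewrite muleC /h /k pmulr_rgt0.
have Wle : (\int[mu]_s w s = (rho / ell)%:E)%E.
  rewrite -(integral_ooE 0 rho (fun=> (ell^-1)%:E)) integral_cst//.
  rewrite [X in (_ * X)%E]lebesgue_measure_itv/= lte_fin rho0 oppr0 adde0 -EFinM.
  by rewrite mulrC.
have Ile : (I <= \int[mu]_s k s + (rho / ell)%:E)%E.
  rewrite -Wle (ge0_integralDT mk k0 mw w0); apply: ge0_le_integralT => //.
  exact: emeasurable_funD.
have Kfin : (\int[mu]_s k s)%E \is a fin_num.
  rewrite ge0_fin_numE; last by apply: integral_ge0 => s _; exact: k0.
  apply: (@le_lt_trans _ _ (\int[mu]_(s in `]0%R, rho[) (1 : R)%:E)%E).
    rewrite integral_ooE; apply: ge0_le_integralT => //.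
      by apply: measurable_fun_ifT => //; apply: measurable_and => //; exact: measurable_fun_ltr.
    move=> s; rewrite /k; have [s0|s0] := ltP 0 s => //=.
    have /andP[_ p1] := psi01 (2 * s).
    case: (ltP s rho) => sr; first by rewrite lee_fin.
    by rewrite psi_out// ger0_norm ?mulr_ge0 ?(ltW s0)//; lra.
  rewrite integral_cst// [X in (_ * X)%E]lebesgue_measure_itv/= lte_fin rho0.
  by rewrite -EFinB -EFinM ltry.
rewrite integral_gtE (_ : (\int[mu]_x _)%E = (2%:E * I)%E); last first.
  rewrite -ge0_integralZl//; apply: eq_integral => s _; rewrite /h.
  by case: ifP => _; rewrite ?mule0// -EFinM; congr _%:E; lra.
move: Ile; rewrite IE -(fineK Kfin) -!EFinM -EFinD !lee_fin; lra.
Qed.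

(** The arctangent integral, after scaling by sig. *)
Lemma lorentzian_integral :
  (\int[mu]_s ((s ^+ 2 + sig ^+ 2)^-1)%:E <= (pi / sig)%:E)%E.
Proof.
have q0 (s : R) : 0 < s ^+ 2 + sig ^+ 2 by rewrite ltr_wpDl ?sqr_ge0// exprn_gt0.
have mq : measurable_fun setT (fun s : RR => ((s ^+ 2 + sig ^+ 2)^-1)%:E).
  apply/measurable_EFinP; apply: measurable_funV.
  by apply: measurable_funD => //; apply: measurable_funX.
have mq1 : measurable_fun setT (fun s : RR => ((oneDsqr s)^-1)%:E).
  apply/measurable_EFinP; apply: measurable_funV.
  by apply: measurable_funD => //; apply: measurable_funX.
rewrite (integral_scale sig0 mq); last by move=> s; rewrite lee_fin invr_ge0 ltW.
rewrite (_ : (\int[mu]_x _)%E = ((sig^-1)%:E * \int[mu]_x ((oneDsqr x)^-1)%:E)%E); last first.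
  rewrite -ge0_integralZl//; last by rewrite lee_fin invr_ge0 ltW.
  apply: eq_integral => s _; rewrite -!EFinM; congr _%:E.
  rewrite (_ : (sig * s) ^+ 2 + sig ^+ 2 = sig ^+ 2 * oneDsqr s).
    by rewrite invfM mulrAC expr2 invfM divfK ?gt_eqF.
  by rewrite /oneDsqr exprMn; lra.
rewrite mulrC EFinM; apply: lee_wpmul2l; first by rewrite lee_fin invr_ge0 ltW.
rewrite (integral_pos_neg mq1); last by move=> s; rewrite lee_fin invr_ge0 ltW// oneDsqr_gt0.
apply: (@le_trans _ _ (\int[mu]_(x in `[0%R, +oo[) (2%:E * ((oneDsqr x)^-1)%:E))%E).
  rewrite (_ : (\int[mu]_(x in `]0%R, +oo[) _)%E =
    (\int[mu]_(x in `]0%R, +oo[) (2%:E * ((oneDsqr x)^-1)%:E))%E); last first.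
    by apply: eq_integral => s _; rewrite /oneDsqr sqrrN -EFinD -EFinM; congr _%:E; lra.
  apply: ge0_subset_integral => //.
  - by apply: emeasurable_funM => //; exact: measurable_funTS.
  - by move=> s; rewrite /= !in_itv/= !andbT => /ltW.
rewrite ge0_integralZl//.
- by rewrite integral0y_oneDsqr -EFinM lee_fin; lra.
- exact: measurable_funTS.
Qed.

Lemma dwallb_dirichlet :
  (\int[mu]_s (dwallb sig ell s ^+ 2)%:E <= (pi / (ell * sig))%:E)%E.
Proof.
have q0 (s : R) : 0 < s ^+ 2 + sig ^+ 2 by rewrite ltr_wpDl ?sqr_ge0// exprn_gt0.
have mq : measurable_fun setT (fun s : RR => ((s ^+ 2 + sig ^+ 2)^-1)%:E).
  apply/measurable_EFinP; apply: measurable_funV.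
  by apply: measurable_funD => //; apply: measurable_funX.
apply: (@le_trans _ _ (\int[mu]_s ((ell^-1)%:E * ((s ^+ 2 + sig ^+ 2)^-1)%:E))%E).
  apply: ge0_le_integralT.
  - apply/measurable_EFinP; apply: measurable_funX.
    by apply: continuous_measurable_fun; exact: dwallb_continuous.
  - by move=> s; rewrite lee_fin sqr_ge0.
  - exact: emeasurable_funM.
  - by move=> s; rewrite -EFinM lee_fin; exact: dwallb_sqr_le.
rewrite ge0_integralZl//.
- rewrite (_ : pi / (ell * sig) = ell^-1 * (pi / sig)); last by rewrite invfM; lra.
  rewrite [(ell^-1 * _)%:E]EFinM; apply: lee_wpmul2l; last exact: lorentzian_integral.
  by rewrite lee_fin invr_ge0 ltW.
- by move=> s _; rewrite lee_fin invr_ge0 ltW.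
- by rewrite lee_fin invr_ge0 ltW.
Qed.

End wall_integrals.

(** * The competitor with N walls *)

Section competitor.
Context {R : realType}.
Local Notation mu := (@lebesgue_measure R).
Local Notation RR := (measurableTypeR R).
Local Notation D := (`]-1, 1[%classic : set RR).
Local Notation Kln := (@Kln R).

Lemma is_derive_shift (f : R -> R) (q x df : R) : is_derive (x - q) 1 f df ->
  is_derive x 1 (fun t => f (t - q)) df.
Proof.
move=> dfx; have d1 : is_derive x 1 (fun t : R => t - q) 1.
  by apply: is_derive_eq; rewrite subr0.
by have := @is_derive1_comp R f (fun t : R => t - q) x _ _ dfx d1; rewrite mulr1.
Qed.

Lemma continuous_shift (f : R -> R) (q : R) : continuous f -> continuous (fun t => f (t - q)).
Proof.
move=> cf x; apply: (@continuous_comp _ _ _ (fun t => t - q) f); last exact: cf.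
by apply: cvgB; [exact: cvg_id|exact: cvg_cst].
Qed.

Section one_wall.
Variables sig ell g c s0 : R.
Hypothesis sig0 : 0 < sig.
Hypothesis ell1 : 1 <= ell.
Hypothesis c0 : 0 <= c.
Hypothesis s00 : 0 < s0.
Hypothesis gc : g - c = s0 ^+ 2.

Local Notation w := (wallb sig ell).
Local Notation dw := (dwallb sig ell).

(** For g = 2 |gam| and c = gam^2, the point (d - gam b^2, b slope b) lies
    on the circle.  Unlike a square root of 1 - m_1^2 this is smooth at b =
    0. *)
Definition slope (b : R) : R := Num.sqrt (g - c * b ^+ 2).

(** The derivative of b slope b with respect to b. *)
Definition dslope (b : R) : R := slope b - c * b ^+ 2 / slope b.

(** The radicand is smallest at b = 1, where it equals s0^2; with s0 = sin
    alpha this keeps the second component smooth. *)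
Lemma slope_ge (b : R) : 0 <= b <= 1 -> s0 <= slope b.
Proof.
move=> /andP[b0 b1]; rewrite -[leLHS]ger0_norm ?(ltW s00)// -sqrtr_sqr -gc ler_wsqrtr//.
have : b ^+ 2 <= 1 by exact: exprn_ile1.
move=> b2; have := ler_wpM2l c0 b2; lra.
Qed.

Lemma slope1 : slope 1 = s0.
Proof. by rewrite /slope expr1n mulr1 gc sqrtr_sqr ger0_norm// ltW. Qed.

Lemma is_derive_slope (s : R) :
  is_derive s 1 (fun s => w s * slope (w s)) (dw s * dslope (w s)).
Proof.
have w01 := wallb_itv sig ell1 s; have S0 := lt_le_trans s00 (slope_ge w01).
have r0 : 0 < g - c * w s ^+ 2 by move: S0; rewrite /slope sqrtr_gt0.
have dwx := is_derive_wallb ell sig0 s.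
have d1 : is_derive s 1 (fun s => g - c * w s ^+ 2) (- (2 * c * w s * dw s)).
  apply: is_derive_eq; rewrite /GRing.scale/=; lra.
have d2 := @is_derive1_comp R Num.sqrt _ s _ _ (is_derive1_sqrt r0) d1.
have d3 := is_deriveM dwx d2.
rewrite (_ : (fun s => w s * slope (w s)) = w * (Num.sqrt \o (fun s => g - c * w s ^+ 2)))//.
apply: is_derive_eq d3 _; rewrite /GRing.scale/= -/(slope (w s)) /dslope invfM.
lra.
Qed.

Lemma slope_derivative_continuous : continuous (fun s => dw s * dslope (w s)).
Proof.
have cw := @wallb_continuous _ sig ell sig0.
have cs : continuous (fun s => slope (w s)).
  move=> x; apply: (@continuous_comp _ _ _ (fun s => g - c * w s ^+ 2) Num.sqrt).
    apply: cvgB; first exact: cvg_cst.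
    by apply: cvgM; [exact: cvg_cst|apply: cvgM; exact: cw].
  exact: sqrt_continuous.
move=> x; apply: cvgM; first exact: dwallb_continuous.
apply: cvgB; first exact: cs.
apply: cvgM; first by apply: cvgM; [exact: cvg_cst|apply: cvgM; exact: cw].
apply: cvgV; last exact: cs.
by rewrite gt_eqF// (lt_le_trans s00)// slope_ge// wallb_itv.
Qed.

Lemma dslope_bound (b : R) : 0 <= b <= 1 -> g <= 4 -> `|dslope b| <= 2 + 4 / s0.
Proof.
move=> b01 g4; have S0 := slope_ge b01; have Sp := lt_le_trans s00 S0.
have /andP[b0 b1] := b01.
have b2 : 0 <= b ^+ 2 <= 1 by rewrite sqr_ge0 exprn_ile1.
have /andP[b20 b21] := b2.
have S2 : slope b <= 2.
  rewrite /slope -[leRHS]ger0_norm// -sqrtr_sqr ler_wsqrtr// expr2.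
  have := mulr_ge0 c0 b20; lra.
have c4 : c <= 4 by move: gc g4 (sqr_ge0 s0); lra.
have q1 : 0 <= c * b ^+ 2 / slope b <= 4 / s0.
  rewrite divr_ge0 ?mulr_ge0 ?(ltW Sp)//=.
  apply: ler_pM; rewrite ?mulr_ge0 ?invr_ge0 ?(ltW Sp)//.
    by apply: le_trans c4; rewrite -[leRHS]mulr1 ler_wpM2l.
  by rewrite lef_pV2 ?posrE.
have /andP[q0 q4] := q1.
have s4 : 0 <= 4 / s0 by rewrite divr_ge0// ltW.
rewrite ler_norml /dslope; apply/andP; split; lra.
Qed.

Lemma is_derive_psi (s : R) : is_derive s 1 (wallf sig ell) (- (2 * w s * dw s)).
Proof.
have dwx := is_derive_wallb ell sig0 s.
rewrite (_ : wallf sig ell = fun s => 1 - w s ^+ 2)//.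
by apply: is_derive_eq; rewrite /GRing.scale/=; lra.
Qed.

End one_wall.

Lemma is_derive_cst_sum (N : nat) (h : 'I_N -> R -> R) (dh : 'I_N -> R) (b x : R) :
  (forall n, is_derive x 1 (h n) (dh n)) ->
  is_derive x 1 (fun t => b + \sum_(n < N) h n t) (\sum_(n < N) dh n).
Proof.
move=> hdh; have h1 := is_deriveD (is_derive_cst b x 1) (is_derive_sum hdh).
rewrite add0r in h1.
rewrite (_ : (fun t => _) = cst b + \sum_(n < N) h n)//.
by apply/funext => t; rewrite /= fctE fct_sumE.
Qed.

Lemma continuous_sum_fun (N : nat) (h : 'I_N -> R -> R) :
  (forall n, continuous (h n)) -> continuous (fun t => \sum_(n < N) h n t).
Proof.
elim: N h => [|N IH] h ch.
  rewrite (_ : (fun t => _) = cst 0); first exact: cst_continuous.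
  by apply/funext => t; rewrite big_ord0.
rewrite (_ : (fun t => _) = fun t => \sum_(n < N) h (widen_ord (leqnSn N) n) t + h ord_max t).
  by move=> x; apply: cvgD; [apply: IH => n; exact: ch|exact: ch].
by apply/funext => t; rewrite big_ord_recr.
Qed.

(** Cauchy-Schwarz, from 2 a_i a_j <= a_i^2 + a_j^2. *)
Lemma sqr_sum_le (N : nat) (a : 'I_N -> R) :
  (\sum_(n < N) a n) ^+ 2 <= N%:R * \sum_(n < N) a n ^+ 2.
Proof.
rewrite expr2 big_distrlr/=.
apply: (@le_trans _ _ (\sum_(i < N) \sum_(j < N) (a i ^+ 2 + a j ^+ 2) / 2)).
  apply: ler_sum => i _; apply: ler_sum => j _.
  have := sqr_ge0 (a i - a j); rewrite !expr2; lra.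
rewrite (_ : \sum_(i < N) _ = N%:R * \sum_(n < N) a n ^+ 2)//.
set S := \sum_(n < N) a n ^+ 2.
transitivity (\sum_(i < N) (N%:R * a i ^+ 2 + S) / 2).
  apply: eq_bigr => i _; rewrite -mulr_suml big_split/= sumr_const card_ord.
  by rewrite mulr_natl.
by rewrite -mulr_suml big_split/= sumr_const card_ord -mulr_sumr -mulr_natl -/S; lra.
Qed.

Section walls.
Variables (alpha : R) (N : nat) (d q : 'I_N -> R) (rho sig ell : R).
Hypothesis halpha : 0 < alpha < pi.
Hypothesis hd : signs d.
Hypothesis sig0 : 0 < sig.
Hypothesis ell1 : 1 <= ell.
Hypothesis rho0 : 0 < rho.
Hypothesis ellrho : ell + 4 <= ln (rho / sig).
Hypothesis sep : separated rho q.

Let ell0 : 0 < ell. Proof. exact: lt_le_trans ell1. Qed.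

Local Notation gam := (wall alpha d).
Local Notation w := (wallb sig ell).
Local Notation dw := (dwallb sig ell).
Local Notation psi := (wallf sig ell).
Local Notation g n := (2 * (d n * gam n)).
Local Notation c n := (gam n ^+ 2).

Let sina0 : 0 < sin alpha. Proof. exact: sin_gt0_pi. Qed.

Lemma wall_slope n : g n - c n = sin alpha ^+ 2.
Proof.
have d2 := sqr_sign hd n; have cs := cos2Dsin2 alpha; rewrite /wall.
have : d n * (d n - cos alpha) = 1 - d n * cos alpha by rewrite mulrBr -expr2 d2.
move=> ->; rewrite sqrrB d2 -mulr_natr; lra.
Qed.

Lemma wall_bound n : `|gam n| <= 2.
Proof.
rewrite /wall; apply: le_trans (ler_normB _ _) _.
have : `|cos alpha| <= 1 by rewrite ler_norml cos_geN1 cos_le1.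
by case: (hd n) => ->; rewrite ?normrN normr1; lra.
Qed.

Lemma wall_sqr_le n : gam n ^+ 2 <= 4.
Proof.
rewrite -real_normK ?num_real// (_ : 4 = 2 ^+ 2); last by rewrite expr2; lra.
by rewrite lerXn2r ?nnegrE// wall_bound.
Qed.

Lemma wall_slope_le n : g n <= 4.
Proof.
have : `|d n * gam n| <= 2.
  by rewrite normrM; case: (hd n) => ->; rewrite ?normrN normr1 mul1r wall_bound.
rewrite ler_norml => /andP[_ h]; lra.
Qed.

(** The walls do not overlap, so at every point at most one summand differs
    from its value far away and the sums stay on the circle. *)
Definition competitor (x : R) : R * R :=
  (cos alpha + \sum_(n < N) gam n * psi (x - q n),
   sin alpha + \sum_(n < N) (w (x - q n) * slope (g n) (c n) (w (x - q n)) - sin alpha)).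

Definition dcompetitor (x : R) : R * R :=
  (\sum_(n < N) gam n * (- (2 * w (x - q n) * dw (x - q n))),
   \sum_(n < N) (dw (x - q n) * dslope (g n) (c n) (w (x - q n)))).

Lemma is_derive_competitor1 (x : R) : is_derive x 1 (fst \o competitor) (dcompetitor x).1.
Proof.
apply: is_derive_cst_sum => n.
have := is_deriveZ (gam n) (is_derive_shift (is_derive_psi ell sig0 (x - q n))).
exact.
Qed.

Lemma is_derive_competitor2 (x : R) : is_derive x 1 (snd \o competitor) (dcompetitor x).2.
Proof.
apply: is_derive_cst_sum => n.
have h := is_derive_shift (is_derive_slope sig0 ell1 (sqr_ge0 _) sina0 (wall_slope n) (x - q n)).
by have := is_deriveB h (is_derive_cst (sin alpha) x 1); rewrite subr0.
Qed.

Lemma dcompetitor1_continuous : continuous (fst \o dcompetitor).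
Proof.
apply: continuous_sum_fun => n x; apply: cvgM; first exact: cvg_cst.
apply: (continuous_shift (f := fun s => - (2 * w s * dw s))) => {}x.
apply: cvgN; apply: cvgM; last exact: dwallb_continuous.
by apply: cvgM; [exact: cvg_cst|exact: wallb_continuous].
Qed.

Lemma dcompetitor2_continuous : continuous (snd \o dcompetitor).
Proof.
apply: continuous_sum_fun => n.
apply: (continuous_shift (f := fun s => dw s * dslope (g n) (c n) (w s))).
exact: slope_derivative_continuous (sqr_ge0 _) sina0 (wall_slope n).
Qed.

Lemma wallb_outside s : rho <= `|s| -> w s = 1.
Proof.
move=> /(psi_outside sig0 ell1 rho0 ellrho); rewrite /wallf => h.
have /andP[w0 w1] := wallb_itv sig ell1 s.
have : w s ^+ 2 = 1 by move: h; lra.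
by move=> /eqP; rewrite sqrf_eq1 => /orP[/eqP//|/eqP wN]; lra.
Qed.

(** The cores are disjoint. *)
Lemma active_wall (x : R) : (forall k, rho <= `|x - q k|) \/
  exists n, forall k, k != n -> rho <= `|x - q k|.
Proof.
have [[n nx]|h] := pselect (exists n, `|x - q n| < rho); last first.
  by left => k; rewrite leNgt; apply/negP => kx; apply: h; exists k.
right; exists n => k kn; have [_ /(_ _ _ kn) s] := sep.
have := ler_distD x (q k) (q n); rewrite (distrC (q k) x); move: rho0; lra.
Qed.

Lemma competitor_outside x : (forall k, rho <= `|x - q k|) ->
  competitor x = (cos alpha, sin alpha).
Proof.
move=> out; rewrite /competitor !big1 ?addr0// => k _.
  by rewrite wallb_outside// (slope1 sina0 (wall_slope k)) mul1r subrr.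
by rewrite (psi_outside sig0 ell1 rho0 ellrho) ?mulr0.
Qed.

Lemma competitor_near x n : (forall k, k != n -> rho <= `|x - q k|) ->
  competitor x = (cos alpha + gam n * psi (x - q n),
    w (x - q n) * slope (g n) (c n) (w (x - q n))).
Proof.
move=> out; rewrite /competitor (bigD1 n)//= [in X in (_, X)](bigD1 n)//= !big1 ?addr0.
- by congr (_, _); rewrite addrC subrK.
- by move=> k kn; rewrite wallb_outside ?out// (slope1 sina0 (wall_slope k)) mul1r subrr.
- by move=> k kn; rewrite (psi_outside sig0 ell1 rho0 ellrho) ?mulr0// out.
Qed.

Lemma competitor_circle x : (competitor x).1 ^+ 2 + (competitor x).2 ^+ 2 = 1.
Proof.
have [out|[n out]] := active_wall x.
  by rewrite competitor_outside//= cos2Dsin2.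
rewrite (competitor_near out)/=.
have w01 := wallb_itv sig ell1 (x - q n).
have S0 := slope_ge (sqr_ge0 (gam n)) sina0 (wall_slope n) w01.
rewrite exprMn /slope sqr_sqrtr; last first.
  by rewrite ltW// -sqrtr_gt0; exact: lt_le_trans S0.
have d2 := sqr_sign hd n.
rewrite /wallf; set b := w _ ^+ 2.
have -> : cos alpha = d n - gam n by rewrite /wall opprB addrC subrK.
rewrite (_ : d n - gam n + gam n * (1 - b) = d n - gam n * b); last lra.
rewrite sqrrB d2 exprMn -mulr_natr !expr2; lra.
Qed.

Lemma competitor_admissible : admissible alpha q d competitor.
Proof.
have [h1 _] := C1_H1 is_derive_competitor1 dcompetitor1_continuous.
have [h2 _] := C1_H1 is_derive_competitor2 dcompetitor2_continuous.
have far (x : R) : 1 <= `|x| -> forall k, rho <= `|x - q k|.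
  move=> x1 k; have [/(_ k)/andP[k1 k2] _] := sep.
  have : `|q k| <= 1 - 2 * rho by rewrite ler_norml; apply/andP; split; lra.
  have := ler_distD (q k) x 0; rewrite !subr0; move: rho0; lra.
split.
- by split => // x _; exact: competitor_circle.
- move=> n; have out k : k != n -> rho <= `|q n - q k|.
    move=> kn; have [_ /(_ _ _ kn)] := sep; rewrite distrC; move: rho0; lra.
  by rewrite (competitor_near out)/= subrr (psi0 sig ell1) mulr1 /wall addrC subrK.
- by rewrite competitor_outside//; apply: far; rewrite normrN normr1.
- by rewrite competitor_outside//; apply: far; rewrite normr1.
Qed.

Lemma competitor_profile : profile alpha competitor = fun x => \sum_(n < N) gam n * psi (x - q n).
Proof.
apply/funext => x; rewrite profileE; case: ifPn => [_|xout].
  by rewrite /competitor/= addrC addKr.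
rewrite big1// => k _; rewrite (psi_outside sig0 ell1 rho0 ellrho) ?mulr0//.
have [/(_ k)/andP[k1 k2] _] := sep.
move: xout; rewrite negb_and -!leNgt => /orP[x1|x1].
  by rewrite ler0_norm; move: rho0; lra.
by rewrite ger0_norm; move: rho0; lra.
Qed.

(** Dominates |f| because wall heights are at most 2. *)
Definition envelope (x : R) : R := \sum_(n < N) 2 * psi (x - q n).

Lemma envelope_ge n x : 2 * psi (x - q n) <= envelope x.
Proof.
rewrite /envelope (bigD1 n)//= lerDl sumr_ge0// => k _.
by rewrite mulr_ge0//; have /andP[] := psi_itv sig ell1 (x - q k).
Qed.

Lemma envelope_ge0 x : 0 <= envelope x.
Proof.
by rewrite sumr_ge0// => k _; rewrite mulr_ge0//; have /andP[] := psi_itv sig ell1 (x - q k).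
Qed.

Let f x := \sum_(n < N) gam n * psi (x - q n).

Let pout x : rho <= `|x| -> psi x = 0.
Proof. exact: psi_outside. Qed.

Lemma quot_one_wall s t n :
  (forall k, k != n -> psi (s - q k) = 0 /\ psi (t - q k) = 0) ->
  quot f s t = gam n ^+ 2 * quot psi (s - q n) (t - q n).
Proof.
move=> z; have fE x : (forall k, k != n -> psi (x - q k) = 0) -> f x = gam n * psi (x - q n).
  by move=> zx; rewrite /f (bigD1 n)//= big1 ?addr0// => k kn; rewrite zx ?mulr0.
rewrite /quot !fE; [|by move=> k /z[]..].
rewrite -mulrBr exprMn -mulrA; congr (_ * (_ / _)).
by congr (_ ^+ 2); lra.
Qed.

(** If s and t belong to different cores, the cross term is at most the
    product of the envelopes, divided by the square of the distance, which
    is at least 2 rho; otherwise a single wall is seen. *)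
Lemma quot_walls_le s t :
  quot f s t <= \sum_(n < N) gam n ^+ 2 * quot psi (s - q n) (t - q n) +
    (2 * rho ^+ 2)^-1 * (envelope s * envelope t).
Proof.
have r0 := rho0.
have S0 (P : pred 'I_N) : 0 <= \sum_(n < N | P n) gam n ^+ 2 * quot psi (s - q n) (t - q n).
  by rewrite sumr_ge0// => n _; rewrite mulr_ge0 ?sqr_ge0 ?quot_ge0.
have W0 : 0 <= (2 * rho ^+ 2)^-1 * (envelope s * envelope t).
  by rewrite mulr_ge0 ?mulr_ge0 ?envelope_ge0// invr_ge0 mulr_ge0// sqr_ge0.
have one n : (forall k, k != n -> psi (s - q k) = 0 /\ psi (t - q k) = 0) ->
    quot f s t <= \sum_(n < N) gam n ^+ 2 * quot psi (s - q n) (t - q n) +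
    (2 * rho ^+ 2)^-1 * (envelope s * envelope t).
  by move=> /quot_one_wall ->; rewrite (bigD1 n)//= -addrA lerDl addr_ge0.
have [outs|[i outs]] := active_wall s; have [outt|[j outt]] := active_wall t.
- have fs : f s = 0 by apply: big1 => k _; rewrite pout ?mulr0.
  have ft : f t = 0 by apply: big1 => k _; rewrite pout ?mulr0.
  by rewrite {1}/quot fs ft subrr expr0n mul0r addr_ge0//; exact: (S0 predT).
- by apply: (one j) => k kj; rewrite !pout// outt.
- by apply: (one i) => k ki; rewrite !pout// outs.
have [ij|ij] := eqVneq i j.
  by apply: (one i) => k ki; rewrite !pout ?outs ?outt// -ij.
have [si|si] := leP rho `|s - q i|.
  apply: (one j) => k kj; rewrite (pout (outt _ kj)); split => //.
  by have [->|/outs/pout->//] := eqVneq k i; rewrite pout.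
have [tj|tj] := leP rho `|t - q j|.
  apply: (one i) => k ki; rewrite (pout (outs _ ki)); split => //.
  by have [->|/outt/pout->//] := eqVneq k j; rewrite pout.
(* From here on s and t lie in the distinct cores i and j. *)
have ji : j != i by rewrite eq_sym.
have st : 2 * rho <= `|s - t|.
  have [_ /(_ _ _ ij) h] := sep.
  have := ler_distD s (q i) (q j); have := ler_distD t s (q j).
  rewrite (distrC (q i) s); lra.
have fs : f s = gam i * psi (s - q i).
  by rewrite /f (bigD1 i)//= big1 ?addr0// => k ki; rewrite pout ?mulr0// outs.
have ft : f t = gam j * psi (t - q j).
  by rewrite /f (bigD1 j)//= big1 ?addr0// => k ki; rewrite pout ?mulr0// outt.
rewrite (bigD1 i)//= (bigD1 j)//=.
have x0 : 0 <= (s - t) ^- 2 by rewrite invr_ge0 sqr_ge0.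
have E n : quot psi (s - q n) (t - q n) = (psi (s - q n) - psi (t - q n)) ^+ 2 * (s - t) ^- 2.
  by rewrite /quot; congr (_ / _ ^+ 2); lra.
have := S0 [pred n | (n != i) && (n != j)]; rewrite /=.
set T := \sum_(n < N | _) _; move=> T0.
have Wi := envelope_ge i s; have Wj := envelope_ge j t.
have /andP[pi0 _] := psi_itv sig ell1 (s - q i).
have /andP[pj0 _] := psi_itv sig ell1 (t - q j).
rewrite !E (pout (outt _ ij)) (pout (outs _ ji)) /quot fs ft subr0 sub0r sqrrN.
have gi := wall_bound i; have gj := wall_bound j.
set a := gam i in gi *; set b := gam j in gj *.
set x := psi (s - q i) in Wi pi0 *; set y := psi (t - q j) in Wj pj0 *.
have ab : - (2 * ((a * x) * (b * y))) <= 2 * (envelope s * envelope t).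
  have ax : `|a * x| <= envelope s.
    by apply: le_trans Wi; rewrite normrM (ger0_norm pi0) ler_wpM2r.
  have bY : `|b * y| <= envelope t.
    by apply: le_trans Wj; rewrite normrM (ger0_norm pj0) ler_wpM2r.
  have : `|(a * x) * (b * y)| <= envelope s * envelope t.
    by rewrite normrM ler_pM.
  rewrite ler_norml => /andP[h _]; lra.
have WW : 0 <= envelope s * envelope t by rewrite mulr_ge0 ?envelope_ge0.
have st2 : 4 * rho ^+ 2 <= (s - t) ^+ 2.
  rewrite -[leRHS]real_normK ?num_real// (_ : 4 * rho ^+ 2 = (2 * rho) ^+ 2); last by rewrite exprMn; lra.
  by rewrite lerXn2r ?nnegrE ?mulr_ge0 ?(ltW r0).
have r4 : 0 < 4 * rho ^+ 2 by rewrite mulr_gt0// exprn_gt0.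
have xr : (s - t) ^- 2 <= (4 * rho ^+ 2)^-1.
  by rewrite lef_pV2 ?posrE//; exact: lt_le_trans st2.
have h1 := ler_wpM2r x0 ab.
have h2 := ler_wpM2l (mulr_ge0 (ler0n R 2) WW) xr.
have h3 : 2 * (envelope s * envelope t) / (4 * rho ^+ 2) =
    (2 * rho ^+ 2)^-1 * (envelope s * envelope t) by rewrite !invfM; lra.
rewrite h3 in h2.
rewrite sqrrB -mulr_natr !exprMn; lra.
Qed.

Lemma total_energy_shift (p : R) (u : R -> R) : measurable_fun setT (u : RR -> R) ->
  (\int[mu]_s \int[mu]_t (quot u (s - p)%R (t - p)%R)%:E)%E = total_energy u.
Proof.
move=> mu'; have mq := measurable_quot mu'.
pose h (z : RR * RR) := (quot u z.1 z.2)%:E.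
have mh : measurable_fun setT h by exact/measurable_EFinP.
have h0 z : (0 <= h z)%E by rewrite lee_fin quot_ge0.
have mI : measurable_fun setT (fun s => \int[mu]_t h (s, t))%E.
  exact: (measurable_fun_fubini_tonelli_F h).
apply/esym; transitivity (\int[mu]_s \int[mu]_t h (s, t))%E; first by [].
rewrite (integral_shift (- p) mI); last first.
  by move=> s; apply: integral_ge0 => t _; exact: h0.
apply: eq_integral => s _.
by rewrite (integral_shift (- p) (measurable_fun_pair2 (s - p) mh)).
Qed.

Let mpsi : measurable_fun setT (psi : RR -> R).
Proof. exact: measurable_psi. Qed.

Let mpsis n : measurable_fun setT (fun x : RR => psi (x - q n) : R).
Proof. by apply: (measurableT_comp mpsi); exact: measurable_funB. Qed.

Lemma measurable_envelope : measurable_fun setT (envelope : RR -> R).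
Proof. by apply: measurable_sum => n; exact: measurable_funM. Qed.

Lemma envelope_integral : (\int[mu]_s (envelope s)%:E <= (8 * N%:R * rho / ell)%:E)%E.
Proof.
have p0 n x : 0 <= psi (x - q n) by have /andP[] := psi_itv sig ell1 (x - q n).
rewrite (_ : (\int[mu]_s _)%E = (\sum_(n < N) \int[mu]_s (2%:E * (psi (s - q n)%R)%:E))%E); last first.
  rewrite -ge0_integral_sum; [|by []|by move=> n; apply: emeasurable_funM => //; exact/measurable_EFinP
     |by move=> n s _; rewrite -EFinM lee_fin mulr_ge0].
  by apply: eq_integral => s _; rewrite -sumEFin.
apply: (@le_trans _ _ (\sum_(n < N) (8 * rho / ell)%:E)%E); last first.
  by rewrite sumEFin sumr_const card_ord lee_fin -mulr_natl; lra.
apply: lee_sum => n _; rewrite ge0_integralZl//; last 2 first.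
- exact/measurable_EFinP.
- by move=> s _; rewrite lee_fin.
have -> : (\int[mu]_s (psi (s - q n)%R)%:E = \int[mu]_s (psi s)%:E)%E.
  rewrite [RHS](integral_shift (- q n))//; first exact/measurable_EFinP.
  by move=> s; rewrite lee_fin; have /andP[] := psi_itv sig ell1 s.
apply: (@le_trans _ _ (2%:E * (4 * rho / ell)%:E)%E).
  by apply: lee_wpmul2l => //; exact: psi_L1.
by rewrite -EFinM lee_fin; lra.
Qed.

(** The walls interact through the product of their integrals, each of order
    rho / ell, so the interaction is O(1 / ell^2). *)
Lemma competitor_total_energy :
  (total_energy (profile alpha competitor) <=
   (4 * Kln * Gamma alpha d / ell + 32 * N%:R ^+ 2 / ell ^+ 2)%:E)%E.
Proof.
rewrite competitor_profile -/f.
have mf : measurable_fun setT (f : RR -> R).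
  by apply: measurable_sum => n; exact: measurable_funM.
have mq := measurable_quot mpsi.
have mshift n : measurable_fun setT (fun z : RR * RR => (z.1 - q n, z.2 - q n) : RR * RR).
  by apply: measurable_fun_pair; apply: measurable_funB.
pose qs n (z : RR * RR) := (quot psi (z.1 - q n)%R (z.2 - q n)%R)%:E.
have mqs n : measurable_fun setT (qs n).
  by apply/measurable_EFinP; exact: (measurableT_comp mq (mshift n)).
have qs0 n z : (0 <= qs n z)%E by rewrite lee_fin quot_ge0.
pose h n (z : RR * RR) := ((c n)%:E * (quot psi (z.1 - q n)%R (z.2 - q n)%R)%:E)%E.
pose k (z : RR * RR) := ((2 * rho ^+ 2)^-1%:E * ((envelope z.1)%:E * (envelope z.2)%:E))%E.
have mW := measurable_envelope.
have mh n : measurable_fun setT (h n).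
  by apply: emeasurable_funM => //; exact: mqs.
have mk : measurable_fun setT k.
  apply: emeasurable_funM => //; apply: emeasurable_funM; apply/measurable_EFinP;
    exact: (measurableT_comp mW).
have h0 n z : (0 <= h n z)%E by rewrite /h -EFinM lee_fin mulr_ge0 ?sqr_ge0 ?quot_ge0.
have k0 z : (0 <= k z)%E.
  rewrite /k -!EFinM lee_fin mulr_ge0 ?mulr_ge0 ?envelope_ge0//.
  by rewrite invr_ge0 mulr_ge0// sqr_ge0.
have mhs n s : measurable_fun setT (fun t => h n (s, t)) by exact: (measurable_fun_pair2 s (mh n)).
have mhi n : measurable_fun setT (fun s => \int[mu]_t h n (s, t))%E.
  exact: (measurable_fun_fubini_tonelli_F (h n)).
have hs0 z : (0 <= \sum_(n < N) h n z)%E by exact: sume_ge0.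
have msum : measurable_fun setT (fun z => \sum_(n < N) h n z)%E by exact: emeasurable_sum.
apply: (@le_trans _ _ (\int[mu]_s \int[mu]_t (\sum_(n < N) h n (s, t) + k (s, t)))%E).
  have mqf := measurable_quot mf.
  pose g (z : RR * RR) := (quot f z.1 z.2)%:E.
  pose g' (z : RR * RR) := (\sum_(n < N) h n z + k z)%E.
  have mg : measurable_fun setT g by exact/measurable_EFinP.
  have mg' : measurable_fun setT g' by exact: emeasurable_funD.
  have g0 z : (0 <= g z)%E by rewrite lee_fin quot_ge0.
  have g'0 z : (0 <= g' z)%E by exact: adde_ge0.
  apply: ge0_le_integralT.
  - exact: (measurable_fun_fubini_tonelli_F g).
  - by move=> s; apply: integral_ge0 => t _; exact: (g0 (s, t)).
  - exact: (measurable_fun_fubini_tonelli_F g').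
  move=> s; apply: ge0_le_integralT.
  - exact: (measurable_fun_pair2 s mg).
  - by move=> t; exact: (g0 (s, t)).
  - exact: (measurable_fun_pair2 s mg').
  move=> t; rewrite /h /k/=.
  under eq_bigr do rewrite -EFinM.
  by rewrite sumEFin -!EFinM -EFinD lee_fin quot_walls_le.
have -> : (\int[mu]_s \int[mu]_t (\sum_(n < N) h n (s, t) + k (s, t)) =
  \sum_(n < N) \int[mu]_s \int[mu]_t h n (s, t) + \int[mu]_s \int[mu]_t k (s, t))%E.
  rewrite -ge0_integral_sum; [|by []|exact: mhi
    |by move=> n s _; apply: integral_ge0 => t _; exact: (h0 n (s, t))].
  rewrite ge0_integralDT.
  - apply: eq_integral => s _.
    rewrite -ge0_integral_sum; [|by []|by []|by move=> n t _; exact: (h0 n (s, t))].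
    rewrite ge0_integralDT//.
    + exact: (measurable_fun_pair2 s msum).
    + exact: (measurable_fun_pair2 s mk).
  - by apply: emeasurable_sum => n; exact: mhi.
  - by move=> s; apply: sume_ge0 => n _; apply: integral_ge0 => t _; exact: (h0 n (s, t)).
  - exact: (measurable_fun_fubini_tonelli_F k).
  - by move=> s; apply: integral_ge0 => t _; exact: (k0 (s, t)).
rewrite EFinD; apply: leeD.
  apply: (@le_trans _ _ (\sum_(n < N) (c n * (4 * Kln / ell))%:E)%E); last first.
    by rewrite sumEFin lee_fin -mulr_suml -/(Gamma alpha d); lra.
  apply: lee_sum => n _.
  have -> : (\int[mu]_s \int[mu]_t h n (s, t) = (c n)%:E * total_energy psi)%E.
    rewrite -(total_energy_shift (q n) mpsi) -ge0_integralZl//.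
    - apply: eq_integral => s _.
      rewrite -ge0_integralZl//; first exact: (measurable_fun_pair2 s (mqs n)).
        by move=> t _; exact: (qs0 n (s, t)).
      by rewrite lee_fin sqr_ge0.
    - exact: (measurable_fun_fubini_tonelli_F (qs n)).
    - by move=> s _; apply: integral_ge0 => t _; exact: (qs0 n (s, t)).
    - by rewrite lee_fin sqr_ge0.
  rewrite [(c n * _)%:E]EFinM; apply: lee_wpmul2l; first by rewrite lee_fin sqr_ge0.
  exact: psi_energy rho0 ellrho.
have mWE : measurable_fun setT (fun s : RR => (envelope s)%:E) by exact/measurable_EFinP.
have We0 s : (0 <= (envelope s)%:E)%E by rewrite lee_fin envelope_ge0.
have e0 : 0 <= (2 * rho ^+ 2)^-1 by rewrite invr_ge0 mulr_ge0// sqr_ge0.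
pose I := (\int[mu]_s (envelope s)%:E)%E.
have I0 : (0 <= I)%E by exact: integral_ge0.
have Ifin : I \is a fin_num.
  rewrite ge0_fin_numE//; apply: le_lt_trans envelope_integral _; exact: ltry.
have -> : (\int[mu]_s \int[mu]_t k (s, t) = ((2 * rho ^+ 2)^-1%:E * I) * I)%E.
  rewrite -[RHS]ge0_integralZl//; last by rewrite mule_ge0.
  apply: eq_integral => s _.
  rewrite muleAC -[RHS]ge0_integralZl//; last by rewrite mule_ge0.
  by apply: eq_integral => t _; rewrite /k/= muleA.
have [r Ir] : exists r, I = r%:E by exists (fine I); rewrite fineK.
have := envelope_integral; rewrite -/I Ir lee_fin => Ile.
rewrite -!EFinM lee_fin; move: I0; rewrite Ir lee_fin => If0.
have B0 : 0 <= 8 * N%:R * rho / ell by exact: le_trans Ile.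
have h1 : r * r <= (8 * N%:R * rho / ell) * (8 * N%:R * rho / ell) by rewrite ler_pM.
rewrite -[leLHS]mulrA; apply: le_trans (ler_wpM2l e0 h1) _.
rewrite (_ : (2 * rho ^+ 2)^-1 * _ = 32 * N%:R ^+ 2 / ell ^+ 2 * (rho ^+ 2 / rho ^+ 2)); last first.
  by rewrite !expr2 !invfM; lra.
by rewrite divff ?mulr1// expf_neq0// gt_eqF.
Qed.

(** A bound for the squared derivatives of the two components in terms of
    the squared derivative of the profile. *)
Definition Kdir : R := 16 + (2 + 4 / sin alpha) ^+ 2.

Lemma Kdir_ge0 : 0 <= Kdir.
Proof. by rewrite addr_ge0// sqr_ge0. Qed.

Lemma dcompetitor_sqr_le x : (dcompetitor x).1 ^+ 2 + (dcompetitor x).2 ^+ 2 <=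
  \sum_(n < N) (N%:R * Kdir) * dw (x - q n) ^+ 2.
Proof.
apply: le_trans (lerD (sqr_sum_le _) (sqr_sum_le _)) _.
rewrite -mulrDr -big_split/= mulr_sumr; apply: ler_sum => n _.
rewrite -[leRHS]mulrA ler_wpM2l// /Kdir [leRHS]mulrDl.
have w01 := wallb_itv sig ell1 (x - q n).
move: (w (x - q n)) (dw (x - q n)) w01 => u v u01; have /andP[u0 u1] := u01.
apply: lerD.
  rewrite (_ : _ ^+ 2 = gam n ^+ 2 * (4 * (u ^+ 2 * v ^+ 2))); last first.
    by rewrite !exprMn sqrrN !exprMn; lra.
  rewrite (_ : 16 * _ = 4 * (4 * (1 * v ^+ 2))); last lra.
  have v20 := sqr_ge0 v; have u20 := sqr_ge0 u.
  have uv : 0 <= 4 * (u ^+ 2 * v ^+ 2) by do 2 apply: mulr_ge0 => //.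
  apply: ler_pM => //; rewrite ?sqr_ge0 ?wall_sqr_le//.
  by rewrite ler_wpM2l// ler_wpM2r ?sqr_ge0// exprn_ile1.
rewrite exprMn mulrC ler_wpM2r ?sqr_ge0//.
have h := dslope_bound (sqr_ge0 (gam n)) sina0 (wall_slope n) u01 (wall_slope_le n).
rewrite -real_normK ?num_real// lerXn2r ?nnegrE//.
exact: le_trans h.
Qed.

Lemma competitor_dirichlet :
  (dirichlet competitor <= (N%:R ^+ 2 * Kdir * pi / (ell * sig))%:E)%E.
Proof.
have [h1 w1] := C1_H1 is_derive_competitor1 dcompetitor1_continuous.
have [h2 w2] := C1_H1 is_derive_competitor2 dcompetitor2_continuous.
rewrite (dirichletE h1 h2 w1 w2).
have mdc : measurable_fun setT (fun x : RR => ((dcompetitor x).1 ^+ 2 + (dcompetitor x).2 ^+ 2)%:E).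
  apply/measurable_EFinP; apply: measurable_funD; apply: measurable_funX;
    apply: continuous_measurable_fun;
    [exact: dcompetitor1_continuous|exact: dcompetitor2_continuous].
have mdw n : measurable_fun setT (fun x : RR => (dw (x - q n) ^+ 2)%:E).
  apply/measurable_EFinP; apply: measurable_funX.
  apply: (@measurableT_comp _ _ _ _ _ _ (dw : RR -> R)); last exact: measurable_funB.
  by apply: continuous_measurable_fun; exact: dwallb_continuous.
have mdw0 : measurable_fun setT (fun x : RR => (dw x ^+ 2)%:E).
  apply/measurable_EFinP; apply: measurable_funX.
  by apply: continuous_measurable_fun; exact: dwallb_continuous.
have NK0 : 0 <= N%:R * Kdir by rewrite mulr_ge0 ?Kdir_ge0.
apply: (@le_trans _ _ (\int[mu]_x ((dcompetitor x).1 ^+ 2 + (dcompetitor x).2 ^+ 2)%:E)%E).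
  by apply: ge0_subset_integral => // x _; rewrite lee_fin addr_ge0// sqr_ge0.
apply: (@le_trans _ _ (\int[mu]_x (\sum_(n < N) ((N%:R * Kdir)%:E * (dw (x - q n)%R ^+ 2)%:E)))%E).
  apply: ge0_le_integralT => //.
  - by move=> x; rewrite lee_fin addr_ge0// sqr_ge0.
  - by apply: emeasurable_sum => n; exact: emeasurable_funM.
  - move=> x; under eq_bigr do rewrite -EFinM.
    by rewrite sumEFin lee_fin dcompetitor_sqr_le.
rewrite ge0_integral_sum; [|by []|by move=> n; exact: emeasurable_funM
  |by move=> n x _; rewrite -EFinM lee_fin mulr_ge0// sqr_ge0].
apply: (@le_trans _ _ (\sum_(n < N) ((N%:R * Kdir) * (pi / (ell * sig)))%:E)%E); last first.
  rewrite sumEFin sumr_const card_ord lee_fin -mulr_natl expr2; lra.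
apply: lee_sum => n _; rewrite ge0_integralZl//; last by move=> x _; rewrite lee_fin sqr_ge0.
rewrite [X in (_ <= X)%E]EFinM; apply: lee_wpmul2l => //.
have -> : (\int[mu]_x (dw (x - q n)%R ^+ 2)%:E = \int[mu]_x (dw x ^+ 2)%:E)%E.
  by rewrite [RHS](integral_shift (- q n))// => x; rewrite lee_fin sqr_ge0.
exact: dwallb_dirichlet.
Qed.

Lemma competitor_energy eps : 0 < eps ->
  (energy alpha eps competitor <=
   (Kln * Gamma alpha d / (pi * ell) + 8 * N%:R ^+ 2 / (pi * ell ^+ 2) +
    N%:R ^+ 2 * Kdir * pi * eps / (2 * ell * sig))%:E)%E.
Proof.
move=> e0; have p0 : 0 < pi :> R by exact: pi_gt0.
rewrite energyE.
apply: le_trans (leeD (lee_wpmul2l _ competitor_dirichlet) (lee_wpmul2l _ competitor_total_energy)) _.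
- by rewrite lee_fin divr_ge0// ltW.
- by rewrite lee_fin invr_ge0 mulr_ge0// ltW.
rewrite -!EFinM -EFinD lee_fin le_eqVlt; apply/orP; left; apply/eqP.
rewrite !invfM; set P := pi^-1; lra.
Qed.

End walls.

End competitor.

(** * Moving the walls *)

Section transfer.
Context {R : realType}.
Local Notation mu := (@lebesgue_measure R).
Local Notation RR := (measurableTypeR R).

Lemma derive_itv_increment (f df : R -> R) (lo hi x y : R) :
  (forall t : R, is_derive t 1 f (df t)) -> (forall t, lo <= df t <= hi) ->
  x <= y -> lo * (y - x) <= f y - f x <= hi * (y - x).
Proof.
move=> fdf df01; rewrite le_eqVlt => /predU1P[->|xy]; first by rewrite !subrr !mulr0 lexx.
have cf : {within `[x, y], continuous f}.
  by apply: continuous_subspaceT => t; exact: is_derive_cont (fdf t).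
have [c _ ->] := MVT xy (fun t _ => fdf t) cf.
have /andP[? ?] := df01 c; have yx : 0 <= y - x by rewrite subr_ge0 ltW.
by rewrite !ler_wpM2r.
Qed.

Section bump.
Variable rho : R.
Hypothesis rho0 : 0 < rho.

(** Equal to 1 on the core and to 0 at distance 2 rho. *)
Definition bump : R -> R := plateau (- (2 * rho)) rho rho.
Definition dbump : R -> R := dplateau (- (2 * rho)) rho rho.

Lemma bump1 t : `|t| <= rho -> bump t = 1.
Proof.
have r0 := rho0; rewrite ler_norml => /andP[t1 t2].
rewrite /bump /plateau ramp1 ?ramp0 ?subr0//.
  by rewrite ler_pdivrMr// mul0r; lra.
by rewrite ler_pdivlMr// mul1r; lra.
Qed.

Lemma bump0 t : 2 * rho <= `|t| -> bump t = 0.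
Proof.
have r0 := rho0; rewrite /bump /plateau ler_normr => /orP[t1|t1].
  by rewrite !ramp1 ?subrr// ler_pdivlMr// mul1r; lra.
by rewrite !ramp0 ?subrr// ler_pdivrMr// mul0r; lra.
Qed.

Lemma dbump0 t : `|t| <= rho \/ 2 * rho <= `|t| -> dbump t = 0.
Proof.
have r0 := rho0; rewrite /dbump /dplateau => h.
have -> : dramp ((t - - (2 * rho)) / rho) = 0.
  apply: dramp0; rewrite ler_pdivrMr// ler_pdivlMr// mul0r mul1r.
  by case: h; [rewrite ler_norml => /andP[? ?]|rewrite ler_normr => /orP[?|?]]; lra.
have -> : dramp ((t - rho) / rho) = 0.
  apply: dramp0; rewrite ler_pdivrMr// ler_pdivlMr// mul0r mul1r.
  by case: h; [rewrite ler_norml => /andP[? ?]|rewrite ler_normr => /orP[?|?]]; lra.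
by rewrite mul0r subrr.
Qed.

Lemma dbump_bound t : `|dbump t| <= 2 / rho.
Proof.
rewrite /dbump /dplateau -mulrBl normrM [`|rho^-1|]gtr0_norm ?invr_gt0//.
rewrite ler_pM2r ?invr_gt0//.
have /andP[? ?] := dramp_itv ((t - - (2 * rho)) / rho).
have /andP[? ?] := dramp_itv ((t - rho) / rho).
by rewrite ler_norml; apply/andP; split; lra.
Qed.

End bump.

Variables (N : nat) (p q : 'I_N -> R) (rho r eta : R).
Hypothesis rho0 : 0 < rho.
Hypothesis sep : separated rho q.
Hypothesis pq : forall n, `|p n - q n| <= r.
Hypothesis etaE : eta = 2 * N%:R * r / rho.
Hypothesis eta_le : eta <= 1 / 2.

(** A translation by p n - q n near q n and the identity far from all q n. *)
Definition moving (x : R) : R := x + \sum_(n < N) (p n - q n) * bump rho (x - q n).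
Definition dmoving (x : R) : R := 1 + \sum_(n < N) (p n - q n) * dbump rho (x - q n).

Let eta0 : 0 <= eta.
Proof.
rewrite etaE; case: N p q pq => [|N'] p' q' pq'; first by rewrite mulr0 !mul0r.
by rewrite divr_ge0 ?(ltW rho0)// !mulr_ge0// (le_trans (normr_ge0 _) (pq' ord0)).
Qed.

Lemma is_derive_moving (x : R) : is_derive x 1 moving (dmoving x).
Proof.
have h n : is_derive x 1 (fun t => (p n - q n) * bump rho (t - q n))
    ((p n - q n) * dbump rho (x - q n)).
  have := is_deriveZ (p n - q n) (is_derive_shift (is_derive_plateau (- (2 * rho)) rho rho (x - q n))).
  exact.
have h1 := is_derive_cst_sum 0 h.
have h2 := is_deriveD (is_derive_id x 1) h1.
rewrite (_ : moving = id + (fun t => 0 + \sum_(n < N) (p n - q n) * bump rho (t - q n)))//.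
by apply/funext => t; rewrite /moving fctE add0r.
Qed.

Lemma dmoving_continuous : continuous dmoving.
Proof.
move=> x; apply: cvgD; first exact: cvg_cst.
apply: (continuous_sum_fun (h := fun n t => (p n - q n) * dbump rho (t - q n))) => n {}x.
apply: cvgM; first exact: cvg_cst.
exact: (continuous_shift (@dplateau_continuous _ _ _ _)).
Qed.

Lemma dmoving_itv x : 1 - eta <= dmoving x <= 1 + eta.
Proof.
suff : `|\sum_(n < N) (p n - q n) * dbump rho (x - q n)| <= eta.
  by rewrite ler_norml /dmoving => /andP[? ?]; apply/andP; split; lra.
apply: le_trans (ler_norm_sum _ _ _) _.
apply: (@le_trans _ _ (\sum_(n < N) r * (2 / rho))).
  by apply: ler_sum => n _; rewrite normrM ler_pM// dbump_bound.
rewrite sumr_const card_ord -mulr_natl etaE; lra.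
Qed.

Lemma moving_core x n : `|x - q n| <= rho -> moving x = x + (p n - q n) /\ dmoving x = 1.
Proof.
move=> xn; have r0 := rho0.
have far k : k != n -> 2 * rho <= `|x - q k|.
  move=> kn; have [_ /(_ _ _ kn) s] := sep.
  have := ler_distD x (q k) (q n); rewrite (distrC (q k) x); lra.
split.
  rewrite /moving (bigD1 n)//= bump1// mulr1 big1 ?addr0// => k /far kn.
  by rewrite bump0 ?mulr0.
rewrite /dmoving (bigD1 n)//= (dbump0 rho0 (or_introl xn)) mulr0 add0r big1 ?addr0// => k /far kn.
by rewrite dbump0 ?mulr0//; right.
Qed.

Lemma moving_outside x : 1 <= `|x| -> moving x = x.
Proof.
move=> x1; rewrite /moving big1 ?addr0// => k _; rewrite bump0 ?mulr0//.
have [/(_ k)/andP[k1 k2] _] := sep.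
have : `|q k| <= 1 - 2 * rho by rewrite ler_norml; apply/andP; split; lra.
have := ler_distD (q k) x 0; rewrite !subr0; lra.
Qed.

Lemma moving_lt : {homo moving : x y / x < y}.
Proof.
move=> x y xy; have /andP[h _] := derive_itv_increment is_derive_moving dmoving_itv (ltW xy).
rewrite -subr_gt0; apply: lt_le_trans h; rewrite mulr_gt0 ?subr_gt0//.
move: eta_le; lra.
Qed.

Lemma moving_diffeo : diffeo moving dmoving.
Proof.
split; [exact: moving_lt| |exact: is_derive_moving|exact: dmoving_continuous|]; last first.
  by move=> x; have /andP[h _] := dmoving_itv x; move: eta_le; lra.
move=> y; have [y1|y1] := leP 1 `|y|; first by exists y; exact: moving_outside.
have cf : {within `[-1, 1], continuous moving}.
  by apply: continuous_subspaceT => t; exact: is_derive_cont (is_derive_moving t).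
have e1 : moving (-1) = -1 by rewrite moving_outside// normrN normr1.
have e2 : moving 1 = 1 by rewrite moving_outside// normr1.
have le11 : -1 <= 1 :> R by lra.
have yy : Num.min (moving (-1)) (moving 1) <= y <= Num.max (moving (-1)) (moving 1).
  rewrite e1 e2 min_l// max_r//.
  by move: y1; rewrite ltr_norml => /andP[? ?]; apply/andP; split; exact: ltW.
by have [c _ <-] := IVT le11 cf yy; exists c.
Qed.

(** The map sends the core of q n onto the core of p n, and it is
    increasing. *)
Lemma moving_same_core s t : same_core rho p (moving s) (moving t) -> same_core rho q s t.
Proof.
have mono := diffeo_mono moving_lt.
have inv n x : `|moving x - p n| <= rho -> `|x - q n| <= rho.
  have [e1 _] : moving (q n - rho) = q n - rho + (p n - q n) /\ dmoving (q n - rho) = 1.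
    by apply: moving_core; rewrite addrAC subrr sub0r normrN gtr0_norm.
  have [e2 _] : moving (q n + rho) = q n + rho + (p n - q n) /\ dmoving (q n + rho) = 1.
    by apply: moving_core; rewrite addrAC subrr add0r gtr0_norm.
  rewrite !ler_distl => /andP[h1 h2].
  rewrite -mono e1 -[x <= _]mono e2; apply/andP; split; lra.
move=> /existsP[n /andP[h1 h2]]; apply/existsP; exists n.
by apply/andP; split; exact: inv.
Qed.

(** Inside a core nothing changes under a translation.  Elsewhere the
    difference quotients of the map lie between 1 - eta and 1 + eta, and so
    do the Jacobian factors. *)
Lemma quot_moving_le (f : R -> R) s t :
  quot (f \o moving) s t <= dmoving s * dmoving t *
    (quot f (moving s) (moving t) +
     16 * eta * (if same_core rho p (moving s) (moving t) then 0 else quot f (moving s) (moving t))).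
Proof.
have e2 := eta_le; have e0 := eta0.
have Q0 : 0 <= quot f (moving s) (moving t) by exact: quot_ge0.
have th x : 0 <= dmoving x by have /andP[h _] := dmoving_itv x; lra.
have [/existsP[n /andP[sn tn]]|out] := boolP (same_core rho q s t).
  have [ms ds] := moving_core sn; have [mt dt] := moving_core tn.
  rewrite ds dt !mul1r; apply: (@le_trans _ _ (quot f (moving s) (moving t))); last first.
    by rewrite lerDl mulr_ge0 ?mulr_ge0//; case: ifP.
  rewrite /quot/=; rewrite le_eqVlt; apply/orP; left; apply/eqP; congr (_ / _ ^+ 2).
  rewrite ms mt; lra.
have -> : same_core rho p (moving s) (moving t) = false.
  by apply/negbTE; apply: contra out; exact: moving_same_core.
have [->|st] := eqVneq s t.
  rewrite {1}/quot subrr expr0n mul0r; apply: mulr_ge0; first exact: mulr_ge0.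
  by apply: addr_ge0; [|apply: mulr_ge0; [exact: mulr_ge0|]]; exact: quot_ge0.
have st0 : 0 < (s - t) ^+ 2 by rewrite exprn_even_gt0//= subr_eq0.
have Dle : (moving s - moving t) ^+ 2 <= (1 + eta) ^+ 2 * (s - t) ^+ 2.
  rewrite -exprMn -[leLHS]real_normK ?num_real// -[leRHS]real_normK ?num_real//.
  rewrite lerXn2r ?nnegrE// normrM [`|1 + eta|]ger0_norm; last lra.
  wlog ts : s t {out st st0 Q0} / t <= s.
    move=> H; have [/H//|/ltW/H] := leP t s.
    by rewrite distrC (distrC t).
  have /andP[h1 h2] := derive_itv_increment is_derive_moving dmoving_itv ts.
  by rewrite !ger0_norm ?subr_ge0 ?(diffeo_mono moving_lt).
have Y0 : 0 < (moving s - moving t) ^+ 2.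
  rewrite exprn_even_gt0//= subr_eq0; move: st; rewrite !neq_lt.
  by case/orP => /moving_lt ->; rewrite ?orbT.
rewrite -[X in X + 16 * eta * _]mul1r -mulrDl mulrA.
have /andP[s1 _] := dmoving_itv s; have /andP[t1 _] := dmoving_itv t.
have thth : (1 + eta) ^+ 2 <= dmoving s * dmoving t * (1 + 16 * eta).
  have h : (1 - eta) * (1 - eta) <= dmoving s * dmoving t by apply: ler_pM => //; lra.
  apply: (@le_trans _ _ ((1 - eta) * (1 - eta) * (1 + 16 * eta))); last first.
    by rewrite ler_wpM2r//; lra.
  rewrite expr2.
  (* (1 - eta)^2 (1 + 16 eta) - (1 + eta)^2 is four times this product. *)
  have h1 : 0 <= eta * ((1 - 2 * eta) * (3 - 2 * eta)).
    by apply: mulr_ge0 => //; apply: mulr_ge0; lra.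
  lra.
apply: le_trans (ler_wpM2r Q0 thth).
rewrite /quot/= mulrCA ler_wpM2l ?sqr_ge0//.
by rewrite -ler_pdivrMr// in Dle *; rewrite ler_pdivlMr// mulrC.
Qed.

(** The factors dmoving s and dmoving t are the Jacobians of the
    substitution in each variable. *)
Lemma total_energy_moving (f : R -> R) : measurable_fun setT (f : RR -> R) ->
  (total_energy (f \o moving) <=
   total_energy f + (16 * eta)%:E * off_energy rho p f)%E.
Proof.
move=> mf; have dM := moving_diffeo; have e0 := eta0.
have mM : measurable_fun setT (moving : RR -> RR) by exact: diffeo_measurable dM.
have mth : measurable_fun setT (dmoving : RR -> R) by exact: diffeo_derivative_measurable dM.
have th0 x : 0 <= dmoving x by case: dM.
pose u (z : RR * RR) : \bar R := (quot f z.1 z.2)%:E.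
pose v (z : RR * RR) : \bar R := if same_core rho p z.1 z.2 then 0%E else u z.
pose k (z : RR * RR) : \bar R := (u z + (16 * eta)%:E * v z)%E.
have mU : measurable_fun setT u by apply/measurable_EFinP; exact: measurable_quot.
have mv : measurable_fun setT v.
  by apply: measurable_fun_ifT => //; exact: measurable_same_core.
have mev : measurable_fun setT (fun z => ((16 * eta)%:E * v z)%E) by exact: emeasurable_funM.
have mk : measurable_fun setT k by exact: emeasurable_funD.
have u0 z : (0 <= u z)%E by rewrite lee_fin quot_ge0.
have v0 z : (0 <= v z)%E by rewrite /v; case: ifP.
have ev0 z : (0 <= (16 * eta)%:E * v z)%E by rewrite mule_ge0// lee_fin mulr_ge0.
have k0 z : (0 <= k z)%E by exact: adde_ge0.
have mI (g : RR * RR -> \bar R) : measurable_fun setT g -> (forall z, 0 <= g z)%E ->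
    measurable_fun setT (fun s => \int[mu]_t g (s, t))%E.
  by move=> mg g0; exact: (measurable_fun_fubini_tonelli_F g).
have -> : (total_energy f + (16 * eta)%:E * off_energy rho p f =
    \int[mu]_s \int[mu]_t k (s, t))%E.
  have -> : ((16 * eta)%:E * off_energy rho p f =
      \int[mu]_s \int[mu]_t ((16 * eta)%:E * v (s, t)))%E.
    rewrite -ge0_integralZl//; first last.
    - by rewrite lee_fin mulr_ge0.
    - by move=> s _; apply: integral_ge0 => t _; exact: (v0 (s, t)).
    - exact: mI mv v0.
    apply: eq_integral => s _; rewrite -ge0_integralZl//.
    - exact: (measurable_fun_pair2 s mv).
    - by move=> t _; exact: (v0 (s, t)).
    - by rewrite lee_fin mulr_ge0.
  transitivity (\int[mu]_s \int[mu]_t u (s, t) +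
      \int[mu]_s \int[mu]_t ((16 * eta)%:E * v (s, t)))%E; first by [].
  rewrite ge0_integralDT.
  - apply: eq_integral => s _; rewrite ge0_integralDT.
    + by [].
    + exact: (measurable_fun_pair2 s mU).
    + by move=> t; exact: (u0 (s, t)).
    + exact: (measurable_fun_pair2 s mev).
    + by move=> t; exact: (ev0 (s, t)).
  - exact: mI mU u0.
  - by move=> s; apply: integral_ge0 => t _; exact: (u0 (s, t)).
  - exact: mI mev ev0.
  - by move=> s; apply: integral_ge0 => t _; exact: (ev0 (s, t)).
have mMM : measurable_fun setT (fun z : RR * RR => (moving z.1, moving z.2) : RR * RR).
  by apply: measurable_fun_pair; apply: (measurableT_comp mM).
rewrite (ge0_integral_subst dM (mI _ mk k0)); last first.
  by move=> s; apply: integral_ge0 => t _; exact: (k0 (s, t)).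
pose G (z : RR * RR) : \bar R := ((dmoving z.1)%:E * (k (moving z.1, moving z.2) * (dmoving z.2)%:E))%E.
have mG : measurable_fun setT G.
  apply: emeasurable_funM; first by apply/measurable_EFinP; exact: (measurableT_comp mth).
  apply: emeasurable_funM; first exact: (measurableT_comp mk mMM).
  by apply/measurable_EFinP; exact: (measurableT_comp mth).
have G0 z : (0 <= G z)%E by rewrite /G !mule_ge0 ?lee_fin.
have GE s : (\int[mu]_t k (moving s, t) * (dmoving s)%:E = \int[mu]_t G (s, t))%E.
  have mks := measurable_fun_pair2 (moving s) mk.
  rewrite (ge0_integral_subst dM mks); last by move=> t; exact: (k0 (moving s, t)).
  rewrite muleC -ge0_integralZl//.
  - apply: emeasurable_funM; last exact/measurable_EFinP.
    exact: (measurableT_comp mks mM).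
  - by move=> t _; rewrite mule_ge0 ?lee_fin.
  - by rewrite lee_fin.
under [leRHS]eq_integral do rewrite GE.
pose g (z : RR * RR) : \bar R := (quot (f \o moving) z.1 z.2)%:E.
have mg : measurable_fun setT g.
  by apply/measurable_EFinP; apply: measurable_quot; exact: measurableT_comp.
have g0 z : (0 <= g z)%E by rewrite lee_fin quot_ge0.
apply: ge0_le_integralT.
- exact: mI mg g0.
- by move=> s; apply: integral_ge0 => t _; exact: (g0 (s, t)).
- exact: mI mG G0.
move=> s; apply: ge0_le_integralT.
- exact: (measurable_fun_pair2 s mg).
- by move=> t; exact: (g0 (s, t)).
- exact: (measurable_fun_pair2 s mG).
move=> t; have := quot_moving_le f s t; rewrite -lee_fin => /le_trans; apply.
rewrite /G /k /u /v/=; case: ifP => _; rewrite ?mule0 ?adde0 -?EFinM -?EFinD -?EFinM lee_fin; lra.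
Qed.

Variables (alpha : R) (d : 'I_N -> R).

Lemma moving_itv x : (-1 < moving x < 1) = (-1 < x < 1).
Proof.
have mono := leW_mono (diffeo_mono moving_lt).
have e1 : moving (-1) = -1 by rewrite moving_outside// normrN normr1.
have e2 : moving 1 = 1 by rewrite moving_outside// normr1.
by rewrite -{1}e1 -{2}e2 !mono.
Qed.

Lemma moving_admissible m : admissible alpha p d m -> admissible alpha q d (m \o moving).
Proof.
move=> [[h1 h2 S] mp mm1 m1].
have e1 : moving (-1) = -1 by rewrite moving_outside// normrN normr1.
have e2 : moving 1 = 1 by rewrite moving_outside// normr1.
have thM x : dmoving x <= 1 + eta by have /andP[] := dmoving_itv x.
have [h1' h2' _] := comp_diffeo_dirichlet moving_diffeo thM e1 e2 h1 h2.
split.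
- split => // x; rewrite in_itv/= => x1; apply: S; rewrite in_itv/=.
  have mono := diffeo_mono moving_lt.
  by rewrite -e1 -{2}e2 !mono.
- move=> n; have [e _] : moving (q n) = q n + (p n - q n) /\ dmoving (q n) = 1.
    by apply: moving_core; rewrite subrr normr0 ltW.
  by rewrite /= e addrC subrK mp.
- by rewrite /= e1.
- by rewrite /= e2.
Qed.

(** The self-energies of the walls, which are of order 1 / L, do not appear
    in the error. *)
Lemma moving_energy eps m : 0 < eps -> H1S1 m ->
  (energy alpha eps (m \o moving) <= energy alpha eps m +
    ((eps / 2 * eta * fine (dirichlet m))%:E +
     (4 * eta / pi)%:E * off_energy rho p (profile alpha m)))%E.
Proof.
move=> eps0 mS; have [h1 h2 _] := mS.
have e1 : moving (-1) = -1 by rewrite moving_outside// normrN normr1.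
have e2 : moving 1 = 1 by rewrite moving_outside// normr1.
have thM x : dmoving x <= 1 + eta by have /andP[] := dmoving_itv x.
have [_ _ dle] := comp_diffeo_dirichlet moving_diffeo thM e1 e2 h1 h2.
have p0 : 0 < pi :> R by exact: pi_gt0.
have prE : profile alpha (m \o moving) = profile alpha m \o moving.
  by apply/funext => x; rewrite /= !profileE moving_itv.
have te := total_energy_moving (measurable_profile alpha mS).
rewrite !energyE prE.
apply: le_trans (leeD (lee_wpmul2l _ dle) (lee_wpmul2l _ te)) _.
- by rewrite lee_fin divr_ge0// ltW.
- by rewrite lee_fin invr_ge0 mulr_ge0// ltW.
rewrite -(fineK (dirichlet_fin_num mS)) -!EFinM.
rewrite ge0_muleDr ?total_energy_ge0//; last first.
  by rewrite mule_ge0 ?off_energy_ge0// lee_fin mulr_ge0.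
rewrite muleA -EFinM.
rewrite addeACA; apply: leeD; first by rewrite -EFinD lee_fin; lra.
apply: leeD => //; rewrite (_ : (4 * pi)^-1 * (16 * eta) = 4 * eta / pi)//.
by rewrite invfM; lra.
Qed.

End transfer.

(** * Comparison of the infima *)

Section final.
Context {R : realType}.
Local Notation mu := (@lebesgue_measure R).
Local Notation RR := (measurableTypeR R).
Local Notation Kln := (@Kln R).
Local Notation Ksqrt := (@Ksqrt R).

Lemma exists_pos_lower_bound (I : finType) (f : I -> R) : (forall i, 0 < f i) ->
  exists rho, [/\ 0 < rho, rho <= 1 & forall i, rho <= f i].
Proof.
move=> f0; exists (\big[Num.min/1]_i f i); split.
- by apply: lt_bigmin => // i _; exact: f0.
- by rewrite bigmin_idl ge_min lexx.
- by move=> i; rewrite (bigminD1 i)// ge_min lexx.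
Qed.

(** The radius is chosen with twice the margins required of a, so that it
    serves all configurations close to a. *)
Lemma exists_separated (N : nat) (a : 'I_N -> R) : positions a ->
  exists rho, [/\ 0 < rho, rho <= 1 & forall b, (forall n, `|b n - a n| <= rho) -> separated rho b].
Proof.
move=> [a1 a2].
pose f (ij : 'I_N * 'I_N) := Num.min ((a ij.1 + 1) / 4) (Num.min ((1 - a ij.1) / 4)
   (if ij.1 == ij.2 then 1 else `|a ij.1 - a ij.2| / 8)).
have f0 ij : 0 < f ij.
  have /andP[h1 h2] := a1 ij.1; rewrite !lt_min; apply/and3P; split.
  - lra.
  - lra.
  - case: ifPn => // nij; rewrite divr_gt0// normr_gt0 subr_eq0.
    case: (ltngtP ij.1 ij.2) => [h|h|/val_inj h].
    + by rewrite lt_eqF// a2.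
    + by rewrite gt_eqF// a2.
    + by rewrite h eqxx in nij.
have [rho [r0 r1 rf]] := exists_pos_lower_bound f0; exists rho; split => // b ba.
have rfi i j := rf (i, j).
split=> [n|i j ij].
  have := rfi n n; rewrite !le_min/= => /and3P[h1 h2 _].
  by have := ba n; rewrite ler_distl => /andP[? ?]; apply/andP; split; lra.
have := rfi i j; rewrite !le_min/= (negbTE ij) => /and3P[_ _ h].
have := ler_distD (b i) (a i) (a j); have := ler_distD (b j) (b i) (a j).
have := ba i; have := ba j; rewrite (distrC (a i) (b i)); lra.
Qed.

Section delta.
Variables (rho eps Kp : R).
Hypothesis rho0 : 0 < rho.
Hypothesis rho1 : rho <= 1.
Hypothesis Kp1 : 1 <= Kp.
Hypothesis eps0 : 0 < eps.
Hypothesis eps1 : eps <= 1 / 4.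

Let x := ln (1 / eps).
Let delta := eps * x.
(** The factor kappa in sig = kappa delta.  The exponential makes L at least
    8, and Kp makes the error in the cores small. *)
Definition core_ratio : R := rho * expR (-8) / Kp.
Let sig := core_ratio * delta.
Let L := ln (rho / sig).

Let eV : 0 < 1 / eps. Proof. by rewrite divr_gt0. Qed.

Lemma log_ge1 : 1 <= x.
Proof.
have h := @ln_le_sub1 R (1 / 2) (divr_gt0 ltr01 (ltr0n _ 2)).
have : ln (1 / 2) *+ 2 = ln (1 / 4) :> R.
  by rewrite mulr2n -lnM ?posrE ?divr_gt0//; congr ln; lra.
rewrite mulr2n => h2.
rewrite /x div1r lnV ?posrE//.
have : ln eps <= ln (1 / 4) by rewrite ler_ln ?posrE ?divr_gt0.
lra.
Qed.

Lemma delta_itv : 0 < delta < 1.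
Proof.
have x1 := log_ge1; have x0 : 0 < x by exact: lt_le_trans x1.
rewrite /delta mulr_gt0//=; have h := ln_le_sub1 eV; rewrite -/x in h.
have e : eps * (1 / eps) = 1 by rewrite mulrC divfK// gt_eqF.
have := ler_wpM2l (ltW eps0) h; rewrite mulrBr e mulr1; move: eps0; lra.
Qed.

Lemma log_delta : - ln delta = x - ln x.
Proof.
have x1 := log_ge1; have x0 : 0 < x by exact: lt_le_trans x1.
by rewrite /delta lnM ?posrE// opprD; congr (_ + _); rewrite /x div1r lnV ?posrE.
Qed.

Lemma log_delta_itv : x / 2 <= - ln delta <= x.
Proof.
have x1 := log_ge1; have x0 : 0 < x by exact: lt_le_trans x1.
rewrite log_delta gerBl ln_ge0// andbT.
have h := @ln_le_sub1 R (x / 2) (divr_gt0 x0 (ltr0n _ 2)).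
rewrite ln_div ?posrE// in h.
have := @ln_le_sub1 R 2 (ltr0n _ 2); lra.
Qed.

Lemma core_ratio_gt0 : 0 < core_ratio.
Proof. by rewrite divr_gt0 ?mulr_gt0 ?expR_gt0// (lt_le_trans ltr01). Qed.

Lemma core_gt0 : 0 < sig.
Proof. by rewrite mulr_gt0 ?core_ratio_gt0//; have /andP[] := delta_itv. Qed.

Lemma core_logE : L = 8 + ln Kp - ln delta.
Proof.
have /andP[d0 _] := delta_itv; have K0 : 0 < Kp by exact: lt_le_trans Kp1.
rewrite /L /sig /core_ratio ln_div ?posrE//; last exact: core_gt0.
rewrite lnM ?posrE//; last exact: core_ratio_gt0.
rewrite ln_div ?posrE// ?mulr_gt0 ?expR_gt0// lnM ?posrE ?expR_gt0// expRK; lra.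
Qed.

Lemma core_log_ge : 8 <= L /\ - ln delta <= L.
Proof.
have lK : 0 <= ln Kp by exact: ln_ge0.
have /andP[l1 _] := log_delta_itv; have x1 := log_ge1.
rewrite core_logE; split; lra.
Qed.

Lemma core_lt : sig < rho.
Proof.
have [L8 _] := core_log_ge; rewrite ltNge; apply/negP => h.
have : L <= 0 by rewrite /L ln_le0// ler_pdivrMr ?core_gt0// mul1r.
lra.
Qed.

(** ln (1 / delta) is at least half of ln (1 / eps), hence sig = kappa eps
    ln (1 / eps) is of order kappa eps L. *)
Lemma core_small : Kp * sig <= 2 * eps * L.
Proof.
have K0 : 0 < Kp by exact: lt_le_trans Kp1.
have [_ h] := core_log_ge; have /andP[l1 _] := log_delta_itv.
have x1 := log_ge1.
have -> : Kp * sig = rho * expR (-8) * (eps * x) * (Kp / Kp) by rewrite /sig /core_ratio /delta; lra.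
rewrite divff ?gt_eqF// mulr1.
have e8 : expR (-8) <= 1 :> R by rewrite expR_le1; lra.
have re : rho * expR (-8) <= 1 by rewrite mulr_ile1// ?expR_ge0// ltW.
have ex : 0 <= eps * x by rewrite mulr_ge0 ?(ltW eps0)//; lra.
have := ler_wpM2r ex re; have : eps * x <= eps * (2 * L) by rewrite ler_pM2l//; lra.
lra.
Qed.

(** Conversely L is at most a multiple of ln (1 / eps): this bounds the
    Dirichlet energy eps / (L sig) of the competitor by O(1 / L^2). *)
Lemma core_large : core_ratio * (eps * L) <= (9 + ln Kp) * sig.
Proof.
have lK : 0 <= ln Kp by exact: ln_ge0.
have /andP[_ l2] := log_delta_itv; have x1 := log_ge1; have k0 := core_ratio_gt0.
rewrite /sig [leRHS]mulrCA ler_pM2l// /delta [leRHS]mulrCA ler_pM2l//.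
have : L <= 8 + ln Kp + x by rewrite core_logE; lra.
have : ln Kp * 1 <= ln Kp * x by rewrite ler_wpM2l.
lra.
Qed.

End delta.

Section comparison.
Variables (alpha : R) (N : nat) (d : 'I_N -> R) (rho : R).
Hypothesis halpha : 0 < alpha < pi.
Hypothesis hd : signs d.
Hypothesis rho0 : 0 < rho.
Hypothesis rho1 : rho <= 1.

Local Notation Gamma := (Gamma alpha d).

Definition Kp : R := 16 * N%:R * Kln + 1.
Definition etaL : R := (72 * N%:R * Ksqrt + 1)^-1.
Definition Clow : R := 2 * N%:R * Ksqrt / (pi * etaL * rho).
Definition Cup : R := 8 * (Kln * Gamma / pi) + 32 * (N%:R ^+ 2 / pi) +
  N%:R ^+ 2 * Kdir alpha * pi * ((9 + ln Kp) / core_ratio rho Kp).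

Let pi0 : 0 < pi :> R. Proof. exact: pi_gt0. Qed.

Lemma Kp_ge1 : 1 <= Kp.
Proof. by rewrite /Kp lerDr !mulr_ge0 ?Kln_ge0. Qed.

Let Kp1 := Kp_ge1.

Let etaL0 : 0 < etaL.
Proof. by rewrite invr_gt0 ltr_wpDl// !mulr_ge0 ?Ksqrt_ge0. Qed.

Lemma Gamma_ge0 : 0 <= Gamma.
Proof. by apply: sumr_ge0 => n _; exact: sqr_ge0. Qed.

Lemma Clow_ge0 : 0 <= Clow.
Proof. by rewrite divr_ge0 ?mulr_ge0 ?Ksqrt_ge0// ltW. Qed.

Let kap0 : 0 < core_ratio rho Kp. Proof. exact: core_ratio_gt0. Qed.

Lemma Cup_ge0 : 0 <= Cup.
Proof.
have h1 : 0 <= 8 * (Kln * Gamma / pi) by rewrite mulr_ge0// divr_ge0 ?(ltW pi0)// mulr_ge0 ?Kln_ge0 ?Gamma_ge0.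
have h2 : 0 <= 32 * (N%:R ^+ 2 / pi) :> R by rewrite mulr_ge0// divr_ge0 ?sqr_ge0 ?(ltW pi0).
have h3 : 0 <= (9 + ln Kp) / core_ratio rho Kp by rewrite divr_ge0 ?addr_ge0 ?ln_ge0 ?(ltW kap0).
have h4 : 0 <= N%:R ^+ 2 * Kdir alpha * pi.
  by rewrite mulr_ge0 ?(ltW pi0)// mulr_ge0 ?sqr_ge0 ?Kdir_ge0.
by apply: addr_ge0; [exact: addr_ge0|exact: mulr_ge0].
Qed.

Variable eps : R.
Hypothesis eps0 : 0 < eps.
Hypothesis eps1 : eps <= 1 / 4.

Local Notation delta_of := (eps * ln (1 / eps)).
Let sig := core_ratio rho Kp * delta_of.
Let L := ln (rho / sig).

Let sig0 : 0 < sig. Proof. exact: core_gt0. Qed.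
Let L8 : 8 <= L. Proof. by have [] := core_log_ge rho0 Kp1 eps0 eps1. Qed.
Let L0 : 0 < L. Proof. exact: lt_le_trans L8. Qed.

Definition leading : R := Kln * Gamma / (pi * L).

(** Passing from ell = L - 4 to L costs 8 / L^2 in the leading term, because
    L is at least 8. *)
Lemma inf_energy_upper (p : 'I_N -> R) : separated rho p ->
  (inf_energy alpha eps p d <= (leading + Cup / L ^+ 2)%:E)%E.
Proof.
move=> sep; have ell1 : 1 <= L - 4 by move: L8; lra.
have ell0 : 0 < L - 4 by exact: lt_le_trans ell1.
have lrho : L - 4 + 4 <= ln (rho / sig) by rewrite subrK.
have := competitor_energy halpha hd sig0 ell1 rho0 lrho sep eps0.
have adm := competitor_admissible halpha hd sig0 ell1 rho0 lrho sep.
move=> h; apply: ereal_inf_le.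
exists (energy alpha eps (competitor alpha d p sig (L - 4))).
  by exists (competitor alpha d p sig (L - 4)).
apply: le_trans h _; rewrite lee_fin.
have := core_large rho0 Kp1 eps0 eps1.
set c9 := 9 + ln Kp; rewrite -/sig -/L => large.
rewrite /leading /Cup -/c9 (invfM pi (L - 4)) (invfM pi (_ ^+ 2)) (invfM (2 * (L - 4)) sig).
rewrite (invfM 2 (L - 4)) (invfM pi L) -[(_ ^+ 2)^-1]exprVn -[in X in _ <= X]exprVn.
set i := L^-1; set j := (L - 4)^-1; set P := pi^-1.
have i0 : 0 < i by rewrite invr_gt0.
have j0 : 0 < j by rewrite invr_gt0.
have Li : L * i = 1 by rewrite divff// gt_eqF.
have lj : (L - 4) * j = 1 by rewrite divff// gt_eqF.
have j2 : j <= 2 * i.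
  rewrite -(ler_pM2l ell0) lj; have := ler_wpM2l (ltW i0) L8; lra.
have jij : j = i + 4 * (i * j).
  have : i * ((L - 4) * j) = i by rewrite lj mulr1.
  have : (L * i) * j = j by rewrite Li mul1r.
  lra.
have ij2 : i * j <= 2 * i ^+ 2.
  by have := ler_wpM2l (ltW i0) j2; rewrite expr2; lra.
have jle : j <= i + 8 * i ^+ 2 by lra.
have jj : j ^+ 2 <= 4 * i ^+ 2.
  by have := ler_pM (ltW j0) (ltW j0) j2 j2; rewrite !expr2; lra.
have es : eps / sig <= c9 / core_ratio rho Kp * i.
  rewrite ler_pdivrMr// -(ler_pM2l kap0) -(ler_pM2l L0).
  rewrite (_ : L * (_ * (_ * _)) = (core_ratio rho Kp / core_ratio rho Kp) * (L * i) * (c9 * sig)); last lra.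
  rewrite divff ?gt_eqF// Li !mul1r; lra.
set c := c9 / core_ratio rho Kp in es *.
have KG0 : 0 <= Kln * Gamma * P by rewrite !mulr_ge0 ?Kln_ge0 ?Gamma_ge0// invr_ge0 ltW.
have NP0 : 0 <= N%:R ^+ 2 * P by rewrite mulr_ge0 ?sqr_ge0// invr_ge0 ltW.
have ND0 : 0 <= N%:R ^+ 2 * Kdir alpha * pi by rewrite !mulr_ge0 ?sqr_ge0 ?Kdir_ge0// ltW.
have h1 := ler_wpM2l KG0 jle.
have h2 := ler_wpM2l NP0 jj.
have es0 : 0 <= eps / sig by rewrite divr_ge0// ltW.
have jes : j * (eps / sig) <= 2 * i * (c * i) by apply: ler_pM => //; exact: ltW.
have h3 := ler_wpM2l ND0 jes.
move: h1 h2 h3.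
rewrite !expr2; lra.
Qed.

Lemma core_condition : 8 * N%:R * Kln * sig / (4 * pi * L) <= eps / 4.
Proof.
have := core_small rho0 rho1 Kp1 eps0 eps1; rewrite -/sig -/L /Kp => small.
rewrite ler_pdivrMr ?mulr_gt0//.
have := @pi_ge2 R; have eL : 0 <= eps * L by rewrite mulr_ge0// ltW.
move=> /(ler_wpM2l eL); move: small sig0; lra.
Qed.

(** The leading terms of the lower and the upper bound coincide, so the
    surplus in energy_lower is at most the sum of the remainders. *)
Lemma excess_energy (p : 'I_N -> R) (m : R -> R * R) (tau : R) :
  separated rho p -> admissible alpha p d m ->
  (energy alpha eps m <= (leading + Cup / L ^+ 2 + tau)%:E)%E ->
  exists Q, off_energy rho p (profile alpha m) = Q%:E /\
    eps / 4 * fine (dirichlet m) + Q / (8 * pi) <= (Cup + Clow) / L ^+ 2 + tau.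
Proof.
move=> sep [mS mp _ _] mE.
have sigrho : sig < rho by exact: core_lt.
have etale : 72 * N%:R * Ksqrt * etaL <= 1.
  by rewrite /etaL ler_pdivrMr ?mul1r ?lerDl//; rewrite ltr_wpDl// !mulr_ge0 ?Ksqrt_ge0.
have := energy_lower alpha hd (erefl L : L = ln (rho / sig)) mS sig0 sigrho sep mp etaL0 etale core_condition.
rewrite -/leading -/Clow.
have := off_energy_ge0 rho p (profile alpha m).
set O1 := off_energy _ _ _; move=> O0 low.
have {low} := le_trans low (leeD mE (lexx _)).
have i8 : 0 < (8 * pi)^-1 :> R by rewrite invr_gt0 mulr_gt0.
case: O1 O0 => [Q|_|//]; last first.
  by rewrite gt0_muley ?lte_fin//= -EFinD leNgt ltry.
rewrite lee_fin => Q0; rewrite -EFinM -!EFinD lee_fin => h.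
by exists Q; split => //; move: h; lra.
Qed.

Lemma energy_ge0 (m : R -> R * R) : (0 <= energy alpha eps m)%E.
Proof.
rewrite energyE adde_ge0// mule_ge0 ?dirichlet_ge0 ?total_energy_ge0// lee_fin.
  by rewrite divr_ge0// ltW.
by rewrite invr_ge0 mulr_ge0// ltW.
Qed.

Lemma inf_energy_fin (p : 'I_N -> R) : separated rho p ->
  inf_energy alpha eps p d \is a fin_num.
Proof.
move=> sep; rewrite ge0_fin_numE; first exact: le_lt_trans (inf_energy_upper sep) (ltry _).
by apply: le_ereal_inf_tmp => _ [m _ <-]; exact: energy_ge0.
Qed.

(** Move the walls of a near-minimizer: the error in moving_energy is at
    most 32 eta times its excess energy. *)
Lemma inf_energy_compare (p q : 'I_N -> R) (r eta : R) :
  separated rho p -> separated rho q -> (forall n, `|p n - q n| <= r) ->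
  eta = 2 * N%:R * r / rho -> 0 <= eta -> eta <= 1 / 2 ->
  (inf_energy alpha eps q d <= inf_energy alpha eps p d +
     (32 * eta * (Cup + Clow) / L ^+ 2)%:E)%E.
Proof.
move=> sp sq pq etaE eta0 eta2.
have pfin := inf_energy_fin sp.
have pup := inf_energy_upper sp.
(* The near-minimality tau enters once directly and with weight 32 eta <= 16. *)
apply/lee_addgt0Pr => e e0; pose tau := e / 17.
have tau0 : 0 < tau by rewrite divr_gt0.
have [_ [m adm <-] mlt] := lb_ereal_inf_adherent tau0 pfin.
rewrite -/(inf_energy alpha eps p d) in mlt.
have mle : (energy alpha eps m <= (leading + Cup / L ^+ 2 + tau)%:E)%E.
  by rewrite EFinD; apply: le_trans (ltW mlt) _; apply: leeD.
have [Q [QE Qle]] := excess_energy sp adm mle.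
have [mS _ _ _] := adm.
have adm' := moving_admissible rho0 sq pq etaE eta2 adm.
have := moving_energy rho0 sq pq etaE eta2 alpha eps0 mS.
set m' := m \o _ in adm' *; rewrite QE => me.
have infle : (inf_energy alpha eps q d <= energy alpha eps m')%E.
  by apply: ereal_inf_lbound; exists m'.
apply: le_trans infle _; apply: le_trans me _.
have := leeD (ltW mlt) (lexx ((eps / 2 * eta * fine (dirichlet m))%:E +
  (4 * eta / pi)%:E * Q%:E)%E).
move/le_trans; apply; rewrite -(fineK pfin) -!EFinM -!EFinD lee_fin.
have := ler_wpM2l (mulr_ge0 (ler0n R 32) eta0) Qle.
have A0 : 0 <= eps * eta * fine (dirichlet m).
  by rewrite mulr_ge0 ?fine_ge0 ?dirichlet_ge0// mulr_ge0// ltW.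
have te : eta * tau <= 1 / 2 * tau by rewrite ler_wpM2r// ltW.
have et : e = 17 * tau by rewrite /tau mulrC divfK.
rewrite et !invfM; lra.
Qed.

End comparison.

End final.

Theorem proposition2 (R : realType) (alpha : R) (halpha : 0 < alpha < pi)
  (N : nat) (a d : 'I_N -> R) (ha : positions a) (hd : signs d) :
  forall c0 : R, 0 < c0 ->
  exists r : R, 0 < r /\
  forall b : 'I_N -> R, positions b ->
  (forall n, `|b n - a n| <= r) ->
  forall eps : R, 0 < eps <= 1 / 4 ->
  let delta := eps * ln (1 / eps) in
  (`| inf_energy alpha eps a d - inf_energy alpha eps b d |
     <= (c0 / (ln delta) ^+ 2)%:E)%E.
Proof.
move=> c0 c00; have [rho [rho0 rho1 sep]] := exists_separated ha.
pose C := Cup alpha d rho + Clow N rho.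
have C0 : 0 <= C by rewrite addr_ge0 ?Cup_ge0 ?Clow_ge0.
have N0 : 0 <= N%:R :> R by [].
have NC0 : 0 <= N%:R * C by rewrite mulr_ge0.
(* The first bound gives eta <= 1 / 2 and r <= rho, the second one 32 eta C <= c0. *)
pose r := rho * Num.min (4 * N%:R + 1)^-1 (c0 / (64 * (N%:R * C) + 1)).
have D1 : 0 < 4 * N%:R + 1 :> R by lra.
have D2 : 0 < 64 * (N%:R * C) + 1 by lra.
have r0 : 0 < r by rewrite mulr_gt0// lt_min invr_gt0 D1 divr_gt0.
exists r; split => // b hb ba eps /andP[eps0 eps1]; cbv zeta.
set delta := eps * ln (1 / eps).
set eta := 2 * N%:R * r / rho.
have rE : r / rho = Num.min (4 * N%:R + 1)^-1 (c0 / (64 * (N%:R * C) + 1)).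
  by rewrite /r mulrAC divff ?mul1r// gt_eqF.
have etaE : eta = 2 * N%:R * (r / rho) by rewrite mulrA.
have rr1 : r / rho * (4 * N%:R + 1) <= 1.
  by rewrite -ler_pdivlMr// div1r rE ge_min lexx.
have rr2 : r / rho * (64 * (N%:R * C) + 1) <= c0.
  by rewrite -ler_pdivlMr// rE ge_min lexx orbT.
have rr0 : 0 < r / rho by rewrite divr_gt0.
have eta0 : 0 <= eta by rewrite etaE; apply: mulr_ge0; [exact: mulr_ge0|exact: ltW].
have eta2 : eta <= 1 / 2 by rewrite etaE; lra.
have rrho : r <= rho.
  have : r / rho <= 1.
    by apply: le_trans rr1; rewrite -[leLHS]mulr1 ler_pM2l//; lra.
  by rewrite ler_pdivrMr// mul1r.
have sa : separated rho a by apply: sep => n; rewrite subrr normr0 ltW.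
have sb : separated rho b by apply: sep => n; exact: le_trans rrho.
have ab n : `|a n - b n| <= r by rewrite distrC.
have Hab := inf_energy_compare halpha hd rho0 rho1 eps0 eps1 sa sb ab erefl eta0 eta2.
have Hba := inf_energy_compare halpha hd rho0 rho1 eps0 eps1 sb sa ba erefl eta0 eta2.
have fa := inf_energy_fin halpha hd rho0 eps0 eps1 sa.
have fb := inf_energy_fin halpha hd rho0 eps0 eps1 sb.
have Kp1 : 1 <= @Kp R N by exact: Kp_ge1.
have [L8 dL] := core_log_ge rho0 Kp1 eps0 eps1.
have /andP[d0 d1] := delta_itv eps0 eps1.
set L := ln _ in L8 dL Hab Hba.
have L0 : 0 < L by exact: lt_le_trans L8.
have ld : 0 < - ln delta by rewrite oppr_gt0 ln_lt0// d0.
have le2 : 32 * eta * C / L ^+ 2 <= c0 / ln delta ^+ 2.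
  apply: ler_pM.
  - by apply: mulr_ge0 => //; apply: mulr_ge0.
  - by rewrite invr_ge0 sqr_ge0.
  - by rewrite etaE; lra.
  - rewrite -[ln delta ^+ 2]sqrrN lef_pV2 ?posrE ?exprn_gt0//.
    by rewrite lerXn2r ?nnegrE// ltW.
move: Hab Hba; rewrite -(fineK fa) -(fineK fb) -EFinB abse_EFin -!EFinD !lee_fin -/C => h1 h2.
rewrite -/eta in h1 h2; apply: le_trans le2.
move: h1 h2; set W := 32 * eta * C / L ^+ 2 => h1 h2.
by rewrite ler_norml; apply/andP; split; lra.
Qed.
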